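(* The numbers $\mathcal N_g(m_1,\dots,m_q)$ satisfy the initial condition $\mathcal N_0(m)=\delta_{m,1}\frac{1}{2CJ}$ (for the one-part composition $(m)$), and, whenever $2g-2+|m|+q\ge1$, for every $r\in\{1,\dots,q\}$: $$m_r\,\mathcal N_g(m_1,\dots,m_q)=\sum_{j\ne r}(m_r+m_j)\,\mathcal N_g(m_1,\dots,\hat m_j,\dots,m_r+m_j,\dots,m_q)+m_r(m_r-1)\,T\,\mathcal N_{g-\frac12}(m_1,\dots,m_q)$$ $$+\sum_{\alpha+\beta=m_r}2CJ\,\alpha\beta\Big(\mathcal N_{g-1}(m_1,\dots,\hat m_r,\alpha,\beta,\dots,m_q)+\sum_{g_1+g_2=g}\ \sum_{\substack{I_1\cup I_2=\{1,\dots,q\}\\ I_1\cap I_2=\{r\}}}\mathcal N_{g_1}\big(m_{I_1}(m_r\mapsto\beta)\big)\,\mathcal N_{g_2}\big(m_{I_2}(m_r\mapsto\alpha)\big)\Big),$$ where $\alpha,\beta\ge1$, $g_1,g_2\in\frac12\mathbb Z_{\ge0}$, $\hat m_j$ denotes omission of the part $m_j$, $m_r+m_j$ replaces $m_r$, $m_{I}(m_r\mapsto\beta)$ is the subcomposition of $(m_1,\dots,m_q)$ formed by the parts with indices in $I$ with $m_r$ replaced by $\beta$, and any $\mathcal N$ with negative genus is $0$.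
   Context: Let $[\bar n]=\{1,\bar 1,\dots,n,\bar n\}$ with the total order $1<\bar1<\cdots<n<\bar n$, $S_{2n}$ the symmetric group on it, $\tau=(1\ \bar1)\cdots(n\ \bar n)$, $\sigma.\rho=\sigma\rho\sigma^{-1}$. The type of a fixed-point-free involution $\rho$ is the partition whose parts are half the numbers of vertices of the connected components of the graph $\rho\cup\tau$ on $[\bar n]$ with edges $\{x,\rho(x)\},\{x,\tau(x)\}$. A transposition $\sigma$ has weight $C$, $J$ or $T$ ($C,J,T$ indeterminates) for $\rho$ according as the type of $\sigma.\rho$ has one more part than that of $\rho$, one fewer part, or equals it. For a composition $m=(m_1,\dots,m_q)$ of $n=|m|$ and $g\in\frac12\mathbb Z_{\ge0}$ with $k=2g-2+n+q\ge0$, consider pairs $((\sigma_1,\dots,\sigma_k),\preccurlyeq)$ where $\sigma_i=(p_i\ q_i)$ with $q_i\in\{1,\dots,n\}$, $p_i\in[\bar n]$, $p_i<q_i$; $q_1\le\cdots\le q_k$; $\langle\tau,\sigma_1,\dots,\sigma_k\rangle$ is transitive on $[\bar n]$; and, with $\varrho=\sigma_k\cdots\sigma_1.\tau$, $\preccurlyeq$ labels the connected components of $\varrho\cup\tau$ by $1,\dots,q$ so that the component labelled $j$ has $2m_j$ vertices. The weight of a pair is $\prod_{i=1}^kw(\sigma_{i-1}\cdots\sigma_1.\tau,\sigma_i)$. Define $\mathcal N_g(m_1,\dots,m_q)=\frac{1}{n!\,C^qJ^n2^n}\sum(\text{weights of all such pairs})$, and $\mathcal N_g(m)=0$ if $k<0$.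 (These numbers do not depend on the order of the parts $m_j$.)
   Formalization: The initial condition N_0(m) = δ_{m,1}/(2CJ) is stated only when 2g-2+|m|+q < 1, i.e. for m ≤ 1, since for m ≥ 2 it is false (for example N_0(2) = 1/(4CJ)). *)

(* Defs.v *)
From HB Require Import structures.
From mathcomp Require Import all_boot all_order all_algebra all_fingroup.
From mathcomp Require Import fraction.
From mathcomp.multinomials Require Import mpoly.

Set Implicit Arguments.
Unset Strict Implicit.
Unset Printing Implicit Defensive.

Import Order.TTheory GRing.Theory Num.Theory.
Local Open Scope ring_scope.

(* The weights C, J, T are algebraically independent indeterminates; the
   numbers N involve negative powers of C and J, so everything lives in the
   field of rational functions Q(C, J, T). *)
Definition QCJT : fieldType := {fraction {mpoly rat[3]}}.
Definition varC : QCJT := FracField.tofrac ('X_(inord 0) : {mpoly rat[3]}).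
Definition varJ : QCJT := FracField.tofrac ('X_(inord 1) : {mpoly rat[3]}).
Definition varT : QCJT := FracField.tofrac ('X_(inord 2) : {mpoly rat[3]}).

(* [bar n] = {1, \bar 1, ..., n, \bar n}: (i, false) stands for the unbarred
   i + 1 and (i, true) for its barred copy. *)
Definition barset (n : nat) : finType := ('I_n * bool)%type.

Definition bar_lt (n : nat) (x y : barset n) : bool :=
  ((x.1 < y.1) || ((x.1 == y.1) && (~~ x.2 && y.2)))%N.

Definition bar_flip (n : nat) (x : barset n) : barset n := (x.1, ~~ x.2).

Lemma bar_flip_inj (n : nat) : injective (@bar_flip n).
Proof. by apply: (can_inj (g := @bar_flip n)) => -[i b]; rewrite /bar_flip negbK. Qed.

Definition tau (n : nat) : {perm barset n} := perm (@bar_flip_inj n).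

Definition pair_edge (n : nat) (rho : {perm barset n}) : rel (barset n) :=
  fun x y => (y == rho x) || (y == tau n x).

Definition components (n : nat) (rho : {perm barset n}) : {set {set barset n}} :=
  [set [set y | connect (pair_edge rho) x y] | x : barset n].

Definition inv_type (n : nat) (rho : {perm barset n}) : seq nat :=
  sort geq [seq #|B|./2 | B : {set barset n} in components rho].

(* sigma . rho = sigma rho sigma^-1 with functions composed right to left; as
   permutations are multiplied left to right in the library, this is the
   conjugate (rho ^ sigma)%g = (sigma^-1 * rho * sigma)%g. *)
Definition act_inv (n : nat) (sigma rho : {perm barset n}) : {perm barset n} :=
  (rho ^ sigma)%g.

(* Conjugating by a transposition changes the number of parts by -1, 0 or 1,
   and the type is unchanged when the number of parts is. *)
Definition weight (n : nat) (rho sigma : {perm barset n}) : QCJT :=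
  let l := size (inv_type rho) in
  let l' := size (inv_type (act_inv sigma rho)) in
  if l' == l.+1 then varC else if l'.+1 == l then varJ else varT.

(* A transposition (p q) with p < q and q unbarred is recorded by the pair
   (p, q), which it determines. *)
Definition marked (n : nat) : finType := (barset n * 'I_n)%type.

Definition marked_transp (n : nat) (t : marked n) : {perm barset n} :=
  tperm t.1 (t.2, false).

(* sigma_i ... sigma_1 . tau, the first i transpositions having been applied
   (sigma_1 is s 0). *)
Definition partial_inv (n k : nat) (s : {ffun 'I_k -> marked n}) (i : nat) :
    {perm barset n} :=
  act_inv (\prod_(j < k | (j < i)%N) marked_transp (s j))%g (tau n).

Definition monotone_transitive (n k : nat) (s : {ffun 'I_k -> marked n}) : bool :=
  [&& [forall i, bar_lt (s i).1 ((s i).2, false)],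
      [forall i : 'I_k, forall j : 'I_k,
         ((i <= j) ==> ((s i).2 <= (s j).2))%N]
    & [transitive <<tau n |: [set marked_transp (s i) | i : 'I_k]>>%g,
         on [set: barset n] | 'P] ].

Definition is_labelling (m : seq nat) (n : nat) (rho : {perm barset n})
    (lab : {ffun 'I_(size m) -> {set barset n}}) : bool :=
  [&& injectiveb lab,
      [set lab j | j : 'I_(size m)] == components rho
    & [forall j, #|lab j| == (2 * nth 0 m j)%N] ].

(* The sum of the weights of all pairs with k transpositions. *)
Definition total_weight (m : seq nat) (k : nat) : QCJT :=
  \sum_(sl : {ffun 'I_k -> marked (sumn m)} *
             {ffun 'I_(size m) -> {set barset (sumn m)}}
        | monotone_transitive sl.1 && is_labelling (partial_inv sl.1 k) sl.2)
     \prod_(i < k) weight (partial_inv sl.1 i) (marked_transp (sl.1 i)).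

(* Genera are half-integers: throughout, h stands for 2g. *)
Definition num_transp (h : int) (m : seq nat) : int :=
  h - 2 + (sumn m)%:Z + (size m)%:Z.

Definition N (h : int) (m : seq nat) : QCJT :=
  if (0 <= h) && (0 <= num_transp h m) then
    total_weight m `|num_transp h m|%N /
      ((sumn m)`!%:R * varC ^+ size m * varJ ^+ sumn m * 2%:R ^+ sumn m)
  else 0.

Definition composition (m : seq nat) : bool := all (fun x => 0 < x)%N m.

(* m_I (m_r |-> a); indices are 0-based. *)
Definition subcomp (m : seq nat) (I : {set 'I_(size m)}) (r : 'I_(size m))
    (a : nat) : seq nat :=
  [seq if i == r then a else nth 0%N m i | i <- enum I].

(* m with m_r replaced by the two consecutive parts a, b. *)
Definition split_part (m : seq nat) (r a b : nat) : seq nat :=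
  take r m ++ [:: a; b] ++ drop r.+1 m.

(* Main.v *)
Require Import Defs.
From HB Require Import structures.
From mathcomp Require Import all_boot all_order all_algebra all_fingroup.
From mathcomp Require Import fraction.
From mathcomp.multinomials Require Import mpoly.
From mathcomp Require Import ring zify.
Import Order.TTheory GRing.Theory Num.Theory.
Local Open Scope ring_scope.

Set Implicit Arguments.
Unset Strict Implicit.
Unset Printing Implicit Defensive.

(* Read a sequence of transpositions backwards from the matching rho it ends
   at.  The last step (p q) of a nonempty monotone transitive sequence has q the
   largest unbarred vertex, and it weighs C when p and q lie in different
   components of rho, and J or T when they lie in one component which the step
   cuts or twists.  Dropping it gives a recursion at the component of q; the
   products come from the case in which two orbits remain, a monotone sequence on
   two orbits being a shuffle of two monotone sequences in a unique way.

   This singles out the component of the largest vertex.  To allow any component,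
   drop transitivity: the sums over all monotone sequences satisfy a linear
   recursion, and treating two components in either order gives the same result
   (commutation relations of Virasoro type), so they depend only on the type of
   rho.  Sorting sequences by the orbit of a vertex recovers the transitive sums,
   which therefore depend only on the type as well.

   Finally, a total weight is a transitive sum times the number of labelled
   matchings of the given type, which is n! 2^n / prod_j (2 m_j) by double
   counting the ways of cutting off a two-vertex component. *)

(** * The linear recursion on lists of parts *)

(** Monotonicity refers to the order of the vertices, so renaming vertices is not a symmetry of the
    sequences, and a recursion obtained at the largest vertex says nothing at first about the other
    parts. For transitive sums the recursion contains products, which would make two orders of
    treatment hard to compare; for all monotone sequences it is linear, and the comparison comes
    down to [quadratic_exchange]. Once transitive sums are functions of the type, m_r may be any
    part, because some matching of that type has the largest vertex in the r-th component.

    The n! 2^n in the count of labelled matchings cancels against the normalisation, so N_g(m) is a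
    transitive sum divided by the product of d(m_j), where d(a) = 2 a C J^a. As d(a) d(b) = (2 C a b
    / (a + b)) d(a + b), this quotient produces both coefficients m_r + m_j and 2 C J alpha beta.
    Distributing k steps over two orbits becomes distributing g, because a transitive sum with too
    few steps for a nonnegative genus vanishes. *)

Local Ltac perm_count := by apply/seq.permP => ? /=; lia.

(** Reduces invariance under permutations to exchanging the two head entries, the only case in which
    the recursion at the head has to be examined. The third premise also provides [perm_eq s t], so
    that invariance already known for shorter walks can be used on the tails. *)
Lemma perm_eq_ind (T : eqType) (P : seq T -> seq T -> Prop) :
  (forall s, P s s) ->
  (forall s t u, P s t -> P t u -> P s u) ->
  (forall x s t, perm_eq s t -> P s t -> P (x :: s) (x :: t)) ->
  (forall x y s, P [:: x, y & s] [:: y, x & s]) ->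
  forall s t, perm_eq s t -> P s t.
Proof.
move=> Pr Pt Pc Ps s; move: {2}(size s) (leqnn (size s)) => N.
elim: N s => [|N IH] [|x s] //= leN t pst.
- by have /eqP := perm_size pst; rewrite eq_sym => /nilP ->.
- by have /eqP := perm_size pst; rewrite eq_sym => /nilP ->.
case: t pst => [/perm_size //|y t] pst.
have [exy|nxy] := eqVneq x y.
  rewrite -exy perm_cons in pst *.
  by apply: Pc => //; apply: IH.
have ys : y \in s.
  by have := perm_mem pst y; rewrite !inE eqxx eq_sym (negPf nxy) /= => ->.
have p1 := perm_to_rem ys.
have p2 : perm_eq t (x :: rem y s).
  rewrite -(perm_cons y); apply: perm_trans (_ : perm_eq [:: x, y & rem y s] _).
    by rewrite perm_sym in pst; apply: perm_trans pst _; rewrite perm_cons.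
  perm_count.
have sz : (size (y :: rem y s) <= N)%N by rewrite -(perm_size p1).
have h1 : P s (y :: rem y s) by apply: IH.
have sz2 : (size (x :: rem y s) <= N)%N by [].
have h2 : P (x :: rem y s) t by apply: IH; rewrite // perm_sym.
apply: (Pt _ _ _ (Pc x _ _ p1 h1)); apply: (Pt _ _ _ (Ps _ _ _)).
by apply: Pc; rewrite // perm_sym.
Qed.

(** Choices are made by position, so equal parts are picked separately, as distinct components of
    equal size must be. *)
Fixpoint picks (T : Type) (m : seq T) : seq (T * seq T) :=
  if m is x :: m' then
    (x, m') :: [seq (y.1, x :: y.2) | y <- picks m'] else [::].

Arguments picks : simpl never.

Section Picks.
Variables (T : eqType) (R : nmodType).
Implicit Type F : T -> seq T -> R.

Lemma sum_picks_cons F x m :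
  \sum_(y <- picks (x :: m)) F y.1 y.2 =
  F x m + \sum_(y <- picks m) F y.1 (x :: y.2).
Proof. by rewrite big_cons big_map. Qed.

(** Both sides run over ordered pairs of distinct positions. *)
Lemma exchange_picks (G : T -> T -> seq T -> R) m :
  \sum_(y <- picks m) \sum_(z <- picks y.2) G y.1 z.1 z.2 =
  \sum_(y <- picks m) \sum_(z <- picks y.2) G z.1 y.1 z.2.
Proof.
elim: m G => [|x m IH] G; first by rewrite !big_nil.
rewrite (sum_picks_cons (fun y m' => \sum_(z <- picks m') G y z.1 z.2)).
rewrite (sum_picks_cons (fun y m' => \sum_(z <- picks m') G z.1 y z.2)).
under [X in _ + X = _]eq_bigr => y _ do rewrite /= (sum_picks_cons (fun z m' => G y.1 z m')).
under [X in _ = _ + X]eq_bigr => y _ do rewrite /= (sum_picks_cons (fun z m' => G z y.1 m')).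
rewrite !big_split /= addrCA; congr (_ + (_ + _)).
exact: (IH (fun y z m' => G y z (x :: m'))).
Qed.

Lemma perm_picks F m m' :
  (forall y s t, perm_eq s t -> F y s = F y t) -> perm_eq m m' ->
  \sum_(y <- picks m) F y.1 y.2 = \sum_(y <- picks m') F y.1 y.2.
Proof.
move=> HF pm; move: m m' pm F HF; apply: perm_eq_ind => //.
- by move=> s t u h1 h2 F HF; rewrite h1 // h2.
- move=> x s t pst IH F HF; rewrite !sum_picks_cons (HF _ _ _ pst); congr (_ + _).
  apply: (IH (fun y m => F y (x :: m))) => y s' t' p; apply: HF.
  by rewrite perm_cons.
- move=> x y s F HF; rewrite !sum_picks_cons.
  rewrite (sum_picks_cons (fun y m => F y (x :: m))).
  rewrite (sum_picks_cons (fun z m => F z (y :: m))) addrCA.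
  congr (_ + (_ + _)); apply: eq_bigr => z _; apply: HF.
  perm_count.
Qed.

End Picks.

Section Linear.
Variables (R : comNzRingType) (C J T : R).

Definition seq_sym (f : seq nat -> R) := forall s t, perm_eq s t -> f s = f t.

(* A part [a] stands for a component with [a.+1] pairs, so that every list of
   naturals is admissible. *)
Definition last_step (f : seq nat -> R) (a : nat) (m : seq nat) : R :=
  \sum_(y <- picks m) (2 * y.1.+1)%:R * C * f ((a + y.1).+1 :: y.2)
  + a%:R * T * f (a :: m) + \sum_(i < a) J * f [:: (i : nat), (a.-1 - i)%N & m].

Lemma seq_sym_swap f x y s : seq_sym f -> f [:: x, y & s] = f [:: y, x & s].
Proof.
by apply; perm_count.
Qed.

Lemma last_step_perm f a m m' : seq_sym f -> perm_eq m m' -> last_step f a m = last_step f a m'.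
Proof.
move=> fs pm; rewrite /last_step; congr (_ + _ * _ + _).
- apply: (@perm_picks _ _ (fun y s => (2 * y.+1)%:R * C * f ((a + y).+1 :: s)) _ _ _ pm).
  by move=> y s t p; congr (_ * _); apply: fs; rewrite perm_cons.
- by apply: fs; rewrite perm_cons.
by apply: eq_bigr => i _; congr (_ * _); apply: fs; rewrite !perm_cons.
Qed.

Lemma last_step_cons f b x m :
  last_step f b (x :: m) =
   (2 * x.+1)%:R * C * f ((b + x).+1 :: m)
  + \sum_(y <- picks m) (2 * y.1.+1)%:R * C * f [:: (b + y.1).+1, x & y.2]
  + b%:R * T * f [:: b, x & m]
  + \sum_(i < b) J * f [:: (i : nat), (b.-1 - i)%N, x & m].
Proof.
rewrite /last_step (sum_picks_cons (fun y s => (2 * y.+1)%:R * C * f ((b + y).+1 :: s))).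
by [].
Qed.

(* [last_step] at the component of a, then at the component of b wherever b ended up. *)
Definition last_two_steps (f : seq nat -> R) (a b : nat) (m : seq nat) : R :=
  (2 * b.+1)%:R * C * last_step f (a + b).+1 m
  + \sum_(y <- picks m) (2 * y.1.+1)%:R * C * last_step f b ((a + y.1).+1 :: y.2)
  + a%:R * T * last_step f b (a :: m)
  + \sum_(i < a) J * last_step f b [:: (i : nat), (a.-1 - i)%N & m].

(* The coefficient of [S x = f (x :: c - x :: m)] on the two sides differs by
   [2x - c], which is odd under the symmetry [x -> c - x] of [S]. *)
Lemma quadratic_exchange (a b : nat) (S : nat -> R) :
  (forall x, (x <= a + b)%N -> S x = S (a + b - x)%N) ->
  b.+1%:R * (\sum_(i < (a + b).+1) S i) + \sum_(i < a) (2 * i.+1)%:R * S (b + i).+1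
  = a.+1%:R * (\sum_(i < (a + b).+1) S i) + \sum_(i < b) (2 * i.+1)%:R * S (a + i).+1.
Proof.
move=> HS; set c := (a + b)%N.
(* Truncated subtraction gives the terms with x <= v the coefficient zero, so both sums can be taken
   over the whole range x <= c and compared there. *)
have E (u v : nat) : (u + v)%N = c ->
   \sum_(i < u) (2 * i.+1)%:R * S (v + i).+1 = \sum_(x < c.+1) (2 * (x - v))%:R * S x :> R.
  move=> uv.
  rewrite -(big_mkord xpredT (fun x => (2 * (x - v))%:R * S x)).
  rewrite (@big_cat_nat _ _ _ v.+1) /=; [|by []|by lia].
  rewrite [X in _ = X + _]big_nat [X in _ = X + _]big1 ?add0r; last first.
    by move=> i /andP[_ hi]; rewrite (_ : (i - v = 0)%N) ?mul0r//; lia.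
  rewrite -{1}(add0n v.+1) big_addn (_ : (c.+1 - v.+1 = u)%N); last by lia.
  rewrite big_mkord; apply: eq_bigr => i _.
  have -> : (i + v.+1 = (v + i).+1)%N by lia.
  by have -> : ((v + i).+1 - v = i.+1)%N by lia.
rewrite (E a b) // (E b a) /c; last by rewrite addnC.
have -> : \sum_(x < (a + b).+1) (2 * (x - a))%:R * S x =
          \sum_(x < (a + b).+1) (2 * (b - x))%:R * S x :> R.
  rewrite [LHS](reindex_inj rev_ord_inj) /=; apply: eq_bigr => x _.
  have hx : (x <= a + b)%N by rewrite -ltnS.
  rewrite subSS -(HS x hx).
  by have -> : (a + b - x - a = b - x)%N by lia.
rewrite !mulr_sumr -!big_split /=.
have Z0 : \sum_(x < (a + b).+1) (x%:R - (a + b - x)%N%:R) * S x = 0.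
  rewrite (eq_bigr (fun x : 'I__ => x%:R * S x - (a + b - x)%N%:R * S (a + b - x)%N)); last first.
    move=> x _; have hx : (x <= a + b)%N by rewrite -ltnS.
    by rewrite mulrBl -(HS x hx).
  rewrite sumrB [X in _ - X](reindex_inj rev_ord_inj) /=.
  apply/eqP; rewrite subr_eq0; apply/eqP; apply: eq_bigr => x _.
  by have := ltn_ord x; rewrite subSS ltnS => hx; rewrite subKn.
apply/eqP; rewrite -subr_eq0 -sumrB -[X in _ == X]Z0; apply/eqP/eq_bigr => x _.
have := ltn_ord x; rewrite ltnS => hx.
rewrite -!mulrDl -mulrBl; congr (_ * _).
rewrite -!natrD.
apply/eqP; rewrite subr_eq addrAC eq_sym subr_eq -!natrD; apply/eqP; congr (_%:R).
lia.
Qed.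

(** The terms are grouped by what happens to the components a and b. In [P1] both join the same
    third component, in [P2] two different ones; [P3] and [P4] combine one such join with a twist or
    a cut, [P5] is a twist with a cut and [P6] two cuts. Exchanging a and b permutes these groups,
    up to reordering lists. *)
Lemma last_two_steps_sym f a b m : seq_sym f -> last_two_steps f a b m = last_two_steps f b a m.
Proof.
move=> fs.
have sw x y s : f [:: x, y & s] = f [:: y, x & s] by apply: seq_sym_swap.
have sw2 x y z s : f [:: z, x, y & s] = f [:: z, y, x & s].
  by apply: fs; perm_count.
rewrite /last_two_steps.
pose P2 a b := \sum_(y <- picks m) \sum_(z <- picks y.2)
   (2 * y.1.+1)%:R * C * ((2 * z.1.+1)%:R * C * f [:: (b + z.1).+1, (a + y.1).+1 & z.2]).
pose P3 a b := \sum_(y <- picks m) (2 * y.1.+1)%:R * C * b%:R * T * f [:: b, (a + y.1).+1 & y.2].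
pose P4 a b := \sum_(y <- picks m) \sum_(i < b)
   (2 * y.1.+1)%:R * C * J * f [:: (i : nat), (b.-1 - i)%N, (a + y.1).+1 & y.2].
pose P1 a b := \sum_(y <- picks m) (2 * y.1.+1)%:R * C * C * (2 * (a + b + y.1 + 3))%:R *
   f ((a + b + y.1).+2 :: y.2).
pose S x := f [:: x, (a + b - x)%N & m].
pose P5 a b := \sum_(i < a) J * ((b%:R * T) * f [:: b, (i : nat), (a.-1 - i)%N & m]).
pose P6 a b := \sum_(i < a) \sum_(j < b) J * (J * f [:: (j : nat), (b.-1 - j)%N, (i : nat), (a.-1 - i)%N & m]).
pose Q := \sum_(i < (a + b).+1) S i.
have sQ x : (x <= a + b)%N -> S x = S (a + b - x)%N.
  by move=> hx; rewrite /S sw subKn.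
have P2s u v : P2 u v = P2 v u.
  rewrite /P2 (exchange_picks (fun y z s => (2 * y.+1)%:R * C * ((2 * z.+1)%:R * C * f [:: (v + z).+1, (u + y).+1 & s]))).
  by apply: eq_bigr => y _; apply: eq_bigr => z _; rewrite sw; ring.
have P1s u v : P1 u v = P1 v u by apply: eq_bigr => y _; rewrite [(u + v)%N]addnC.
have P6s u v : P6 u v = P6 v u.
  rewrite /P6 exchange_big /=; apply: eq_bigr => i _; apply: eq_bigr => j _.
  congr (_ * (_ * _)); apply: fs.
  perm_count.
(* Only two coefficients are not visibly symmetric, both from a and b being joined to each other:
   with a twist (the C T term), where (v+1)(u+v+1) + u(u+1) is a symmetric polynomial, and with a
   cut (the C J term), where [quadratic_exchange] is needed. *)
have key (u v : nat) : (u + v = a + b)%N ->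
  (2 * v.+1)%:R * C * last_step f (u + v).+1 m +
  \sum_(y <- picks m) (2 * y.1.+1)%:R * C * last_step f v ((u + y.1).+1 :: y.2) +
  u%:R * T * last_step f v (u :: m) +
  \sum_(i < u) J * last_step f v [:: (i : nat), (u.-1 - i)%N & m] =
  P1 u v + P2 u v + (P3 u v + P3 v u) + (P4 u v + P4 v u) +
  (2 * ((v.+1) * (u + v).+1 + u * u.+1))%:R * C * T * f ((u + v).+1 :: m)
  + u%:R * T * v%:R * T * f [:: v, u & m] + (P5 v u + P5 u v) + P6 u v
  + 2%:R * C * J * (v.+1%:R * Q + \sum_(i < u) (2 * i.+1)%:R * S (v + i).+1).
  move=> uv.
  under [X in _ + X + _ + _ = _]eq_bigr => y _ do
    rewrite last_step_cons !mulrDr !mulr_sumr.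
  rewrite !big_split /=.
  rewrite last_step_cons /last_step.
  have -> : \sum_(i < u) J * (
    \sum_(y <- picks [:: (i : nat), (u.-1 - i)%N & m]) (2 * y.1.+1)%:R * C * f ((v + y.1).+1 :: y.2) +
    v%:R * T * f [:: v, (i : nat), (u.-1 - i)%N & m] +
    \sum_(i0 < v) J * f [:: (i0 : nat), (v.-1 - i0)%N, (i : nat), (u.-1 - i)%N & m]) =
    2%:R * C * J * (\sum_(i < u) (2 * i.+1)%:R * S (v + i).+1) + P4 v u + P5 u v + P6 u v.
    under eq_bigr => i _.
      rewrite (sum_picks_cons (fun y s => (2 * y.+1)%:R * C * f ((v + y).+1 :: s))).
      rewrite (sum_picks_cons (fun y s => (2 * y.+1)%:R * C * f [:: (v + y).+1, (i : nat) & s])).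
      rewrite !mulrDr !mulr_sumr.
      over.
    rewrite !big_split /= addrA; congr (_ + _ + _ + _) => //.
    (* After u is cut, v may join either piece; reversing i identifies the second choice with the
       first, which doubles the coefficient. *)
    - rewrite [X in _ + X](reindex_inj rev_ord_inj) /= -big_split /=.
      rewrite mulr_sumr; apply: eq_bigr => i _.
      have hi := ltn_ord i.
      rewrite (_ : (u.-1 - (u - i.+1) = i)%N); last by lia.
      rewrite /S (_ : (a + b - (v + i).+1 = u.-1 - i)%N); last by lia.
      rewrite (_ : (u - i.+1 = u.-1 - i)%N); last by lia.
      by rewrite natrM; ring.
    - rewrite /P4 exchange_big /=; apply: eq_bigr => y _; apply: eq_bigr => i _.
      rewrite (fs _ [:: (i : nat), (u.-1 - i)%N, (v + y.1).+1 & y.2]); first by ring.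
      perm_count.
  rewrite (_ : \sum_(y <- picks m) (2 * y.1.+1)%:R * C * (v%:R * T * f [:: v, (u + y.1).+1 & y.2]) = P3 u v);
    last by apply: eq_bigr => y _; rewrite !mulrA.
  rewrite (_ : \sum_(y <- picks m) \sum_(i < v) _ = P4 u v);
    last by apply: eq_bigr => y _; apply: eq_bigr => i _; rewrite !mulrA.
  rewrite (_ : \sum_(y <- picks m) \sum_(z <- picks y.2) _ = P2 u v) //.
  rewrite (_ : \sum_(i < (u + v).+1) _ = J * Q); last first.
    rewrite uv /Q mulr_sumr; apply: eq_bigr => i _; congr (_ * _).
  rewrite (_ : u%:R * T * (_ + _ + _ + _) = u%:R * T * ((2 * u.+1)%:R * C * f ((v + u).+1 :: m)) + P3 v u
     + u%:R * T * (v%:R * T * f [:: v, u & m]) + P5 v u); last first.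
    rewrite !mulrDr; congr (_ + _ + _ + _).
      rewrite /P3 mulr_sumr; apply: eq_bigr => y _.
      by rewrite sw; ring.
    rewrite /P5 mulr_sumr; apply: eq_bigr => i _.
    rewrite (fs _ [:: u, (i : nat), (v.-1 - i)%N & m]); first by ring.
    perm_count.
  have -> : P1 u v = (2 * v.+1)%:R * C * (\sum_(y <- picks m) (2 * y.1.+1)%:R * C * f (((u + v).+1 + y.1).+1 :: y.2))
     + \sum_(y <- picks m) (2 * y.1.+1)%:R * C * ((2 * (u + y.1).+2)%:R * C * f ((v + (u + y.1).+1).+1 :: y.2)).
    rewrite mulr_sumr -big_split /=; apply: eq_bigr => y _.
    rewrite (_ : ((u + v).+1 + y.1).+1 = (u + v + y.1).+2)%N; last by lia.
    rewrite (_ : (v + (u + y.1).+1).+1 = (u + v + y.1).+2)%N; last by lia.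
    rewrite (_ : (2 * (u + v + y.1 + 3) = 2 * v.+1 + 2 * (u + y.1).+2)%N); last by lia.
    by rewrite natrD; ring.
  rewrite [(v + u)%N]addnC.
  rewrite (_ : (2 * (v.+1 * (u + v).+1 + u * u.+1))%:R = (2 * v.+1)%:R * (u + v).+1%:R + u%:R * (2 * u.+1)%:R); last first.
    by rewrite -!natrM -natrD; congr (_%:R); lia.
  rewrite (_ : (2 * v.+1)%:R = 2%:R * v.+1%:R); last by rewrite natrM.
  ring.
rewrite key // key; last by rewrite addnC.
rewrite quadratic_exchange // (P1s b) (P2s b) (P6s b) [(b + a)%N]addnC sw.
rewrite (_ : (b.+1 * (a + b).+1 + a * a.+1 = a.+1 * (a + b).+1 + b * b.+1)%N); last by lia.
rewrite -/Q.
ring.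
Qed.

(* The weighted number of monotone, not necessarily transitive, walks with k
   steps that end at a given matching of type m; see [mono_sum_typ]. *)
Fixpoint type_sum (k : nat) : seq nat -> R :=
  fix Zk m :=
    if m is a :: m' then
      (a == 0%N)%:R * Zk m' + (if k is k'.+1 then last_step (type_sum k') a m' else 0)
    else (k == 0%N)%:R.

Lemma type_sum_cons k a m : type_sum k (a :: m) =
  (a == 0%N)%:R * type_sum k m + (if k is k'.+1 then last_step (type_sum k') a m else 0).
Proof. by case: k. Qed.

(** Expanding at both head entries leaves a product of two Kronecker deltas, two mixed terms that
    are exchanged, and [last_two_steps] two levels down. The induction is strong because symmetry is
    needed at both earlier levels. *)
Lemma type_sum_sym k : seq_sym (type_sum k).
Proof.
have [N leN] := ubnP k; elim: N k leN => // N IHN k leN.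
have recZ a s t : perm_eq s t ->
  (if k is k'.+1 then last_step (type_sum k') a s else 0) = (if k is k'.+1 then last_step (type_sum k') a t else 0).
  move=> pst; case: k leN => // k' leN; apply: last_step_perm => //.
  by apply: IHN; lia.
apply: perm_eq_ind => //.
- by move=> s t u -> ->.
- by move=> x s t pst e; rewrite !type_sum_cons e (recZ x s t).
move=> a b m; rewrite !type_sum_cons.
case: k leN recZ => [|k] leN _; first by rewrite !addr0 mulrCA.
have fs : seq_sym (type_sum k) by apply: IHN; lia.
(* Symmetry one level down moves v to the head, where the recursion unfolds it. If v has been joined
   to u, the head is a successor and its delta term vanishes. *)
have E u v : last_step (type_sum k) u (v :: m) = (v == 0%N)%:R * last_step (type_sum k) u m +
   (if k is k'.+1 then last_two_steps (type_sum k') u v m else 0).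
  have Ev s : type_sum k (v :: s) = (v == 0%N)%:R * type_sum k s + (if k is k'.+1 then last_step (type_sum k') v s else 0).
    exact: type_sum_cons.
  rewrite last_step_cons /last_step.
  rewrite (seq_sym_swap _ _ _ fs) Ev.
  under [X in _ + X + _ + _ = _]eq_bigr => y _ do rewrite (seq_sym_swap _ _ _ fs) Ev mulrDr.
  have fv x y : type_sum k [:: x, y, v & m] = type_sum k [:: v, x, y & m].
    by apply: fs; perm_count.
  under [X in _ + X = _]eq_bigr => i _ do rewrite fv Ev mulrDr.
  rewrite !big_split /= [type_sum k ((u + v).+1 :: m)]type_sum_cons mul0r add0r.
  rewrite (_ : \sum_(i <- picks m) (2 * i.1.+1)%:R * C * ((v == 0)%:R * type_sum k ((u + i.1).+1 :: i.2)) =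
    (v == 0)%:R * \sum_(i <- picks m) (2 * i.1.+1)%:R * C * type_sum k ((u + i.1).+1 :: i.2)); last first.
    by rewrite mulr_sumr; apply: eq_bigr => y _; ring.
  rewrite (_ : \sum_(i < u) J * ((v == 0)%:R * type_sum k [:: (i : nat), (u.-1 - i)%N & m]) =
    (v == 0)%:R * \sum_(i < u) J * type_sum k [:: (i : nat), (u.-1 - i)%N & m]); last first.
    by rewrite mulr_sumr; apply: eq_bigr => y _; ring.
  case: (k) => [|k']; last by rewrite /last_two_steps; ring.
  have -> : \sum_(i <- picks m) (2 * i.1.+1)%:R * C * 0 = 0 :> R.
    by apply: big1 => i _; rewrite mulr0.
  have -> : \sum_(i < u) J * 0 = 0 :> R by apply: big1 => i _; rewrite mulr0.
  ring.
rewrite !E.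
have -> : (if k is k'.+1 then last_two_steps (type_sum k') a b m else 0) = (if k is k'.+1 then last_two_steps (type_sum k') b a m else 0).
  case: (k) leN => // k' leN; apply: last_two_steps_sym; apply: IHN; lia.
by rewrite !mulrDr mulrCA addrACA.
Qed.

End Linear.

(** * Components of a matching *)

Lemma card_porbit_iter (T : finType) (c : {perm T}) x i : (0 < i)%N ->
  iter i c x = x -> (forall j, (0 < j < i)%N -> iter j c x != x) ->
  #|porbit c x| = i.
Proof.
move=> i0 ix nx; have K0 : (0 < #|porbit c x|)%N.
  by rewrite lt0n card_porbit_neq0.
apply/eqP; rewrite eqn_leq; apply/andP; split; rewrite leqNgt; apply/negP => h.
  have := uniq_traject_porbit c x; move/(nth_uniq x).
  move/(_ i 0%N); rewrite size_traject => /(_ h K0).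
  by rewrite !nth_traject //= ix eqxx; case: (i) i0.
by have := nx #|porbit c x|; rewrite K0 h iter_porbit eqxx => /(_ isT).
Qed.

Lemma mem_porbit_iter (T : finType) (c : {perm T}) x y :
  reflect (exists2 i, (i < #|porbit c x|)%N & y = iter i c x) (y \in porbit c x).
Proof. by rewrite porbit_traject; apply: trajectP. Qed.

Lemma iter_porbit_inj (T : finType) (c : {perm T}) x i j :
  (i < #|porbit c x|)%N -> (j < #|porbit c x|)%N ->
  iter i c x = iter j c x -> i = j.
Proof.
move=> hi hj /eqP.
rewrite -(nth_traject c hi) -(nth_traject c hj) nth_uniq ?size_traject //.
  by move/eqP.
exact: uniq_traject_porbit.
Qed.

Lemma perm_enum_setU1 (T : finType) (x : T) (S : {set T}) :
  x \notin S -> perm_eq (enum (x |: S)) (x :: enum S).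
Proof.
move=> xS; apply: uniq_perm; rewrite /= ?enum_uniq ?andbT ?mem_enum //.
by move=> y; rewrite !inE !mem_enum !inE.
Qed.

Section Matching.
Variable n : nat.
Local Notation V := (barset n).
Local Notation tau := (tau n).
Implicit Types (rho : {perm V}) (A B E : {set V}) (p q x y : V).

Lemma tauE x : tau x = (x.1, ~~ x.2).
Proof. by rewrite permE. Qed.

Lemma tauK : involutive tau.
Proof. by move=> [i b]; rewrite !tauE /= negbK. Qed.

Lemma tau_neq x : tau x != x.
Proof. by case: x => i b; rewrite tauE xpair_eqE; case: b; rewrite /= andbF. Qed.

Definition matching rho := [forall x, (rho (rho x) == x) && (rho x != x)].

Lemma matchingK rho : matching rho -> involutive rho.
Proof. by move=> /forallP h x; case/andP: (h x) => /eqP. Qed.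

Lemma matching_neq rho x : matching rho -> rho x != x.
Proof. by move=> /forallP h; case/andP: (h x). Qed.

Lemma matching_tau : matching tau.
Proof. by apply/forallP => x; rewrite tauK eqxx tau_neq. Qed.

Lemma conjpE rho (s : {perm V}) x : (rho ^ s)%g x = s (rho (s^-1%g x)).
Proof. by rewrite conjgE !permM. Qed.

Lemma matching_conj rho s : matching rho -> matching (rho ^ s)%g.
Proof.
move=> m; apply/forallP => x; rewrite !conjpE permK (matchingK m) permKV eqxx /=.
by rewrite -{2}(permKV s x) (inj_eq perm_inj) matching_neq.
Qed.

Lemma conj_tpermE rho p q x : (rho ^ tperm p q)%g x = tperm p q (rho (tperm p q x)).
Proof. by rewrite conjpE tpermV. Qed.

Lemma conj_tpermK rho p q : ((rho ^ tperm p q) ^ tperm p q)%g = rho.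
Proof. by rewrite -conjgM tperm2 conjg1. Qed.

(** These are the unions of components. Every sum is formed inside such a set, so that it can be
    restricted to one orbit of a walk and to the complement. *)
Definition stable A rho := [forall x in A, (tau x \in A) && (rho x \in A)].

Lemma stable_tau A rho x : stable A rho -> x \in A -> tau x \in A.
Proof. by move=> /forall_inP h /h /andP[]. Qed.

Lemma stable_rho A rho x : stable A rho -> x \in A -> rho x \in A.
Proof. by move=> /forall_inP h /h /andP[]. Qed.

Lemma stable_tauE A rho x : stable A rho -> (tau x \in A) = (x \in A).
Proof.
by move=> s; apply/idP/idP => /(stable_tau s) //; rewrite tauK.
Qed.

Lemma stable_rhoE A rho x : matching rho -> stable A rho -> (rho x \in A) = (x \in A).
Proof.
by move=> m s; apply/idP/idP => /(stable_rho s) //; rewrite matchingK.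
Qed.

Lemma stableT rho : stable setT rho.
Proof. by apply/forall_inP => x _; rewrite !inE. Qed.

Lemma stableD A B rho : matching rho -> stable A rho -> stable B rho -> stable (A :\: B) rho.
Proof.
move=> m sA sB; apply/forall_inP => x; rewrite !inE => /andP[xB xA].
by rewrite (stable_tauE _ sA) (stable_tauE _ sB) (stable_rhoE _ m sA) (stable_rhoE _ m sB) xB xA.
Qed.

Lemma stableU A B rho : stable A rho -> stable B rho -> stable (A :|: B) rho.
Proof.
move=> sA sB; apply/forall_inP => x; rewrite !inE => /orP[] h.
  by rewrite (stable_tau sA) ?(stable_rho sA).
by rewrite (stable_tau sB) ?(stable_rho sB) ?orbT.
Qed.

Definition comp rho x := [set y | connect (pair_edge rho) x y].

Lemma comp_refl rho x : x \in comp rho x.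
Proof. by rewrite inE. Qed.

Lemma comp_sym rho : matching rho -> connect_sym (pair_edge rho).
Proof.
move=> m; apply: sym_connect_sym => x y; rewrite /pair_edge.
rewrite [y == rho x]eq_sym (can2_eq (matchingK m) (matchingK m)).
by rewrite [y == tau x]eq_sym (can2_eq tauK tauK).
Qed.

Lemma comp_eq rho x y : matching rho -> y \in comp rho x -> comp rho y = comp rho x.
Proof.
move=> m; rewrite inE => h; apply/setP => z; rewrite !inE.
by rewrite (same_connect (comp_sym m) h).
Qed.

Lemma mem_comp_sym rho x y : matching rho -> (y \in comp rho x) = (x \in comp rho y).
Proof. by move=> m; rewrite !inE comp_sym. Qed.

Lemma comp_stable rho x : stable (comp rho x) rho.
Proof.
apply/forall_inP => y; rewrite !inE => h.
by apply/andP; split; apply: connect_trans h (connect1 _); rewrite /pair_edge eqxx ?orbT.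
Qed.

Lemma comp_min rho A x : stable A rho -> x \in A -> comp rho x \subset A.
Proof.
move=> s xA; apply/subsetP => y; rewrite inE => /connectP[p].
elim: p x xA => [|z p IH] x xA /=; first by move=> _ ->.
case/andP=> e hp; apply: IH => //.
by case/orP: e => /eqP ->; [apply: stable_rho s xA | apply: stable_tau s xA].
Qed.

(** A component is a cycle whose edges alternate between [tau] and [rho]. Advancing by two edges
    visits every second vertex, so an orbit of [step] is one half of a component, [tau] exchanges
    the halves, and the orbit length is the part. *)
Definition step rho : {perm V} := (tau * rho)%g.

Lemma stepE rho x : step rho x = rho (tau x).
Proof. by rewrite permM. Qed.

(* Both tau and rho invert [step rho], so a first coincidence would give a fixed
   point of one of them. *)
Lemma iter_step_neq rho y m : matching rho -> tau y != iter m (step rho) y.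
Proof.
move=> mt; have [N] := ubnP m; elim: N y m => // N IH y [|[|m]] hm.
- exact: tau_neq.
- by rewrite /= stepE eq_sym matching_neq.
apply/eqP; rewrite iterS => h.
have /perm_inj e : step rho (tau (step rho y)) = step rho (iter m.+1 (step rho) y).
  by rewrite -h !stepE tauK (matchingK mt).
by move: e; rewrite iterSr; apply/eqP; apply: IH; lia.
Qed.

Lemma porbit_tauF rho x y : matching rho ->
  y \in porbit (step rho) x -> tau y \notin porbit (step rho) x.
Proof.
move=> m yx; apply/negP; rewrite -eq_porbit_mem in yx.
rewrite -(eqP yx) => /mem_porbit_iter[i _ e].
by have := iter_step_neq y i m; rewrite e eqxx.
Qed.

Lemma stable_iter rho A x i : stable A rho -> x \in A -> iter i (step rho) x \in A.
Proof.
by move=> s xA; elim: i => //= i IH; rewrite stepE (stable_rho s) // (stable_tau s).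
Qed.

Lemma compE rho x : matching rho ->
  comp rho x = porbit (step rho) x :|: [set y | tau y \in porbit (step rho) x].
Proof.
move=> m; apply/eqP; rewrite eqEsubset; apply/andP; split.
  apply: comp_min; last by rewrite inE porbit_id.
  have st y : y \in porbit (step rho) x -> rho (tau y) \in porbit (step rho) x.
    by rewrite -stepE => /porbitP[i ->]; rewrite -permM -expgSr mem_porbit.
  have sti y : y \in porbit (step rho) x -> tau (rho y) \in porbit (step rho) x.
    rewrite -eq_porbit_mem => /eqP <-.
    rewrite porbit_sym; apply/porbitP; exists 1%N.
    by rewrite expg1 stepE tauK matchingK.
  apply/forall_inP => y; rewrite !inE tauK => /orP[] h.
    by rewrite h orbT /= sti ?orbT.
  by rewrite h /=; have := st _ h; rewrite tauK => ->.
apply/subsetP => y; rewrite in_setU in_set => /orP[] /mem_porbit_iter[i _ e].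
  by rewrite e; apply: stable_iter; [apply: comp_stable | apply: comp_refl].
rewrite -(tauK y) e; apply: stable_tau (comp_stable _ _) _.
by apply: stable_iter; [apply: comp_stable | apply: comp_refl].
Qed.

Lemma porbit_sub_comp rho x : porbit (step rho) x \subset comp rho x.
Proof.
apply/subsetP => y /mem_porbit_iter[i _ ->].
by apply: stable_iter; [apply: comp_stable | apply: comp_refl].
Qed.

Lemma card_comp rho x : matching rho -> #|comp rho x| = (2 * #|porbit (step rho) x|)%N.
Proof.
move=> m; rewrite compE // cardsU.
rewrite (_ : _ :&: _ = set0) ?cards0 ?subn0; last first.
  apply/setP => y; rewrite !inE; apply/negP => /andP[h]; apply/negP.
  exact: porbit_tauF.
have -> : [set y | tau y \in porbit (step rho) x] = tau @^-1: porbit (step rho) x.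
  by apply/setP => y; rewrite !inE.
by rewrite card_preimset; [lia | exact: perm_inj].
Qed.

Lemma card_comp_half rho x : matching rho -> #|comp rho x|./2 = #|porbit (step rho) x|.
Proof. by move=> m; rewrite card_comp // mul2n doubleK. Qed.

Lemma agree_iter rho rho' A x i : stable A rho -> {in A, rho =1 rho'} -> x \in A ->
  iter i (step rho') x = iter i (step rho) x.
Proof.
move=> s h xA; elim: i => //= i ->; rewrite !stepE -h //.
by apply: (stable_tau s); apply: stable_iter.
Qed.

Lemma agree_stable rho rho' A : stable A rho -> {in A, rho =1 rho'} -> stable A rho'.
Proof.
move=> s h; apply/forall_inP => x xA.
by rewrite -h // (stable_tau s) ?(stable_rho s).
Qed.

Lemma agree_comp rho rho' A x : stable A rho -> {in A, rho =1 rho'} -> x \in A ->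
  comp rho x = comp rho' x.
Proof.
have half (r r' : {perm V}) : stable A r -> {in A, r =1 r'} -> x \in A -> comp r x \subset comp r' x.
  move=> s h xA; apply: subset_trans (_ : comp r' x :&: A \subset _); last exact: subsetIl.
  apply: comp_min; last by rewrite inE comp_refl.
  apply/forall_inP => y; rewrite !in_setI => /andP[y1 y2].
  by rewrite (stable_tau s y2) (stable_rho s y2) h // (stable_tau (comp_stable _ _) y1)
     (stable_rho (comp_stable _ _) y1).
move=> s h xA; apply/eqP; rewrite eqEsubset !half //.
- exact: agree_stable s h.
- by move=> y yA; rewrite h.
Qed.

Lemma agree_porbit rho rho' A x : stable A rho -> {in A, rho =1 rho'} -> x \in A ->
  porbit (step rho) x = porbit (step rho') x.
Proof.
move=> s h xA; apply/setP => y; apply/porbitP/porbitP => -[i ->]; exists i;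
  by rewrite !permX (agree_iter i s h xA).
Qed.

Lemma stable_conj A rho p q : stable A rho -> (p \in A) = (q \in A) ->
  stable A (rho ^ tperm p q)%g.
Proof.
move=> s pq; have tA x : (tperm p q x \in A) = (x \in A) by case: tpermP => // ->.
by apply/forall_inP => x xA; rewrite conj_tpermE tA (stable_rho s) ?tA // (stable_tau s).
Qed.

Lemma conj_agree A rho p q : stable A rho -> p \notin A -> q \notin A ->
  {in A, rho =1 (rho ^ tperm p q)%g}.
Proof.
move=> s pA qA x xA; have nt y : y \in A -> tperm p q y = y.
  by move=> yA; apply: tpermD; apply/eqP => e; [move: pA | move: qA]; rewrite e yA.
by rewrite conj_tpermE !nt // (stable_rho s).
Qed.

(** Conjugation by (p q) changes the [rho] edges only at p, q and their two partners, and all four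
    are assumed to lie in E. *)
Lemma stable_unconj E rho p q : stable E (rho ^ tperm p q)%g ->
  p \in E -> q \in E -> rho p \in E -> rho q \in E -> stable E rho.
Proof.
move=> s pE qE rp rq; apply/forall_inP => x xE; rewrite (stable_tau s) //=.
have [-> //|xp] := eqVneq x p; have [-> //|xq] := eqVneq x q.
have tx : tperm p q x = x by rewrite tpermD // eq_sym.
by have := stable_rho s xE; rewrite conj_tpermE tx; case: tpermP => [->|->|].
Qed.

Lemma conj_step rho p q y : tau y != p -> tau y != q ->
  (rho ^ tperm p q)%g (tau y) = tperm p q (step rho y).
Proof.
by move=> h1 h2; rewrite conj_tpermE stepE (@tpermD _ p q (tau y)) // eq_sym.
Qed.

Lemma walk_mem E rho rho' x i : stable E rho' -> x \in E ->
  (forall j, (j < i)%N -> rho' (tau (iter j (step rho) x)) = iter j.+1 (step rho) x) ->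
  iter i (step rho) x \in E.
Proof.
move=> s xE; elim: i => // i IH h; rewrite -h //.
apply: (stable_rho s); apply: (stable_tau s); apply: IH => j ji; apply: h.
by rewrite ltnS ltnW.
Qed.

Lemma porbit_pred rho x : matching rho ->
  tau (iter #|porbit (step rho) x|.-1 (step rho) x) = rho x.
Proof.
move=> m; apply: (can_inj (matchingK m)); rewrite matchingK // -stepE -iterS.
by rewrite prednK ?iter_porbit // lt0n card_porbit_neq0.
Qed.

Lemma step_notin rho q i j : matching rho -> tau (iter i (step rho) q) != iter j (step rho) q.
Proof.
move=> m; apply/eqP => e.
have h k : iter k (step rho) q \in porbit (step rho) q by rewrite -permX mem_porbit.
by have := porbit_tauF m (h i); rewrite e h.
Qed.

(** * Joining, cutting and twisting components by a transposition *)

Section Conj.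
Variables (rho : {perm V}) (p q : V).
Hypothesis m : matching rho.
Local Notation rho' := (rho ^ tperm p q)%g.

Let m' : matching rho'. Proof. exact: matching_conj. Qed.

(** Starting at x, the conjugate takes the same double steps as [rho] up to the last vertex before
    the return to x, whose [tau] partner is [rho x]; the walk does not meet y, which lies
    elsewhere. *)
Lemma join_walk (x y : V) : y \notin comp rho x ->
  rho x \in comp (rho ^ tperm x y)%g x.
Proof.
move=> yx; set r := (rho ^ _)%g; rewrite -porbit_pred //.
have yn i : iter i (step rho) x != y.
  apply: contraNneq yx => <-; apply: stable_iter (comp_stable _ _) (comp_refl _ _).
have yt i : tau (iter i (step rho) x) != y.
  apply: contraNneq yx => <-; apply: stable_tau (comp_stable _ _) _.
  by apply: stable_iter (comp_stable _ _) (comp_refl _ _).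
apply: stable_tau (comp_stable _ _) _.
apply: (walk_mem (comp_stable r x)) (comp_refl _ _) _ => j hj.
rewrite conj_step //; last exact: (step_notin x j 0 m).
rewrite -iterS tpermD // 1?eq_sym //; apply/eqP => e.
by have := @iter_porbit_inj _ (step rho) x j.+1 0; rewrite e => /(_ _ _ erefl) h;
   have: j.+1 = 0%N by apply: h; lia.
Qed.

(** The conjugate pairs q with [rho p]. By [join_walk] each old cycle is still connected from its
    point to that point's old partner, so the exchanged edges link the two into one. *)
Lemma join_comp : p \notin comp rho q -> comp rho' q = comp rho p :|: comp rho q.
Proof.
move=> pq; have qp : q \notin comp rho p by rewrite mem_comp_sym.
apply/eqP; rewrite eqEsubset; apply/andP; split.
  apply: comp_min; last by rewrite inE comp_refl orbT.
  apply: stable_conj; last by rewrite !in_setU !comp_refl orbT.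
  by apply: stableU; apply: comp_stable.
have rp : rho p \in comp rho' p by apply: join_walk.
have rq : rho q \in comp rho' q by rewrite tpermC; apply: join_walk.
have e : rho' q = rho p.
  rewrite conj_tpermE tpermR tpermD // eq_sym ?matching_neq //.
  apply: contraNneq qp => <-; exact: (stable_rho (comp_stable _ _) (comp_refl _ _)).
have rp2 : rho p \in comp rho' q.
  by rewrite -e; apply: (stable_rho (comp_stable _ _) (comp_refl _ _)).
have pE : p \in comp rho' q by rewrite -(comp_eq m' rp2) (comp_eq m' rp) comp_refl.
have s : stable (comp rho' q) rho.
  by apply: stable_unconj (comp_stable _ _) _ _ _ _; rewrite ?comp_refl.
by rewrite subUset !(comp_min s) // comp_refl.
Qed.

Variable i : nat.
Hypothesis hi : (0 < i < #|porbit (step rho) q|)%N.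

Let xi_neq j : (j < i)%N -> iter j (step rho) q != iter i (step rho) q.
Proof.
move=> ji; apply/eqP => e.
have : j = i by apply: (iter_porbit_inj _ _ e); lia.
by lia.
Qed.

Let x0_neq j : (0 < j <= i)%N -> iter j (step rho) q != q.
Proof.
move=> ji; apply/eqP => h.
have : j = 0%N by apply: (@iter_porbit_inj _ (step rho) q j 0 _ _ h); lia.
by lia.
Qed.

(** Here p lies on the same half of the cycle as q, i double steps later. The walk of the conjugate
    follows the old one but returns to q at the moment it would have reached p, which closes off a
    cycle of 2i vertices. *)
Lemma cut_comp : p = iter i (step rho) q ->
  [/\ #|comp rho' q| = (2 * i)%N, p \notin comp rho' q &
      comp rho q = comp rho' q :|: comp rho' p].
Proof.
move=> pi.
have c' j : (j < i)%N -> iter j (step rho') q = iter j (step rho) q.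
  elim: j => // j IH ji; rewrite !iterS IH; last by lia.
  rewrite [LHS]stepE conj_step ?pi ?step_notin //; last exact: (step_notin q j 0 m).
  by rewrite -iterS tpermD // eq_sym ?xi_neq // x0_neq //; lia.
have cq : iter i (step rho') q = q.
  case: i hi pi c' => // k hk pk c'; rewrite iterS c' //.
  rewrite stepE conj_step ?pk ?step_notin //; last exact: (step_notin q k 0 m).
  by rewrite -iterS -pk tpermL.
have ci : #|porbit (step rho') q| = i.
  apply: card_porbit_iter => //; first by lia.
  by move=> j hj; rewrite c' ?x0_neq //; lia.
have pn : p \notin comp rho' q.
  rewrite compE // !inE negb_or; apply/andP; split; apply/negP => /mem_porbit_iter[j];
    rewrite ci => ji e; rewrite c' // pi in e.
    by have := xi_neq ji; rewrite e eqxx.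
  by have := step_notin q i j m; rewrite e eqxx.
have pq : p \in comp rho q.
  by rewrite pi; apply: stable_iter (comp_stable _ _) (comp_refl _ _).
split=> //; first by rewrite card_comp // ci.
apply/eqP; rewrite eqEsubset; apply/andP; split; last first.
  have s : stable (comp rho q) rho'.
    by apply: stable_conj; rewrite ?comp_stable // comp_refl.
  by rewrite subUset !(comp_min s) // comp_refl.
apply: comp_min; last by rewrite inE comp_refl.
apply: stable_unconj (_ : stable _ rho') _ _ _ _.
- by apply: stableU; apply: comp_stable.
- by rewrite inE comp_refl orbT.
- by rewrite inE comp_refl.
- have [e|n1] := eqVneq (rho p) q; first by rewrite e inE comp_refl.
  have e : rho' q = rho p.
    by rewrite conj_tpermE tpermR tpermD // eq_sym // matching_neq.
  by rewrite -e inE (stable_rho (comp_stable _ _) (comp_refl _ _)).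
have [e|n1] := eqVneq (rho q) p; first by rewrite e inE comp_refl orbT.
have e : rho' p = rho q.
  by rewrite conj_tpermE tpermL tpermD // eq_sym // matching_neq.
by rewrite -e inE (stable_rho (comp_stable _ _) (comp_refl _ _)) orbT.
Qed.

(** Here p lies on the opposite half, so the exchange reverses a segment of the cycle. The walk from
    q is unchanged until it reaches [tau p], which keeps p connected to q. *)
Lemma twist_comp : p = tau (iter i (step rho) q) -> comp rho' q = comp rho q.
Proof.
move=> pi.
have xiq : iter i (step rho) q \in comp rho q.
  exact: stable_iter (comp_stable _ _) (comp_refl _ _).
have pq : p \in comp rho q by rewrite pi (stable_tau (comp_stable _ _)).
apply/eqP; rewrite eqEsubset; apply/andP; split.
  apply: comp_min (comp_refl _ _).
  by apply: stable_conj; rewrite ?comp_stable // comp_refl.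
have s' := comp_stable rho' q.
have pE : p \in comp rho' q.
  rewrite [X in X \in _]pi; apply: (stable_tau s').
  apply: (walk_mem s') (comp_refl _ _) _ => j ji.
  rewrite conj_step ?pi ?(inj_eq perm_inj) ?xi_neq //; last exact: (step_notin q j 0 m).
  by rewrite -iterS tpermD // ?step_notin // eq_sym x0_neq //; lia.
apply: comp_min (comp_refl _ _).
have [e|n1] := eqVneq (rho p) q.
  have e2 : rho q = p by rewrite -e matchingK.
  by apply: (stable_unconj s'); rewrite ?e ?e2 ?comp_refl.
have n2 : rho q != p by apply: contra_neq n1 => <-; rewrite matchingK.
apply: (stable_unconj s') => //; rewrite ?comp_refl //.
  have <- : rho' q = rho p.
    by rewrite conj_tpermE tpermR tpermD // eq_sym // matching_neq.
  by rewrite (stable_rho s') // comp_refl.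
have <- : rho' p = rho q.
  by rewrite conj_tpermE tpermL tpermD // eq_sym // matching_neq.
by rewrite (stable_rho s').
Qed.

End Conj.

Definition comps A rho := [set comp rho x | x in A].
Definition typ A rho := [seq #|B|./2 | B : {set V} <- enum (comps A rho)].

Lemma size_typ A rho : size (typ A rho) = #|comps A rho|.
Proof. by rewrite size_map -cardE. Qed.

Lemma comps_block A rho x : matching rho -> stable A rho -> x \in A ->
  comps A rho = comp rho x |: comps (A :\: comp rho x) rho /\
  comp rho x \notin comps (A :\: comp rho x) rho.
Proof.
move=> m s xA; split.
  apply/setP => B; rewrite in_setU1; apply/imsetP/orP.
    move=> [y yA ->]; have [yx|yx] := boolP (y \in comp rho x).
      by left; rewrite (comp_eq m yx).
    by right; apply: imset_f; rewrite inE yx.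
  case=> [/eqP ->|/imsetP[y]]; first by exists x.
  by rewrite inE => /andP[_ yA] ->; exists y.
apply/imsetP => -[y]; rewrite inE => /andP[yx yA] e.
by move: yx; rewrite e comp_refl.
Qed.

Lemma agree_comps A rho rho' : stable A rho -> {in A, rho =1 rho'} ->
  comps A rho = comps A rho'.
Proof. by move=> s h; apply: eq_in_imset => x xA; apply: agree_comp s h xA. Qed.

Lemma typ_block A rho x : matching rho -> stable A rho -> x \in A ->
  perm_eq (typ A rho) (#|comp rho x|./2 :: typ (A :\: comp rho x) rho).
Proof.
move=> m s xA; have [e1 e2] := comps_block m s xA.
rewrite /typ e1 -[X in perm_eq _ X](map_cons (fun B : {set V} => #|B|./2)).
by apply: perm_map; apply: perm_enum_setU1.
Qed.

Lemma agree_typ A rho rho' : stable A rho -> {in A, rho =1 rho'} ->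
  typ A rho = typ A rho'.
Proof. by move=> s h; rewrite /typ (agree_comps s h). Qed.

Lemma typ_block2 A rho x y : matching rho -> stable A rho -> x \in A -> y \in A ->
  y \notin comp rho x ->
  perm_eq (typ A rho) [:: #|comp rho x|./2, #|comp rho y|./2 &
                          typ (A :\: (comp rho x :|: comp rho y)) rho].
Proof.
move=> m s xA yA yx; apply: perm_trans (typ_block m s xA) _.
rewrite perm_cons -setDDl; apply: typ_block => //; last by rewrite inE yx.
by apply: stableD => //; apply: comp_stable.
Qed.

Section ConjTyp.
Variables (A : {set V}) (rho : {perm V}) (p q : V).
Hypotheses (m : matching rho) (s : stable A rho) (pA : p \in A) (qA : q \in A).
Local Notation rho' := (rho ^ tperm p q)%g.

Let m' : matching rho'. Proof. exact: matching_conj. Qed.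
Let s' : stable A rho'. Proof. by apply: stable_conj; rewrite ?pA. Qed.

Let restE B : stable B rho -> p \in B -> q \in B ->
  {in A :\: B, rho =1 rho'} /\ stable (A :\: B) rho.
Proof.
move=> sB pB qB; split; last exact: stableD.
by apply: conj_agree; rewrite ?inE ?pB ?qB //; apply: stableD.
Qed.

Lemma join_typ : p \notin comp rho q ->
  perm_eq (typ A rho) [:: #|comp rho q|./2, #|comp rho p|./2 &
                          typ (A :\: (comp rho q :|: comp rho p)) rho] /\
  perm_eq (typ A rho') ((#|comp rho q|./2 + #|comp rho p|./2)%N ::
                          typ (A :\: (comp rho q :|: comp rho p)) rho).
Proof.
move=> pq; split; first exact: typ_block2.
have e := join_comp m pq.
have d : [disjoint comp rho p & comp rho q].
  rewrite -setI_eq0; apply/eqP/setP => x; rewrite [in LHS]inE [in RHS]inE.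
  apply/negP => /andP[x1 x2]; move: pq.
  by rewrite -(comp_eq m x2) (comp_eq m x1) comp_refl.
apply: perm_trans (typ_block m' s' qA) _; rewrite e.
rewrite [_ :|: comp rho p]setUC.
have [|||a1 a2] := restE (B := comp rho p :|: comp rho q).
- by apply: stableU; apply: comp_stable.
- by rewrite inE comp_refl.
- by rewrite inE comp_refl orbT.
rewrite (agree_typ a2 a1) cardsU disjoint_setI0 // cards0 subn0.
by rewrite !card_comp // -mulnDr !mul2n !doubleK addnC.
Qed.

Lemma cut_typ i : (0 < i < #|porbit (step rho) q|)%N -> p = iter i (step rho) q ->
  perm_eq (typ A rho')
    [:: i, (#|porbit (step rho) q| - i)%N & typ (A :\: comp rho q) rho].
Proof.
move=> hi pi; have [c1 c2 c3] := cut_comp m hi pi.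
apply: perm_trans (typ_block2 m' s' qA pA c2) _; rewrite -c3.
have d : comp rho' q :&: comp rho' p = set0.
  apply/setP => x; rewrite [in LHS]inE [in RHS]inE.
  apply/negP => /andP[x1 x2]; move: c2.
  by rewrite -(comp_eq m' x1) (comp_eq m' x2) comp_refl.
have [|||a1 a2] := restE (B := comp rho q).
- exact: comp_stable.
- by rewrite c3 inE comp_refl orbT.
- exact: comp_refl.
rewrite (agree_typ a2 a1) c1 mul2n doubleK.
have := card_comp q m; rewrite c3 cardsU d cards0 subn0 c1 => h.
by rewrite (_ : #|comp rho' p| = (2 * (#|porbit (step rho) q| - i))%N) ?mul2n ?doubleK //; lia.
Qed.

Lemma twist_typ i : (0 < i < #|porbit (step rho) q|)%N -> p = tau (iter i (step rho) q) ->
  perm_eq (typ A rho') (typ A rho).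
Proof.
move=> hi pi; have c := twist_comp m hi pi.
apply: perm_trans (typ_block m' s' qA) _; rewrite perm_sym.
apply: perm_trans (typ_block m s qA) _; rewrite c.
have [|||a1 a2] := restE (B := comp rho q).
- exact: comp_stable.
- rewrite pi (stable_tau (comp_stable _ _)) //.
  exact: stable_iter (comp_stable _ _) (comp_refl _ _).
- exact: comp_refl.
by rewrite (agree_typ a2 a1).
Qed.

End ConjTyp.

Lemma inv_typeE rho : size (inv_type rho) = #|comps setT rho|.
Proof.
rewrite /inv_type size_sort size_map.
rewrite (_ : components rho = comps setT rho) -?cardE //.
by apply/setP => B; apply/imsetP/imsetP => -[x _ ->]; exists x.
Qed.

End Matching.

(** * Monotone walks *)

(** Sequences of transpositions are handled as lists because the recursions strip the head;
    [sum_ffun_words] returns to finite functions. *)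
Fixpoint words (T : finType) (k : nat) : seq (seq T) :=
  if k is k'.+1 then [seq t :: s | t <- enum T, s <- words T k'] else [:: [::]].

Lemma mem_words (T : finType) k (s : seq T) : (s \in words T k) = (size s == k).
Proof.
elim: k s => [|k IH] [|t s] //=.
  by apply/allpairsP => -[[x y]] /= [].
rewrite eqSS -IH; apply/allpairsP/idP => [[[x y]] /= [_ h [_ ->]] //|h].
by exists (t, s); rewrite mem_enum.
Qed.

Lemma words_uniq (T : finType) k : uniq (words T k).
Proof.
elim: k => //= k IH; apply: allpairs_uniq => //; first exact: enum_uniq.
by move=> [x y] [x' y'] _ _ [-> ->].
Qed.

Lemma sum_wordsS (T : finType) (R : nmodType) k (P : pred (seq T)) (F : seq T -> R) :
  \sum_(s <- words T k.+1 | P s) F s =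
  \sum_t \sum_(s <- words T k | P (t :: s)) F (t :: s).
Proof.
rewrite big_mkcond /= big_flatten /= big_map big_enum /=; apply: eq_bigr => t _.
by rewrite big_map [RHS]big_mkcond.
Qed.

Lemma sum_words0 (T : finType) (R : nmodType) (P : pred (seq T)) (F : seq T -> R) :
  \sum_(s <- words T 0 | P s) F s = if P [::] then F [::] else 0.
Proof. by rewrite big_mkcond big_seq1. Qed.

(** * Shuffles of two sorted words *)

Section Shuffle.
Variables (T : finType) (key : T -> nat) (a b : pred T).
Let ge (t u : T) := (key u <= key t)%N.
Hypothesis ab : forall t u, a t -> b u -> key t != key u.

Let ge_tr : transitive ge.
Proof. by rewrite /ge => t u v h1 h2; apply: leq_trans h2 h1. Qed.

Let ge_tot : total ge.
Proof. by move=> t u; rewrite /ge leq_total. Qed.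

Let nab t : a t -> b t = false.
Proof. by move=> h; apply/negP => /(ab h); rewrite eqxx. Qed.

(** Where two such words first differ, one has a letter t of the first alphabet and the other a
    letter u of the second. Each letter occurs later in the other word, so sortedness bounds the
    keys both ways and makes them equal, which is excluded. *)
Lemma filter_shuffle_inj s s' :
  all (predU a b) s -> all (predU a b) s' -> sorted ge s -> sorted ge s' ->
  filter a s = filter a s' -> filter b s = filter b s' -> s = s'.
Proof.
have hd t u r r' : a t -> b u -> path ge t r -> path ge u r' ->
    filter a (t :: r) = filter a (u :: r') -> filter b (t :: r) = filter b (u :: r') -> False.
  move=> at_ bu pt pu ea eb.
  have tu : t != u by apply/eqP => e; move: (nab at_); rewrite e bu.
  have ur : u \in r.
    have : u \in filter b (t :: r) by rewrite eb mem_filter bu mem_head.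
    by rewrite mem_filter inE eq_sym (negPf tu) => /andP[].
  have tr : t \in r'.
    have : t \in filter a (u :: r') by rewrite -ea mem_filter at_ mem_head.
    by rewrite mem_filter inE (negPf tu) => /andP[].
  have h1 : ge t u by apply: (allP (order_path_min ge_tr pt)).
  have h2 : ge u t by apply: (allP (order_path_min ge_tr pu)).
  by have := ab at_ bu; rewrite eqn_leq [(key t <= _)%N]h2 [(_ <= key t)%N]h1.
have nil r : all (predU a b) r -> filter a r = [::] -> filter b r = [::] -> r = [::].
  by case: r => //= t r /andP[/orP[] -> _].
elim: s s' => [|t r IH] [|u r'] //.
- by move=> _ h _ _ /esym h1 /esym h2; rewrite (nil _ h h1 h2).
- by move=> h _ _ _ h1 h2; rewrite (nil _ h h1 h2).
move=> /= /andP[ht hr] /andP[hu hr'] sr sr' ea eb.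
case/orP: ht => ht; case/orP: hu => hu.
- move: ea eb; rewrite ht hu (nab ht) (nab hu) => -[-> e1 e2].
  by rewrite (IH r') // (path_sorted sr, path_sorted sr').
- by case: (hd t u r r').
- by case: (hd u t r' r).
have na v : b v -> a v = false by move=> h; apply/negP => /nab; rewrite h.
move: ea eb; rewrite ht hu (na _ ht) (na _ hu) => e1 [-> e2].
by rewrite (IH r') // (path_sorted sr, path_sorted sr').
Qed.

(* A sorted word over two alphabets with distinct keys is determined by its
   two subwords, which are arbitrary sorted words. *)
Lemma sum_shuffle (R : nmodType) k (F : seq T -> seq T -> R) :
  \sum_(s <- words T k | all (predU a b) s && sorted ge s)
     F (filter a s) (filter b s) =
  \sum_(i < k.+1) \sum_(s <- words T i | all a s && sorted ge s)
    \sum_(u <- words T (k - i) | all b u && sorted ge u) F s u.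
Proof.
pose X := [seq (filter a s, filter b s) | s <- words T k & all (predU a b) s && sorted ge s].
pose Yi i := [seq (s, u) | s <- [seq s <- words T i | all a s && sorted ge s],
                u <- [seq u <- words T (k - i) | all b u && sorted ge u]].
have memYi i v : (v \in Yi i) = [&& size v.1 == i, size v.2 == (k - i)%N,
    all a v.1, sorted ge v.1, all b v.2 & sorted ge v.2].
  apply/allpairsP/and5P => [[[s u]] /=|]; last first.
    case: v => s u /= [h1 h2 h3 h4 /andP[h5 h6]].
    by exists (s, u); rewrite !mem_filter !mem_words h1 h2 h3 h4 h5 h6.
  rewrite !mem_filter !mem_words => -[/andP[/andP[h1 h2] h3] /andP[/andP[h4 h5] h6]].
  by move=> ->; split=> //; rewrite h4 h5.
have uYi i : uniq (Yi i).
  apply: allpairs_uniq; rewrite ?filter_uniq ?words_uniq //.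
  by move=> [x y] [x' y'] _ _ [-> ->].
transitivity (\sum_(v <- X) F v.1 v.2).
  by rewrite /X big_map big_filter.
transitivity (\sum_(v <- flatten [seq Yi i | i <- iota 0 k.+1]) F v.1 v.2); last first.
  rewrite big_flatten big_map -(big_mkord xpredT (fun i => \sum_(s <- words T i | all a s && sorted ge s)
    \sum_(u <- words T (k - i) | all b u && sorted ge u) F s u)).
  rewrite /index_iota subn0; apply: eq_bigr => i _.
  rewrite /Yi big_allpairs big_filter; apply: eq_bigr => s _.
  by rewrite big_filter.
apply: perm_big; apply: uniq_perm.
- rewrite map_inj_in_uniq ?filter_uniq ?words_uniq //.
  move=> s s'; rewrite !mem_filter => /andP[/andP[h1 h2] _] /andP[/andP[h3 h4] _] [e1 e2].
  exact: filter_shuffle_inj.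
- elim: (iota 0 k.+1) (iota_uniq 0 k.+1) => //= i l IH /andP[il ul].
  rewrite cat_uniq uYi IH // andbT; apply/hasPn => v /flattenP[_ /mapP[j jl ->]].
  rewrite !memYi => /and3P[/eqP hj _ _]; apply/negP => /and3P[/eqP hi _ _].
  by move: il; rewrite -hi hj jl.
move=> v; apply/mapP/flattenP => [[s]|[_ /mapP[i hi ->]]].
  rewrite mem_filter mem_words => /andP[/andP[h1 h2] /eqP h3] ->.
  exists (Yi (count a s)); last rewrite memYi /=.
    apply/mapP; exists (count a s) => //; rewrite mem_iota /= add0n ltnS -h3.
    exact: count_size.
  rewrite !size_filter eqxx !filter_all !(sorted_filter ge_tr) // !andbT /=.
  rewrite -h3 -(count_predC a s) addKn; apply/eqP/eq_in_count => t ts.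
  by case/orP: (allP h1 t ts) => h /=; rewrite ?(nab h) h //; apply/esym/negP => /nab; rewrite h.
rewrite memYi => /and5P[/eqP s1 /eqP s2 a1 o1 /andP[a2 o2]].
have fa : filter a (v.1 ++ v.2) = v.1.
  rewrite filter_cat (all_filterP a1) (_ : filter a v.2 = [::]) ?cats0 //.
  apply/eqP; rewrite -size_eq0 size_filter -leqn0 leqNgt -has_count; apply/hasPn => t tv.
  by apply/negP => /nab; rewrite (allP a2).
have fb : filter b (v.1 ++ v.2) = v.2.
  rewrite filter_cat (all_filterP a2) (_ : filter b v.1 = [::]) //.
  apply/eqP; rewrite -size_eq0 size_filter -leqn0 leqNgt -has_count; apply/hasPn => t tv.
  by rewrite nab // (allP a1).
(* The order compares keys only, so it matters that [sort] is stable: filtering the sorted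
   concatenation then returns the two sorted words unchanged. *)
exists (sort ge (v.1 ++ v.2)); last first.
  rewrite !(filter_sort ge_tot ge_tr) fa fb !(sorted_sort ge_tr) //.
  by case: (v).
rewrite mem_filter mem_words size_sort size_cat s1 s2 sort_sorted // andbT.
move: hi; rewrite mem_iota add0n ltnS /= => hi; rewrite subnKC // eqxx andbT.
rewrite all_sort all_cat; apply/andP; split.
  by apply: sub_all a1 => t h; rewrite /= h.
by apply: sub_all a2 => t h; rewrite /= h orbT.
Qed.

End Shuffle.

Lemma disjoint_setD (T : finType) (O A : {set T}) : [disjoint O & A :\: O].
Proof.
rewrite -setI_eq0; apply/eqP/setP => x; rewrite !inE.
by case: (x \in O).
Qed.

Lemma setU_setD (T : finType) (O A : {set T}) : O \subset A -> O :|: (A :\: O) = A.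
Proof.
move=> /subsetP OA; apply/setP => x; rewrite !inE.
by case h: (x \in O) => //=; rewrite OA.
Qed.

Section Walks.
Variable n : nat.
Local Notation V := (barset n).
Local Notation tau := (tau n).
Implicit Types (rho : {perm V}) (A B O : {set V}) (p q x y : V).
Implicit Types (s : seq (marked n)) (t : marked n).

Definition high t : V := (t.2, false).

Lemma marked_transpE t : marked_transp t = tperm t.1 (high t).
Proof. by []. Qed.

(** As q is unbarred, p < q in the order on the vertices says just that p has the smaller index. *)
Definition admissible A t := [&& t.1 \in A, high t \in A & (t.1.1 < t.2)%N].

(** Weakly decreasing, because words are read from the last transposition to the first. *)
Definition desc s := sorted (fun t u => (u.2 <= t.2)%N) s.

Definition valid A s := all (admissible A) s && desc s.

(** The Schreier graph of the group generated by [tau] and the transpositions; its components are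
    the orbits. *)
Definition link s : rel V :=
  fun x y => (y == tau x) || has (fun t => y == marked_transp t x) s.

Definition walk_orbit s x := [set y | connect (link s) x y].

Definition closed_under s B :=
  [forall x in B, tau x \in B] && all (fun t => (t.1 \in B) == (high t \in B)) s.

Definition transitive_on A s := [forall x in A, A \subset walk_orbit s x].

Lemma link_sym s : connect_sym (link s).
Proof.
apply: sym_connect_sym => x y; rewrite /link; congr (_ || _).
  by rewrite [RHS]eq_sym (can2_eq (@tauK n) (@tauK n)).
apply: eq_has => t; rewrite [RHS]eq_sym (can2_eq (tpermK _ _) (tpermK _ _)).
by [].
Qed.

Lemma walk_orbit_refl s x : x \in walk_orbit s x.
Proof. by rewrite inE. Qed.

Lemma walk_orbit_eq s x y : y \in walk_orbit s x -> walk_orbit s y = walk_orbit s x.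
Proof.
rewrite inE => h; apply/setP => z; rewrite !inE.
by rewrite (same_connect (link_sym s) h).
Qed.

Lemma walk_orbit_min s B x : closed_under s B -> x \in B -> walk_orbit s x \subset B.
Proof.
case/andP=> /forall_inP h1 /allP h2 xB; apply/subsetP => y; rewrite inE => /connectP[l].
elim: l x xB => [|z l IH] x xB /=; first by move=> _ ->.
case/andP=> e hl; apply: IH => //; case/orP: e => [/eqP ->|/hasP[t ts /eqP ->]].
  exact: h1.
by rewrite marked_transpE; case: tpermP => // e; have /eqP := h2 t ts; rewrite -e xB.
Qed.

Lemma walk_orbit_closed s x : closed_under s (walk_orbit s x).
Proof.
apply/andP; split.
  apply/forall_inP => y; rewrite !inE => h.
  by apply: connect_trans h (connect1 _); rewrite /link eqxx.
apply/allP => t ts; apply/eqP; rewrite !inE; apply: (same_connect_r (link_sym s)).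
apply: connect1; rewrite /link; apply/orP; right; apply/hasP; exists t => //.
by rewrite marked_transpE tpermL.
Qed.

Lemma transitive_onE A s x : closed_under s A -> x \in A -> transitive_on A s = (walk_orbit s x == A).
Proof.
move=> cA xA; apply/forall_inP/eqP => [h|h y].
  by apply/eqP; rewrite eqEsubset h // walk_orbit_min.
by rewrite -h => /walk_orbit_eq ->.
Qed.

Lemma closed_stable A s rho : stable A rho -> all (admissible A) s -> closed_under s A.
Proof.
move=> sA h; apply/andP; split.
  by apply/forall_inP => x; apply: (stable_tau sA).
by apply: sub_all h => t /and3P[-> ->].
Qed.

Lemma closed_sub s s' B : {subset s' <= s} -> closed_under s B -> closed_under s' B.
Proof.
by move=> ss /andP[h1 /allP h2]; rewrite /closed_under h1; apply/allP => t /ss /h2.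
Qed.

Section Weighted.
Variables (R : comNzRingType) (C J T : R).

(** Here [rho] is the matching after the step. Inside one component, p on the same half as q means
    that undoing the step cuts, so the step itself was a join; on the opposite half, undoing it is a
    twist. *)
Definition step_weight rho p q : R :=
  if p \notin comp rho q then C else
  if p \in porbit (step rho) q then J else T.

(* The head of the list is the last transposition applied. *)
Fixpoint walk_weight A rho s : R :=
  if s is t :: s' then
    step_weight rho t.1 (high t) * walk_weight A (rho ^ marked_transp t)%g s'
  else [forall x in A, rho x == tau x]%:R.

Definition mono_sum k A rho := \sum_(s <- words (marked n) k | valid A s) walk_weight A rho s.

Definition trans_sum k A rho :=
  \sum_(s <- words (marked n) k | valid A s && transitive_on A s) walk_weight A rho s.

Local Notation W := walk_weight.

(* A walk that reaches tau cannot mix its orbits. *)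
Lemma walk_weight_stable A rho s O : W A rho s != 0 -> O \subset A -> closed_under s O -> stable O rho.
Proof.
move=> h /subsetP OA /andP[/forall_inP h1 h2]; elim: s rho h h2 => [|t s IH] rho /= h.
  move=> _; have {}h : [forall x in A, rho x == tau x].
    by apply: contraNT h => /negPf ->.
  apply/forall_inP => x xO; rewrite h1 //=.
  by rewrite (eqP (forall_inP h x (OA x xO))) h1.
case/andP=> /eqP e h2; rewrite -(conj_tpermK rho t.1 (high t)).
apply: stable_conj => //; apply: IH => //.
by apply: contra_neq h => ->; rewrite mulr0.
Qed.

Lemma walk_weight_agree A rho rho' s : stable A rho -> {in A, rho =1 rho'} ->
  all (admissible A) s -> W A rho s = W A rho' s.
Proof.
elim: s rho rho' => [|t s IH] rho rho' sA h /=.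
  move=> _; congr ((nat_of_bool _)%:R); apply: eq_forallb_in => x xA.
  by rewrite h.
case/andP=> /and3P[t1 t2 _] hs; congr (_ * _).
  by rewrite /step_weight (agree_comp sA h t2) (agree_porbit sA h t2).
apply: IH => //; first by apply: stable_conj; rewrite ?t1.
move=> x xA; rewrite !conj_tpermE h //.
by case: tpermP.
Qed.

Lemma admissibleF O O' t : [disjoint O & O'] -> admissible O t -> admissible O' t = false.
Proof.
move=> d /and3P[h _ _]; apply/negP => /and3P[h' _ _].
by have := disjointFr d h; rewrite h'.
Qed.

(** A transposition inside one of the two stable sets changes neither the matching nor the step
    weights on the other. *)
Lemma walk_weight_split O O' rho s : [disjoint O & O'] -> stable O rho -> stable O' rho ->
  all (predU (admissible O) (admissible O')) s ->
  W (O :|: O') rho s = W O rho (filter (admissible O) s) * W O' rho (filter (admissible O') s).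
Proof.
move=> d; have d' : [disjoint O' & O] by rewrite disjoint_sym.
elim: s rho => [|t s IH] rho sO sO' /=.
  move=> _; rewrite -natrM mulnb; congr ((nat_of_bool _)%:R).
  apply/forall_inP/andP => [h|[/forall_inP h1 /forall_inP h2] x].
    by split; apply/forall_inP => x xO; apply: h; rewrite inE xO ?orbT.
  by rewrite inE => /orP[/h1|/h2].
have loc (E E' : {set V}) : [disjoint E & E'] -> stable E rho -> stable E' rho -> admissible E t ->
  [/\ stable E (rho ^ marked_transp t)%g, stable E' (rho ^ marked_transp t)%g &
   W E' (rho ^ marked_transp t)%g (filter (admissible E') s) = W E' rho (filter (admissible E') s)].
  move=> dE sE sE' /and3P[h1 h2 _].
  have n1 := disjointFr dE h1; have n2 := disjointFr dE h2.
  split; [by apply: stable_conj; rewrite ?h1 | by apply: stable_conj; rewrite ?n1 |].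
  apply/esym/walk_weight_agree => //; last exact: filter_all.
  by apply: conj_agree; rewrite ?n1 ?n2.
case/andP=> /orP[] ht hs.
  have [s1 s2 e] := loc O O' d sO sO' ht.
  by rewrite ht (admissibleF d ht) /= IH // e mulrA.
have [s2 s1 e] := loc O' O d' sO' sO ht.
by rewrite ht (admissibleF d' ht) /= IH // e mulrCA.
Qed.

Lemma sum_walk_weight_split k O O' rho (P P' : pred (seq (marked n))) :
  [disjoint O & O'] -> stable O rho -> stable O' rho ->
  \sum_(s <- words _ k | [&& all (predU (admissible O) (admissible O')) s, desc s,
       P (filter (admissible O) s) & P' (filter (admissible O') s)]) W (O :|: O') rho s =
  \sum_(i < k.+1) (\sum_(s <- words _ i | valid O s && P s) W O rho s) *
                  (\sum_(s <- words _ (k - i) | valid O' s && P' s) W O' rho s).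
Proof.
move=> d sO sO'.
pose F s u := if P s && P' u then W O rho s * W O' rho u else 0.
transitivity (\sum_(s <- words _ k | all (predU (admissible O) (admissible O')) s && desc s)
   F (filter (admissible O) s) (filter (admissible O') s)).
  rewrite big_mkcond [RHS]big_mkcond; apply: eq_bigr => s _.
  have [h1|_] := boolP (all _ s) => //=.
  by case: (desc s) => //=; rewrite /F; case: ifP => // _; rewrite walk_weight_split.
(* The key determines the vertex [high t], so transpositions inside disjoint sets have different
   keys and every pair of words has exactly one monotone shuffle. *)
rewrite (sum_shuffle (key := fun t : marked n => t.2)); last first.
  move=> t u /and3P[_ ht _] /and3P[_ hu _]; apply/eqP => e.
  have := disjointFr d ht; rewrite /high (_ : t.2 = u.2) //; last exact: val_inj.
  by rewrite [_ \in _]hu.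
apply: eq_bigr => i _; rewrite mulr_suml big_mkcond [RHS]big_mkcond; apply: eq_bigr => s _.
rewrite /valid /desc /F; case: (all _ s && _) => //=.
case: (P s) => /=; last by rewrite big1.
rewrite mulr_sumr big_mkcond [RHS]big_mkcond; apply: eq_bigr => u _ /=.
by case: (_ && _) => //=.
Qed.

Lemma walk_orbit_filter O O' s x rho : [disjoint O & O'] -> stable O rho -> x \in O ->
  all (predU (admissible O) (admissible O')) s ->
  walk_orbit (filter (admissible O) s) x = walk_orbit s x.
Proof.
move=> d sO xO h; apply/eqP; rewrite eqEsubset; apply/andP; split.
  apply: walk_orbit_min (walk_orbit_refl _ _); apply: closed_sub (walk_orbit_closed s x) => t.
  by rewrite mem_filter => /andP[].
apply: walk_orbit_min (walk_orbit_refl _ _).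
set s' := filter _ _; have /andP[c1 /allP c2] := walk_orbit_closed s' x.
rewrite /closed_under c1; apply/allP => t ts; case/orP: (allP h t ts) => ht.
  by apply: c2; rewrite mem_filter ht.
have sub : walk_orbit s' x \subset O.
  by apply: walk_orbit_min xO; apply: closed_stable sO (filter_all _ _).
have nO y : y \in O' -> y \in walk_orbit s' x = false.
  by move=> yO'; apply/negP => /(subsetP sub) yO; have := disjointFr d yO; rewrite yO'.
by case/and3P: ht => h1 h2 _; rewrite !nO.
Qed.

Lemma all_admissibleU O O' s rho : [disjoint O & O'] -> stable (O :|: O') rho ->
  closed_under s O -> all (admissible (O :|: O')) s ->
  all (predU (admissible O) (admissible O')) s.
Proof.
move=> d sA /andP[_ /allP c] /allP h; apply/allP => t ts.
have /and3P[h1 h2 h3] := h t ts; have /eqP e := c t ts.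
rewrite /= /admissible h3 !andbT; move: h1 h2; rewrite !inE e.
by case: (high t \in O) => //= -> ->.
Qed.

Lemma admissibleS O A t : O \subset A -> admissible O t -> admissible A t.
Proof. by move=> /subsetP h /and3P[/h h1 /h h2 h3]; apply/and3P. Qed.

Lemma all_predU O O' s : all (predU (admissible O) (admissible O')) s ->
  all (admissible (O :|: O')) s.
Proof.
by apply: sub_all => t /orP[]; apply: admissibleS; rewrite ?subsetUl ?subsetUr.
Qed.

Lemma closed_predU O O' s rho : [disjoint O & O'] -> stable O rho ->
  all (predU (admissible O) (admissible O')) s -> closed_under s O.
Proof.
move=> d sO h; apply/andP; split.
  by apply/forall_inP => x; apply: stable_tau sO.
apply: sub_all h => t /orP[] /and3P[h1 h2 _]; first by rewrite h1 h2.
by rewrite !(disjointFl d).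
Qed.

(** With O the orbit of x, the word is a shuffle of a word transitive on O and an arbitrary one on
    the complement. By [walk_weight_stable], an orbit that is not stable under [rho] contributes
    zero. *)
Lemma mono_sum_orbit k A rho x : matching rho -> stable A rho -> x \in A ->
  mono_sum k A rho = \sum_(O : {set V} | [&& O \subset A, x \in O & stable O rho])
    \sum_(i < k.+1) trans_sum i O rho * mono_sum (k - i) (A :\: O) rho.
Proof.
move=> m sA xA; rewrite /mono_sum (partition_big (fun s => walk_orbit s x) predT) //=.
rewrite [RHS]big_mkcond; apply: eq_bigr => O _; case: ifP => [/and3P[OA xO sO]|h].
  have d := disjoint_setD O A.
  have sD : stable (A :\: O) rho by apply: stableD.
  have U := setU_setD OA.
  rewrite -[in LHS]U (eq_bigr (fun i : 'I_k.+1 => (\sum_(s <- words _ i | valid O s && transitive_on O s) W O rho s) *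
     (\sum_(s <- words _ (k - i) | valid (A :\: O) s && predT s) W (A :\: O) rho s))); last first.
    by move=> i _; congr (_ * _); apply: eq_bigl => s; rewrite andbT.
  rewrite -sum_walk_weight_split //; apply: eq_bigl => s; rewrite andbT /valid -andbA andbCA [RHS]andbCA.
  congr (_ && _); apply/andP/andP => -[h1 h2].
    have c : closed_under s O by rewrite -(eqP h2) walk_orbit_closed.
    have h3 := all_admissibleU d (_ : stable (O :|: (A :\: O)) rho) c h1.
    rewrite U in h3; split; first exact: h3.
    rewrite (transitive_onE (x := x)) // ?(walk_orbit_filter d sO xO (h3 sA)) //.
    exact: closed_stable sO (filter_all _ _).
  split; first exact: all_predU.
  by rewrite -(walk_orbit_filter d sO xO h1) -transitive_onE // (closed_stable sO (filter_all _ _)).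
rewrite big1_seq // => s /andP[/andP[/andP[h1 _] /eqP e] _].
apply/eqP; apply: contraFT h => W0.
have cA := closed_stable sA h1.
have OA : O \subset A by rewrite -e walk_orbit_min.
rewrite OA -{1}e walk_orbit_refl /=; apply: walk_weight_stable W0 OA _.
by rewrite -e walk_orbit_closed.
Qed.

(** Dropping one transposition from a transitive family leaves at most two orbits, and if there are
    two they are those of [high t] and of [t.1]. *)
Lemma trans_sum_last k A rho t : matching rho -> stable A rho -> t.1 \in A -> high t \in A ->
  \sum_(s <- words _ k | valid A s && transitive_on A (t :: s)) W A rho s =
  trans_sum k A rho +
  \sum_(O : {set V} | [&& O \subset A, high t \in O, t.1 \notin O & stable O rho])
    \sum_(i < k.+1) trans_sum i O rho * trans_sum (k - i) (A :\: O) rho.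
Proof.
move=> m sA pA qA; rewrite (partition_big (fun s => walk_orbit s (high t)) predT) //=.
have cA s : all (admissible A) s -> closed_under s A by apply: closed_stable sA.
have cAt s : all (admissible A) s -> closed_under (t :: s) A.
  by move=> /cA /andP[h1 h2]; rewrite /closed_under h1 /= pA qA.
rewrite (bigD1 A) //=; congr (_ + _).
  apply: eq_bigl => s; rewrite /valid; have [h|//] := boolP (all _ s).
  case: (desc s) => //=; rewrite -(transitive_onE (cA s h)) //; apply/andb_idl.
  move=> /forall_inP h2; apply/forall_inP => x xA; apply: subset_trans (h2 x xA) _.
  apply: walk_orbit_min (walk_orbit_refl _ _); apply: closed_sub (walk_orbit_closed (t :: s) x) => u us.
  by rewrite inE us orbT.
rewrite [LHS]big_mkcond [RHS]big_mkcond /=; apply: eq_bigr => O _.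
have [/and4P[OA xO pO sO]|h] := boolP [&& O \subset A, high t \in O, t.1 \notin O & stable O rho].
  have nOA : O != A by apply: contraNneq pO => ->.
  rewrite nOA.
  have d := disjoint_setD O A.
  have d' : [disjoint A :\: O & O] by rewrite disjoint_sym.
  have sD : stable (A :\: O) rho by apply: stableD.
  have U := setU_setD OA.
  have pD : t.1 \in A :\: O by rewrite inE pO.
  rewrite -[in LHS]U -sum_walk_weight_split //; apply: eq_bigl => s.
  rewrite U /valid -!andbA andbCA [RHS]andbCA.
  congr (_ && _); apply/and3P/and3P => -[h1 h2 h3].
    have c : closed_under s O by rewrite -(eqP h3) walk_orbit_closed.
    have hU := all_admissibleU d (_ : stable (O :|: (A :\: O)) rho) c.
    rewrite U in hU; have {}hU := hU sA h1; split=> //.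
      rewrite (transitive_onE (x := high t)) // ?(walk_orbit_filter d sO xO hU) //.
      exact: closed_stable sO (filter_all _ _).
    have hU' : all (predU (admissible (A :\: O)) (admissible O)) s.
      by apply: sub_all hU => u /= ; rewrite orbC.
    rewrite (transitive_onE (x := t.1)) ?(closed_stable sD (filter_all _ _)) //.
    rewrite (walk_orbit_filter d' sD pD hU') eqEsubset; apply/andP; split.
      by apply: walk_orbit_min pD; apply: closed_predU d' sD hU'.
    apply/subsetP => y; rewrite inE => /andP[yO yA].
    (* The orbit of [t.1] together with O is closed under the whole family, hence is all of A; so
       that orbit fills the complement of O. *)
    have cU : closed_under (t :: s) (walk_orbit s t.1 :|: O).
      have /andP[/forall_inP c1 c2] := walk_orbit_closed s t.1.
      have /andP[/forall_inP c3 c4] := c.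
      apply/andP; split.
        by apply/forall_inP => z; rewrite !in_setU => /orP[/c1 ->|/c3 ->] //; rewrite orbT.
      apply/allP => u; rewrite in_cons => /orP[/eqP ->|us].
        by rewrite !in_setU walk_orbit_refl xO orbT.
      by rewrite !in_setU (eqP (allP c2 u us)) (eqP (allP c4 u us)).
    have := subset_trans (forall_inP h2 _ qA) (walk_orbit_min cU _).
    rewrite in_setU xO orbT => /(_ isT) /subsetP /(_ y yA).
    by rewrite in_setU (negPf yO) orbF.
  have hU' : all (predU (admissible (A :\: O)) (admissible O)) s.
    by apply: sub_all h1 => u /= ; rewrite orbC.
  have hA : all (admissible A) s by rewrite -U all_predU.
  have e1 : walk_orbit s (high t) = O.
    by apply/eqP; rewrite -(walk_orbit_filter d sO xO h1) -transitive_onE // (closed_stable sO (filter_all _ _)).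
  have e2 : walk_orbit s t.1 = A :\: O.
    by apply/eqP; rewrite -(walk_orbit_filter d' sD pD hU') -transitive_onE // (closed_stable sD (filter_all _ _)).
  split=> //; last by rewrite e1.
  rewrite (transitive_onE (x := t.1)) ?cAt // eqEsubset walk_orbit_min ?cAt //=.
  have sub u : walk_orbit s u \subset walk_orbit (t :: s) u.
    apply: walk_orbit_min (walk_orbit_refl _ _); apply: closed_sub (walk_orbit_closed _ _) => v vs.
    by rewrite in_cons vs orbT.
  have e3 : walk_orbit (t :: s) (high t) = walk_orbit (t :: s) t.1.
    apply: walk_orbit_eq; have /andP[_] := walk_orbit_closed (t :: s) t.1.
    by case/andP=> /eqP <- _; rewrite walk_orbit_refl.
  by rewrite -U subUset -{1}e1 -{1}e3 -{1}e2 !sub.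
case: ifP => // nOA; rewrite big1_seq // => s /andP[/andP[/andP[/andP[h1 _] h2] /eqP e] _].
apply/eqP; apply: contraNT h => W0.
have OA : O \subset A by rewrite -e walk_orbit_min // cA.
have c : closed_under s O by rewrite -e walk_orbit_closed.
rewrite OA -{1}e walk_orbit_refl (walk_weight_stable W0 OA c) andbT /=.
apply: contraNN nOA => pO; rewrite eqEsubset OA /=.
apply: subset_trans (forall_inP h2 _ qA) (walk_orbit_min _ _); last by rewrite -e walk_orbit_refl.
have /andP[c1 c2] := c; rewrite /closed_under c1 /= c2 pO andbT eq_sym.
by rewrite -e walk_orbit_refl.
Qed.

(** * The last step at the largest vertex *)

Section Top.
Variables (A : {set V}) (rho : {perm V}) (i0 : 'I_n).
Local Notation q := ((i0, false) : V).
Hypotheses (m : matching rho) (sA : stable A rho) (qA : q \in A).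
Hypothesis top : forall x, x \in A -> (x.1 <= i0)%N.

Lemma valid_cons_top p s : valid A ((p, i0) :: s) = [&& p \in A, (p.1 < i0)%N & valid A s].
Proof.
rewrite /valid /admissible /= qA /=; case: (p \in A) => //=; case: (p.1 < i0)%N => //=.
rewrite /desc /=; case h: (all _ s) => //=; case: s h => //= u s /andP[/and3P[_ h _] _].
by rewrite (top h).
Qed.

(** The vertices of the largest index. In a decreasing word whose head avoids that index, every
    letter avoids it, so these two vertices are never moved. *)
Let U := [set q; tau q].

Let UE x : (x \in U) = (x.1 == i0).
Proof. by case: x => i b; rewrite !inE tauE !xpair_eqE -andb_orr; case: b; rewrite andbT. Qed.

Lemma valid_below t s : t.2 != i0 -> valid A (t :: s) = valid (A :\: U) (t :: s).
Proof.
have lt0 u : high u \in A -> (u.2 <= i0)%N by move=> /top.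
have e (u : marked n) : (u.2 < i0)%N -> admissible A u = admissible (A :\: U) u.
  move=> ui; rewrite /admissible !in_setD !UE /= -!val_eqE /= [X in ~~ X && (high u \in A)]ltn_eqF //=.
  case: (u.1 \in A) => //=; case: (high u \in A) => //=; rewrite ?andbF //.
  case h: (u.1.1 < u.2)%N; last by rewrite andbF.
  by rewrite ltn_eqF // (ltn_trans h ui).
move=> ti; rewrite /valid; case h: (desc _); rewrite ?andbF // !andbT.
case: (ltngtP t.2 i0) => [ti0|ti0|/val_inj e0]; last by rewrite e0 eqxx in ti.
  have hk : all (fun u : marked n => u.2 < i0)%N (t :: s).
    rewrite /= ti0 /=; apply: sub_all (order_path_min _ h) => [u hu|u v w h1 h2].
      exact: leq_ltn_trans hu ti0.
    exact: leq_trans h2 h1.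
  by apply: eq_in_all => u /(allP hk) /e.
have nt : high t \notin A by apply/negP => /lt0; rewrite leqNgt ti0.
by rewrite /= /admissible !in_setD (negPf nt) !andbF.
Qed.

(** A word that does not move q and [tau q] can reach [tau] only if [rho] already pairs them; the
    pair then splits off with weight one. *)
Lemma walk_weight_below s : valid (A :\: U) s ->
  W A rho s = (rho q == tau q)%:R * W (A :\: U) rho s.
Proof.
case/andP=> hs _; have sUA : U \subset A.
  by rewrite subUset !sub1set qA (stable_tau sA).
have d : [disjoint A :\: U & U] by rewrite disjoint_sym disjoint_setD.
have [e|ne] := eqVneq (rho q) (tau q).
  have sU : stable U rho.
    apply/forall_inP => x; rewrite !inE => /orP[] /eqP ->.
      by rewrite eqxx orbT e eqxx orbT.
    by rewrite tauK eqxx -e matchingK // eqxx.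
  have sD : stable (A :\: U) rho by apply: stableD.
  have e1 : A = (A :\: U) :|: U by rewrite setUC setU_setD.
  rewrite [in LHS]e1 walk_weight_split //; last by apply: sub_all hs => t ht; rewrite /= ht.
  rewrite (all_filterP hs) mul1r (_ : filter _ s = [::]) /=.
    rewrite (_ : [forall x in U, _] = true) ?mulr1 //.
    apply/forall_inP => x; rewrite !inE => /orP[] /eqP -> //; first by rewrite e.
    by rewrite -{1}e matchingK // tauK.
  apply/eqP; rewrite -size_eq0 size_filter -leqn0 leqNgt -has_count; apply/hasPn => t ts.
  by rewrite (admissibleF d) // (allP hs).
rewrite mul0r; apply/eqP; apply: contraNT ne => W0.
have cU : closed_under s U.
  apply/andP; split.
    by apply/forall_inP => x; rewrite !UE tauE.
  by apply: sub_all hs => t /and3P[]; rewrite !in_setD => /andP[/negPf -> _] /andP[/negPf -> _].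
have sU := walk_weight_stable W0 sUA cU.
have /(stable_rho sU) : q \in U by rewrite UE.
by rewrite !inE (negPf (matching_neq _ m)).
Qed.

Lemma mono_sum_top k : mono_sum k A rho = (rho q == tau q)%:R * mono_sum k (A :\: U) rho +
  (if k is k'.+1 then
    \sum_(p | (p \in A) && (p.1 < i0)%N) step_weight rho p q * mono_sum k' A (rho ^ tperm p q)%g else 0).
Proof.
rewrite /mono_sum; case: k => [|k].
  by rewrite !sum_words0 addr0; exact: (walk_weight_below (s := [::]) isT).
rewrite !sum_wordsS mulr_sumr (bigID (fun t : marked n => t.2 == i0)) /= addrC; congr (_ + _).
  rewrite [RHS](bigID (fun t : marked n => t.2 == i0)) /= [X in _ = X + _]big1 ?add0r.
    apply: eq_bigr => t ti; rewrite mulr_sumr; apply: eq_big => s.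
      exact: valid_below.
    by move=> hv; rewrite valid_below // in hv; exact: (walk_weight_below hv).
  move=> t /eqP ti; rewrite big_pred0 ?mulr0 // => s.
  by rewrite /valid /= /admissible !in_setD !UE /= ti eqxx /= andbF.
rewrite (reindex_onto (fun p : V => (p, i0)) fst) /=; last by case=> p i /= /eqP ->.
rewrite [RHS]big_mkcond [LHS]big_mkcond /=; apply: eq_bigr => p _; rewrite !eqxx /=.
under eq_bigl => s do rewrite valid_cons_top.
case: (p \in A) => /=; last by rewrite big_pred0.
case: (p.1 < i0)%N => /=; last by rewrite big_pred0.
by rewrite mulr_sumr.
Qed.

Lemma trans_sum_top k : trans_sum k.+1 A rho =
    \sum_(p | (p \in A) && (p.1 < i0)%N) step_weight rho p q *
     (trans_sum k A (rho ^ tperm p q)%g +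
      \sum_(O : {set V} | [&& O \subset A, q \in O, p \notin O & stable O (rho ^ tperm p q)%g])
        \sum_(i < k.+1) trans_sum i O (rho ^ tperm p q)%g * trans_sum (k - i) (A :\: O) (rho ^ tperm p q)%g).
Proof.
rewrite /trans_sum sum_wordsS (bigID (fun t : marked n => t.2 == i0)) /= [X in _ + X = _]big1 ?addr0.
  rewrite (reindex_onto (fun p : V => (p, i0)) fst) /=; last by case=> p i /= /eqP ->.
  rewrite [RHS]big_mkcond [LHS]big_mkcond /=; apply: eq_bigr => p _; rewrite !eqxx /=.
  under eq_bigl => s do rewrite valid_cons_top.
  have [pA|pA] := boolP (p \in A); last by rewrite big_pred0.
  case: (p.1 < i0)%N => /=; last by rewrite big_pred0.
  rewrite -mulr_sumr; congr (_ * _).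
  have s' : stable A (rho ^ tperm p q)%g by apply: stable_conj; rewrite ?pA.
  exact: (@trans_sum_last k A _ (p, i0) (matching_conj _ m) s' pA qA).
(* If the head avoids the largest index then [U] is closed under the word, yet [t.1] is a vertex of
   A outside [U], so the word is not transitive. *)
move=> t ti; rewrite big_pred0 // => s; apply/negP => /andP[v /forall_inP tr].
have := v; rewrite valid_below // => /andP[/andP[/and3P[t1 _ _] _] _].
have /andP[/andP[_ hs] _] := v.
have := tr q qA; move/subsetP => /(_ t.1); move: t1; rewrite in_setD => /andP[tU tA] /(_ tA).
apply/negP; apply: contra tU; apply/subsetP; apply: walk_orbit_min; last by rewrite UE.
apply/andP; split; first by apply/forall_inP => x; rewrite !UE tauE.
have : valid (A :\: U) (t :: s) by rewrite -valid_below.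
case/andP=> h _; apply: sub_all h => u /and3P[].
by rewrite !in_setD => /andP[/negPf -> _] /andP[/negPf -> _].
Qed.

End Top.
End Weighted.
End Walks.

(** * Dependence on the type *)

Lemma sum_picks_map (I : eqType) (R : nmodType) (g : I -> nat) (s : seq I)
    (F : nat -> seq nat -> R) : uniq s ->
  \sum_(y <- picks [seq g x | x <- s]) F y.1 y.2 =
  \sum_(x <- s) F (g x) [seq g z | z <- rem x s].
Proof.
elim: s F => [|x s IH] F; first by rewrite !big_nil.
case/andP=> xs us; rewrite map_cons sum_picks_cons big_cons /= eqxx; congr (_ + _).
rewrite (IH (fun y m => F y (g x :: m)) us); apply: eq_big_seq => z zs.
by rewrite ifN //; apply: contraNneq xs => ->.
Qed.

Lemma sum_picks_set (I : finType) (R : nmodType) (g : I -> nat) (S : {set I})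
    (F : nat -> seq nat -> R) : (forall y s t, perm_eq s t -> F y s = F y t) ->
  \sum_(y <- picks [seq g x | x <- enum S]) F y.1 y.2 =
  \sum_(x in S) F (g x) [seq g z | z <- enum (S :\ x)].
Proof.
move=> HF; rewrite sum_picks_map ?enum_uniq // big_enum_cond /=.
apply: eq_big => [x|x]; first by rewrite ?andbT.
rewrite ?andbT => xS; apply: HF; apply: perm_map.
apply: uniq_perm; rewrite ?rem_uniq ?enum_uniq // => z.
by rewrite mem_rem_uniq ?enum_uniq // mem_enum !inE mem_enum.
Qed.

(** Any rearrangement of the type comes from an enumeration of the components, so its entries can be
    indexed by actual components even when parts repeat. *)
Lemma perm_map_lift (I J : eqType) (f : I -> J) (s : seq I) (m : seq J) :
  perm_eq m [seq f x | x <- s] -> exists2 e, perm_eq e s & [seq f x | x <- e] = m.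
Proof.
elim: m s => [|b m IH] s pm.
  by exists [::] => //; have := perm_size pm; rewrite size_map => /esym/size0nil ->.
have /mapP[x xs e] : b \in [seq f x | x <- s] by rewrite -(perm_mem pm) mem_head.
have px := perm_to_rem xs.
have : perm_eq m [seq f x | x <- rem x s].
  rewrite -(perm_cons b); apply: perm_trans pm _.
  by rewrite e -map_cons; apply: perm_map.
case/IH=> t pt et; exists (x :: t); last by rewrite /= e et.
by rewrite perm_sym; apply: perm_trans px _; rewrite perm_cons perm_sym.
Qed.

Section Types.
Variable n : nat.
Local Notation V := (barset n).
Local Notation tau := (tau n).
Implicit Types (rho : {perm V}) (A B O : {set V}) (p q x y : V).

Lemma max_vertexP A rho : stable A rho -> A != set0 ->
  exists2 i0 : 'I_n, (i0, false) \in A & forall x, x \in A -> (x.1 <= i0)%N.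
Proof.
move=> sA /set0Pn[x xA].
have [z zA zmax] := @arg_maxnP _ x (mem A) (fun y => y.1 : nat) xA.
exists z.1; last exact: zmax.
by case: z zA {zmax} => i [] // /(stable_tau sA); rewrite tauE.
Qed.

Lemma porbit_step1 rho q : matching rho ->
  (#|porbit (step rho) q| == 1%N) = (rho q == tau q).
Proof.
move=> m; apply/eqP/eqP => [h|h].
  have := iter_porbit (step rho) q; rewrite h /= stepE => e.
  by rewrite -{1}e matchingK.
apply: card_porbit_iter => //; last by case.
by rewrite /= stepE -h matchingK.
Qed.

Lemma comp_porbit1 rho q : matching rho -> rho q = tau q -> comp rho q = [set q; tau q].
Proof.
move=> m e; apply/eqP; rewrite eqEsubset; apply/andP; split.
  apply: comp_min; last by rewrite !inE eqxx.
  apply/forall_inP => x; rewrite !inE => /orP[] /eqP ->.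
    by rewrite eqxx orbT e eqxx orbT.
  by rewrite tauK eqxx -e matchingK // eqxx.
by rewrite subUset !sub1set comp_refl (stable_tau (comp_stable _ _)) // comp_refl.
Qed.

Section Steps.
Variables (A : {set V}) (rho : {perm V}) (i0 : 'I_n).
Local Notation q := ((i0, false) : V).
Hypotheses (m : matching rho) (sA : stable A rho) (qA : q \in A).
Hypothesis top : forall x, x \in A -> (x.1 <= i0)%N.
Local Notation M := #|porbit (step rho) q|.
Local Notation x_ i := (iter i (step rho) q).

(** On the component of q, the condition on p excludes exactly q and [tau q], which sit at position
    0 of the two halves; hence the positions start at 1. *)
Lemma sum_steps (R : zmodType) (F : V -> R) :
  \sum_(p | (p \in A) && (p.1 < i0)%N) F p =
  \sum_(B in comps (A :\: comp rho q) rho) \sum_(p in B) F p +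
  \sum_(i < M.-1) (F (x_ i.+1) + F (tau (x_ i.+1))).
Proof.
have CA : comp rho q \subset A by apply: comp_min.
have ltE p : p \in A -> (p.1 < i0)%N = (p != q) && (p != tau q).
  move=> pA; rewrite ltn_neqAle top // andbT.
  by case: p {pA} => i [] /=; rewrite tauE !xpair_eqE !andbT ?andbF ?andbT.
rewrite (bigID (fun p => p \in comp rho q)) /= addrC; congr (_ + _).
  rewrite (partition_big (comp rho) (fun B => B \in comps (A :\: comp rho q) rho)) /=; last first.
    by move=> p /andP[/andP[pA _] pC]; apply: imset_f; rewrite inE pC.
  apply: eq_bigr => B /imsetP[x]; rewrite inE => /andP[xC xA] ->; apply: eq_bigl => p.
  apply/andP/idP => [[_ /eqP <-]|px]; first exact: comp_refl.
  have e := comp_eq m px; rewrite e eqxx; split=> //.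
  have pA : p \in A by apply: subsetP px; apply: comp_min.
  have pC : p \notin comp rho q.
    by apply: contra xC => pC; rewrite -(comp_eq m pC) e comp_refl.
  rewrite pA pC andbT ltE //=; apply/andP; split; apply: contraNneq pC => ->; first exact: comp_refl.
  exact: stable_tau (comp_stable _ _) (comp_refl _ _).
pose P := porbit (step rho) q.
have MP : M = M.-1.+1 by rewrite prednK // lt0n card_porbit_neq0.
have sumP (H : V -> R) : \sum_(p in P | p != q) H p = \sum_(i < M.-1) H (x_ i.+1).
  rewrite big_mkcondr /=.
  rewrite (eq_bigl (fun p => p \in traject (step rho) q M)); last exact: porbit_traject.
  rewrite -big_uniq ?uniq_traject_porbit //=.
  rewrite -[M]/(M) {1}MP trajectS big_cons eqxx add0r.
  rewrite -(big_map id xpredT (fun p => if p != q then H p else 0)) map_id.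
  rewrite (_ : traject (step rho) (step rho q) M.-1 = [seq x_ i.+1 | i <- iota 0 M.-1]); last first.
    apply: (@eq_from_nth _ (step rho q)); rewrite size_traject ?size_map ?size_iota // => i hi.
    by rewrite nth_traject // (nth_map 0%N) ?size_iota // nth_iota // add0n iterSr.
  rewrite big_map -(big_mkord xpredT (fun i => H (x_ i.+1))) /index_iota subn0.
  rewrite [LHS]big_seq_cond [RHS]big_seq_cond; apply: eq_bigr => i; rewrite mem_iota /= add0n andbT => hi.
  case: eqP => // e.
  have lt1 : (i.+1 < M)%N by rewrite MP ltnS.
  have lt0 : (0 < M)%N by rewrite MP.
  by have := iter_porbit_inj lt1 lt0 e.
rewrite big_split /= -(sumP F) -(sumP (fun p => F (tau p))) (bigID (fun p => p \in P)) /=; congr (_ + _).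
  apply: eq_bigl => p; apply/idP/idP => [/andP[/andP[/andP[pA h] _] pP]|/andP[pP pq]].
    by rewrite pP; move: h; rewrite ltE // => /andP[].
  have pC : p \in comp rho q by apply: subsetP pP; apply: porbit_sub_comp.
  have pA : p \in A by apply: (subsetP CA).
  rewrite pA pC pP ltE // pq /= !andbT; apply: contraTneq pP => ->.
  exact: porbit_tauF m (porbit_id _ _).
(* The reflection [tau] carries the remaining half of the component onto the orbit of q. *)
rewrite (reindex_inj (@perm_inj _ tau)) /=; apply: eq_bigl => p.
have pC : (tau p \in comp rho q) && (tau p \notin P) = (p \in P).
  rewrite (stable_tauE _ (comp_stable _ _)) compE // in_setU in_set.
  case h: (p \in P); first by rewrite (porbit_tauF m).
  by rewrite /= andbN.
rewrite -andbA pC andbC; case h: (p \in P) => //=.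
have : tau p \in comp rho q by move: pC; rewrite h => /andP[].
move/(subsetP CA) => pA; rewrite pA ltE //= (inj_eq perm_inj) andbC.
rewrite (_ : (tau p != q) = true) ?andbT //.
apply: contraTneq h => e; have -> : p = tau q by rewrite -e tauK.
exact: porbit_tauF m (porbit_id _ _).
Qed.

End Steps.

(** * Components named by indices *)

Section Labels.
Variables (I : finType) (rho : {perm V}).
Hypothesis m : matching rho.

(** A bijection from S to the components inside A. Indices keep equal parts apart and turn sums over
    stable sets into the sums over index sets that appear in the recursion. *)
Definition labels A (S : {set I}) (lab : I -> {set V}) :=
  {in S &, injective lab} /\ lab @: S = comps A rho.

Lemma typ_labels A S lab : labels A S lab ->
  perm_eq (typ A rho) [seq #|lab i|./2 | i <- enum S].
Proof.
case=> inj e; rewrite /typ -e [X in perm_eq _ X](map_comp (fun B : {set V} => #|B|./2) lab).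
apply: perm_map; apply: uniq_perm; rewrite ?enum_uniq //.
  by rewrite map_inj_in_uniq ?enum_uniq // => i j; rewrite !mem_enum; apply: inj.
move=> B; rewrite mem_enum; apply/imsetP/mapP => -[i iS ->]; exists i => //.
  by rewrite mem_enum.
by rewrite mem_enum in iS.
Qed.

Variables (A : {set V}) (lab : I -> {set V}).
Hypotheses (sA : stable A rho) (hl : labels A setT lab).

Definition union_of (S : {set I}) : {set V} := \bigcup_(i in S) lab i.

Lemma lab_inj : injective lab.
Proof. by case: hl => h _ i j; apply: h. Qed.

Lemma lab_comp i x : x \in lab i -> lab i = comp rho x.
Proof.
have : lab i \in comps A rho by case: hl => _ <-; apply: imset_f.
by case/imsetP=> y _ -> /(comp_eq m).
Qed.

Lemma lab_neq0 i : exists x, x \in lab i.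
Proof.
have : lab i \in comps A rho by case: hl => _ <-; apply: imset_f.
by case/imsetP=> y _ ->; exists y; apply: comp_refl.
Qed.

Lemma lab_eq i j x : x \in lab i -> x \in lab j -> i = j.
Proof. by move=> /lab_comp e1 /lab_comp e2; apply: lab_inj; rewrite e1 e2. Qed.

Lemma lab_sub i : lab i \subset A.
Proof.
have : lab i \in comps A rho by case: hl => _ <-; apply: imset_f.
by case/imsetP=> y yA ->; apply: comp_min.
Qed.

Lemma lab_ex x : x \in A -> exists i, x \in lab i.
Proof.
move=> xA; have : comp rho x \in comps A rho by apply: imset_f.
by case: hl => _ <- /imsetP[i _ e]; exists i; rewrite -e comp_refl.
Qed.

Lemma mem_union S i x : x \in lab i -> (x \in union_of S) = (i \in S).
Proof.
move=> xi; apply/bigcupP/idP => [[j jS xj]|iS]; last by exists i.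
by rewrite (lab_eq xi xj).
Qed.

Lemma union_sub S : union_of S \subset A.
Proof. by apply/bigcupsP => i _; apply: lab_sub. Qed.

Lemma union_stable S : stable (union_of S) rho.
Proof.
apply/forall_inP => x /bigcupP[i iS xi].
have si : stable (lab i) rho by rewrite (lab_comp xi) comp_stable.
by rewrite !(@mem_union S i) ?iS ?(stable_tau si) ?(stable_rho si).
Qed.

Lemma unionD S : A :\: union_of S = union_of (~: S).
Proof.
apply/setP => x; rewrite inE; have [/lab_ex[i xi]|xA] := boolP (x \in A).
  by rewrite !(mem_union _ xi) inE andbT.
rewrite andbF; apply/esym/negbTE; apply: contra xA; apply/subsetP; exact: union_sub.
Qed.

Lemma unionT : union_of setT = A.
Proof.
apply/setP => x; apply/idP/idP; first by apply/subsetP/union_sub.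
by move=> /lab_ex[i xi]; rewrite (mem_union _ xi).
Qed.

Lemma union_labels S : labels (union_of S) S lab.
Proof.
split; first by move=> i j _ _; apply: lab_inj.
apply/setP => B; apply/imsetP/imsetP => [[i iS ->]|[x /bigcupP[i iS xi] ->]].
  have [x xi] := lab_neq0 i; exists x; last exact: lab_comp.
  by rewrite (mem_union _ xi).
by exists i => //; rewrite (lab_comp xi).
Qed.

(** A stable set is recovered from the labels of the components it contains. *)
Lemma sum_stable (R : nmodType) (F : {set V} -> R) x r : x \in lab r ->
  \sum_(O : {set V} | [&& O \subset A, x \in O & stable O rho]) F O =
  \sum_(S : {set I} | r \in S) F (union_of S).
Proof.
move=> xr.
rewrite (reindex_onto union_of (fun O => [set i | lab i \subset O])) /=; last first.
  move=> O /and3P[/subsetP OA _ sO]; apply/setP => y; apply/bigcupP/idP.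
    by case=> i; rewrite inE => /subsetP h /h.
  move=> yO; have [i yi] := lab_ex (OA y yO); exists i => //.
  by rewrite inE (lab_comp yi); apply: comp_min.
apply: eq_bigl => S; rewrite union_sub (mem_union _ xr) union_stable /= andbT.
rewrite (_ : _ == _ = true) ?andbT //; apply/eqP/setP => i; rewrite inE.
have [y yi] := lab_neq0 i; rewrite -(mem_union S yi); apply/idP/idP => [/subsetP -> //|h].
by rewrite (lab_comp yi); apply: comp_min => //; apply: union_stable.
Qed.

End Labels.

Section Count.
Variables (R : comNzRingType) (C J T : R).
Local Notation D := (mono_sum C J T).
Local Notation G := (trans_sum C J T).
Local Notation wl := (step_weight C J T).
Local Notation Z := (type_sum C J T).

Section Local.
Variables (rho : {perm V}) (q : V).
Hypothesis m : matching rho.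

Lemma step_weight_join p : p \notin comp rho q -> wl rho p q = C.
Proof. by rewrite /wl => ->. Qed.

Lemma step_weight_cut i : wl rho (iter i (step rho) q) q = J.
Proof.
have h : iter i (step rho) q \in porbit (step rho) q by rewrite -permX mem_porbit.
by rewrite /wl (subsetP (porbit_sub_comp _ _) _ h) /= h.
Qed.

Lemma step_weight_twist i : wl rho (tau (iter i (step rho) q)) q = T.
Proof.
have h : iter i (step rho) q \in porbit (step rho) q by rewrite -permX mem_porbit.
rewrite /wl (stable_tau (comp_stable _ _)) /=; last exact: (subsetP (porbit_sub_comp _ _)).
by rewrite (negPf (porbit_tauF m h)).
Qed.

End Local.

Lemma mono_sum0 k rho : D k set0 rho = (k == 0%N)%:R.
Proof.
rewrite /mono_sum; case: k => [|k]; last first.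
  by rewrite sum_wordsS big1 // => t _; rewrite big_pred0 // => s; rewrite /valid /= /admissible in_set0.
rewrite sum_words0 /= (_ : [forall x in set0, _]) //.
by apply/forall_inP => x; rewrite in_set0.
Qed.

(** This is the delta term of [type_sum]: q is paired with [tau q] exactly when its part is 1, which
    is entered there as 0. *)
Lemma mono_sum_fixed k N A rho (q : V) : matching rho -> stable A rho -> q \in A ->
  (forall B r, (#|B| < N)%N -> matching r -> stable B r -> D k B r = Z k [seq a.-1 | a <- typ B r]) ->
  (#|A| < N.+1)%N ->
  (rho q == tau q)%:R * D k (A :\: [set q; tau q]) rho =
  (#|porbit (step rho) q|.-1 == 0%N)%:R * Z k [seq a.-1 | a <- typ (A :\: comp rho q) rho].
Proof.
move=> m sA qA IH leN.
have M0 : (0 < #|porbit (step rho) q|)%N by rewrite lt0n card_porbit_neq0.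
have -> : (#|porbit (step rho) q|.-1 == 0%N) = (rho q == tau q).
  by rewrite -porbit_step1 //; case: #|_| M0.
case: eqP => e; last by rewrite !mul0r.
rewrite -(comp_porbit1 m e) IH //.
  apply: leq_trans (_ : #|A| <= N)%N; last by [].
  apply: proper_card; apply/properP; split; first exact: subsetDl.
  by exists q => //; rewrite in_setD comp_refl.
by apply: stableD => //; apply: comp_stable.
Qed.

(** Induction on k and, inside it, on the size of A: a genuine last step lowers k, while discarding
    a pair already matched by [tau] keeps k and shrinks A. Symmetry of [type_sum] brings the
    component of the largest vertex to the head. *)
Lemma mono_sum_typ k A rho : matching rho -> stable A rho ->
  D k A rho = Z k [seq a.-1 | a <- typ A rho].
Proof.
elim: k A rho => [|k IHk] A rho; have [N leN] := ubnP #|A|;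
  elim: N A rho leN => // N IHN A rho leN m sA; (have [->|A0] := eqVneq A set0;
  [by rewrite mono_sum0 /typ /comps imset0 enum_set0 | ]);
  have [i0 qA top] := max_vertexP sA A0; set q := (i0, false) in qA;
  rewrite (mono_sum_top _ _ _ m sA qA top) (type_sum_sym C J T _ (perm_map _ (typ_block m sA qA))) type_sum_cons;
  rewrite -/q card_comp_half //; set M := #|porbit (step rho) q|;
  have M0 : (0 < M)%N by (rewrite lt0n card_porbit_neq0).
- by rewrite !addr0; apply: (mono_sum_fixed m sA qA IHN).
rewrite (mono_sum_fixed m sA qA IHN leN); congr (_ + _).
have m' p : matching (rho ^ tperm p q)%g by apply: matching_conj.
have s' p : p \in A -> stable A (rho ^ tperm p q)%g by move=> pA; apply: stable_conj; rewrite ?pA.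
have xA i : iter i (step rho) q \in A by apply: stable_iter.
have txA i : tau (iter i (step rho) q) \in A by apply: (stable_tau sA).
rewrite (sum_steps m sA qA top) -/q -/M big_split /= /last_step.
rewrite [X in _ + X = _]addrC addrA; congr (_ + _ + _).
- set S := comps _ _; rewrite -[X in picks X]map_comp.
  rewrite (@sum_picks_set _ _ (fun B : {set V} => #|B|./2.-1) S
     (fun (y : nat) s => (2 * y.+1)%:R * C * Z k ((M.-1 + y).+1 :: s))); last first.
    by move=> y s t p; congr (_ * _); apply: type_sum_sym; rewrite perm_cons.
  apply: eq_bigr => B BS; have := BS; case/imsetP=> x; rewrite in_setD => /andP[xC xA'] eB.
  (* All vertices of B lead to the same type, and their number is the coefficient of the join term
     in [last_step]. *)
  transitivity (\sum_(p in B) C * Z k ((M.-1 + #|B|./2.-1).+1 :: [seq #|B|./2.-1 | B : {set V} <- enum (S :\ B)])).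
    apply: eq_bigr => p; rewrite eB => px; have ep := comp_eq m px.
    have pC : p \notin comp rho q.
      by apply: contra xC => pC; rewrite -(comp_eq m pC) ep comp_refl.
    have pA : p \in A by apply: subsetP px; apply: comp_min.
    rewrite step_weight_join // IHk ?s' //; congr (_ * _).
    rewrite (type_sum_sym C J T k (perm_map _ (join_typ m sA pA qA pC).2)) /= !card_comp_half // -/M.
    rewrite ep; congr (Z k (_ :: _)).
      have : (0 < #|porbit (step rho) x|)%N by rewrite lt0n card_porbit_neq0.
      by rewrite -(card_comp_half p) // ep card_comp_half //; lia.
    rewrite -map_comp; suff -> : S :\ comp rho x = comps (A :\: (comp rho q :|: comp rho x)) rho by [].
    rewrite -setDDl; have [|e1 e2] := @comps_block n (A :\: comp rho q) rho x m (stableD m sA (comp_stable _ _)).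
      by rewrite in_setD xC.
    rewrite /S e1; apply/setP => B'; rewrite !inE.
    by case: eqP => // ->; rewrite (negPf e2).
  rewrite sumr_const -[LHS]mulr_natl mulrA; congr (_%:R * _ * _).
  have : (0 < #|porbit (step rho) x|)%N by rewrite lt0n card_porbit_neq0.
  by rewrite eB card_comp_half // card_comp //; lia.
- rewrite (eq_bigr (fun=> T * Z k (M.-1 :: [seq a.-1 | a <- typ (A :\: comp rho q) rho]))).
    by rewrite sumr_const card_ord -[LHS]mulr_natl mulrA.
  move=> i _; rewrite (@step_weight_twist rho q m i.+1) IHk ?s' //; last exact: (txA i.+1); congr (_ * _); apply: type_sum_sym.
  have hi : (0 < i.+1 < #|porbit (step rho) q|)%N by have := ltn_ord i; rewrite -/M; lia.
  rewrite -[_ :: _](map_cons predn M); apply: perm_map.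
  apply: perm_trans (twist_typ m sA (txA _) qA hi erefl) _.
  by have := typ_block m sA qA; rewrite card_comp_half.
apply: eq_bigr => i _; rewrite (@step_weight_cut rho q i.+1) IHk ?s' //; last exact: (xA i.+1); congr (_ * _).
have hi : (0 < i.+1 < #|porbit (step rho) q|)%N by have := ltn_ord i; rewrite -/M; lia.
rewrite (type_sum_sym C J T k (perm_map _ (cut_typ m sA (xA _) qA hi erefl))) /= -/M.
by congr (Z k [:: _, _ & _]); lia.
Qed.

(* Solves [mono_sum_orbit] for the term [O = A]; N is fuel. *)
Fixpoint conn_fuel N k (l : seq nat) : R :=
  if N is N'.+1 then
    Z k [seq a.-1 | a <- l] -
    \sum_(S : {set 'I_(size l)} | [exists i in S, val i == 0%N] && (S != setT))
      \sum_(i < k.+1) conn_fuel N' i [seq nth 0%N l j | j : 'I_(size l) <- enum S] *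
        Z (k - i) [seq a.-1 | a <- [seq nth 0%N l j | j : 'I_(size l) <- enum (~: S)]]
  else 0.

(** The orbit is taken at a vertex of the component with index 0, which explains the condition on S
    in [conn_fuel]. A proper set of components is smaller, so one unit of fuel less suffices for
    it. *)
Lemma trans_sum_fuel N k A rho (e : seq {set V}) : matching rho -> stable A rho ->
  uniq e -> e =i comps A rho -> (0 < size e <= N)%N ->
  G k A rho = conn_fuel N k [seq #|B|./2 | B : {set V} <- e].
Proof.
elim: N k A rho e => [|N IH] k A rho e m sA ue he /=; first by case: (size e).
set l := [seq _ | B <- e]; have sl : size l = size e by rewrite size_map.
case/andP=> e0 eN.
pose lab (i : 'I_(size l)) := nth set0 e i.
have il (i : 'I_(size l)) : (i < size e)%N by rewrite -sl.
have nl (i : 'I_(size l)) : nth 0%N l i = #|lab i|./2 by rewrite (nth_map set0).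
have hl : labels rho A setT lab.
  split.
    move=> i j _ _ /eqP; rewrite nth_uniq // => /eqP; exact: val_inj.
  apply/setP => B; rewrite -he; apply/imsetP/idP => [[i _ ->]|Be]; first exact: mem_nth.
  have hB : (index B e < size l)%N by rewrite sl index_mem.
  by exists (Ordinal hB) => //; rewrite /lab /= nth_index.
have l0 : (0 < size l)%N by rewrite sl.
pose r : 'I_(size l) := Ordinal l0.
have [x xr] := lab_neq0 hl r.
have xA : x \in A := subsetP (lab_sub sA hl r) _ xr.
have typl : perm_eq (typ A rho) l.
  by apply: perm_map; apply: uniq_perm; rewrite ?enum_uniq // => B; rewrite mem_enum he.
rewrite -(type_sum_sym C J T k (perm_map _ typl)) -mono_sum_typ //.
rewrite (mono_sum_orbit _ _ _ _ m sA xA) (sum_stable m sA hl _ xr).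
(* For O = A the complement is empty and admits only the empty word, so this term is the single
   transitive sum with all k steps. *)
rewrite (bigD1 setT) //= (unionT m sA hl) setDv.
rewrite big_ord_recr /= subnn mono_sum0 mulr1 big1 ?add0r; last first.
  by move=> i _; rewrite mono_sum0 subn_eq0 leqNgt ltn_ord mulr0.
set s1 := (X in _ + X - _); set s2 := (X in _ - X); suff -> : s1 = s2 by rewrite addrK.
apply: eq_big => S.
  congr (_ && _); apply/idP/exists_inP => [rS|[i iS /eqP i0]]; first by exists r.
  by rewrite (_ : r = i) //; apply: val_inj.
case/andP=> rS nS; apply: eq_bigr => i _.
have uS := union_labels m hl S; have uC := union_labels m hl (~: S).
congr (_ * _).
  rewrite (IH i _ rho [seq lab j | j <- enum S]) //.
  - by congr (conn_fuel N i _); rewrite -map_comp; apply: eq_map => j /=; rewrite nl.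
  - exact: (union_stable m hl).
  - by rewrite map_inj_uniq ?enum_uniq //; apply: (lab_inj hl).
  - move=> B; case: uS => _ <-; apply/mapP/imsetP => -[j jS ->]; exists j => //.
      by rewrite mem_enum in jS.
    by rewrite mem_enum.
  rewrite size_map -cardE; apply/andP; split; first by apply/card_gt0P; exists r.
  rewrite -ltnS; apply: leq_trans eN; rewrite -sl -[X in (_ < X)%N](card_ord (size l)) -cardsT.
  by rewrite ltn_neqAle subset_leq_card ?subsetT // andbT; apply: contra nS => /eqP h;
     rewrite eqEcard subsetT h leqnn.
rewrite (unionD m sA hl) mono_sum_typ //; last exact: (union_stable m hl).
rewrite (_ : [seq nth 0%N l j | j : 'I_(size l) <- enum (~: S)] = [seq #|lab j|./2 | j <- enum (~: S)]).
  by apply: type_sum_sym; apply: perm_map; apply: typ_labels uC.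
by apply: eq_map => j /=; rewrite nl.
Qed.

Definition conn_sum k (l : seq nat) := conn_fuel (size l) k l.

(** The right side knows neither the order of the vertices nor which component holds the largest
    one, and l may list the parts in any order. *)
Lemma trans_sum_conn k A rho l : matching rho -> stable A rho -> A != set0 ->
  perm_eq l (typ A rho) -> G k A rho = conn_sum k l.
Proof.
move=> m sA /set0Pn[x xA] pl; have [e pe <-] := perm_map_lift pl.
rewrite /conn_sum size_map; apply: trans_sum_fuel => //.
- by rewrite (perm_uniq pe) enum_uniq.
- by move=> B; rewrite (perm_mem pe) mem_enum.
rewrite leqnn andbT (perm_size pe) -cardE; apply/card_gt0P; exists (comp rho x).
exact: imset_f.
Qed.

End Count.
End Types.

(** * The recursion for transitive walks *)

Lemma subcomp_perm (l : seq nat) (S : {set 'I_(size l)}) r a : r \in S ->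
  perm_eq (subcomp S r a) (a :: [seq nth 0%N l i | i : 'I_(size l) <- enum (S :\ r)]).
Proof.
move=> rS; rewrite /subcomp -{1}(setD1K rS).
apply: perm_trans (perm_map _ (perm_enum_setU1 _)) _; first by rewrite !inE eqxx.
rewrite /= eqxx perm_cons; set u := map _ _; set v := map _ _.
suff -> : u = v by []; apply/eq_in_map => i.
by rewrite mem_enum !inE => /andP[/negPf ->].
Qed.

Lemma map_nth_enum (l : seq nat) : [seq nth 0%N l i | i : 'I_(size l) <- enum 'I_(size l)] = l.
Proof. by rewrite (map_comp (nth 0%N l) val) val_enum_ord; apply: mkseq_nth. Qed.

Lemma perm_nth_setC1 (l : seq nat) (r : 'I_(size l)) :
  perm_eq l (nth 0%N l r :: [seq nth 0%N l i | i : 'I_(size l) <- enum (~: [set r])]).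
Proof.
rewrite -{1}(map_nth_enum l) -(map_cons (fun i : 'I_(size l) => nth 0%N l i)).
apply: perm_map; apply: uniq_perm; rewrite /= ?enum_uniq ?mem_enum ?inE ?eqxx //.
by move=> i; rewrite in_cons !mem_enum !inE; case: eqP.
Qed.

Lemma perm_swap2 (K : eqType) (x y : K) s : perm_eq [:: x, y & s] [:: y, x & s].
Proof. by apply/seq.permP => p /=; rewrite addnCA. Qed.

Lemma split_part_perm (l : seq nat) (r : 'I_(size l)) a b :
  perm_eq (split_part l r a b)
    [:: a, b & [seq nth 0%N l i | i : 'I_(size l) <- enum (~: [set r])]].
Proof.
rewrite /split_part perm_catC /= !perm_cons -(perm_cons (nth 0%N l r)).
apply: perm_trans (perm_nth_setC1 r); rewrite perm_sym.
by rewrite -[X in perm_eq X _](cat_take_drop r l) (drop_nth 0%N (ltn_ord r)) perm_catC.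
Qed.

(** The piece of q inherits the label r and the piece of p is set aside, so the same index set goes
    on serving after a cut. *)
Lemma labels_cut (n : nat) (I : finType) (A : {set barset n}) (rho : {perm barset n})
    (lab : I -> {set barset n}) (r : I) (q : barset n) (i : nat) :
  let p := iter i (step rho) q in let rho' := (rho ^ tperm p q)%g in
  matching rho -> stable A rho -> labels rho A setT lab -> q \in lab r ->
  (0 < i < #|porbit (step rho) q|)%N ->
  labels rho' (A :\: comp rho' p) setT (fun j => if j == r then comp rho' q else lab j).
Proof.
move=> p rho' m sA hl qr hi.
have m' : matching rho' by apply: matching_conj.
have labr : lab r = comp rho q := lab_comp m hl qr.
have qA : q \in A := subsetP (lab_sub sA hl r) _ qr.
have pC : p \in comp rho q := stable_iter i (comp_stable _ _) (comp_refl _ _).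
have pA : p \in A := stable_iter i sA qA.
have s' : stable A rho' by apply: stable_conj; rewrite ?pA.
have [_ c2 c3] := cut_comp m hi erefl.
have sA2 : stable (A :\: comp rho' p) rho' by apply: stableD; rewrite ?comp_stable.
have qA2 : q \in A :\: comp rho' p by rewrite in_setD qA andbT mem_comp_sym.
have A2D : (A :\: comp rho' p) :\: comp rho' q = A :\: comp rho q.
  by rewrite c3 setDDl setUC.
have sD : stable (A :\: comp rho q) rho by apply: stableD => //; apply: comp_stable.
have aD : {in A :\: comp rho q, rho =1 rho'}.
  by apply: conj_agree; rewrite ?in_setD ?pC ?comp_refl.
have compsD : comps (A :\: comp rho q) rho = lab @: (~: [set r]).
  have -> : comp rho q = union_of lab [set r] by rewrite /union_of big_set1.
  rewrite (unionD m sA hl).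
  by case: (union_labels m hl (~: [set r])).
have [e1 e2] := comps_block m' sA2 qA2.
rewrite A2D -(agree_comps sD aD) compsD in e1 e2.
have nr j : j != r -> lab j != comp rho' q.
  by move=> jr; apply: contraNneq e2 => <-; apply: imset_f; rewrite !inE.
split.
  move=> a b _ _; case: (eqVneq a r) => [->|ar]; case: (eqVneq b r) => [->|br] //.
  - by move=> e; have := nr b br; rewrite -e eqxx.
  - by move=> e; have := nr a ar; rewrite -e eqxx.
  exact: (lab_inj hl).
rewrite e1; apply/setP => B; apply/imsetP/setU1P => [[j _ ->]|].
  case: eqVneq => [_|jr]; [by left | right].
  by apply: imset_f; rewrite !inE.
case=> [->|/imsetP[j]]; first by exists r; rewrite // eqxx.
by rewrite !inE => jr ->; exists j; rewrite // (negPf jr).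
Qed.

Section Recursion.
Variables (n : nat) (R : comNzRingType) (C J T : R).
Local Notation V := (barset n).
Local Notation tau := (tau n).
Implicit Types (rho : {perm V}) (A B O : {set V}).
Local Notation D := (mono_sum C J T).
Local Notation G := (trans_sum C J T).
Local Notation wl := (step_weight C J T).
Local Notation conn := (conn_sum C J T).

Lemma trans_sum_perm k A rho l l' : matching rho -> stable A rho -> A != set0 ->
  perm_eq (typ A rho) l -> perm_eq l l' -> G k A rho = conn k l'.
Proof.
move=> m sA A0 p1 p2; apply: trans_sum_conn => //; rewrite perm_sym.
exact: perm_trans p1 p2.
Qed.

(** Two orbits can remain only when undoing the step separates p from q, so the product terms appear
    for cuts alone. *)
Lemma joined_split0 A rho p q (F : {set V} -> R) : matching rho -> p \in comp rho q ->
  \sum_(O : {set V} | [&& O \subset A, q \in O, p \notin O & stable O rho]) F O = 0.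
Proof.
move=> m pq; rewrite big_pred0 // => O; apply/negP => /and4P[_ qO pO sO].
by rewrite (subsetP (comp_min sO qO) _ pq) in pO.
Qed.

Section Labelled.
Variables (l : seq nat) (r : 'I_(size l)).
Local Notation part i := (nth 0%N l i).
Variables (A : {set V}) (rho : {perm V}) (lab : 'I_(size l) -> {set V}) (i0 : 'I_n).
Local Notation q := ((i0, false) : V).
Hypotheses (m : matching rho) (sA : stable A rho) (hl : labels rho A setT lab).
Hypothesis sz : forall i, #|lab i| = (2 * part i)%N.
Hypothesis qr : q \in lab r.
Hypothesis top : forall x, x \in A -> (x.1 <= i0)%N.

Let half i : #|lab i|./2 = part i. Proof. by rewrite sz mul2n doubleK. Qed.

Let qA : q \in A. Proof. exact: subsetP (lab_sub sA hl r) _ qr. Qed.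

Let A0 : A != set0. Proof. by apply/set0Pn; exists q. Qed.

Let labr : lab r = comp rho q. Proof. exact: (lab_comp m hl). Qed.

Let partr : #|porbit (step rho) q| = part r.
Proof. by rewrite -card_comp_half // -labr half. Qed.

Let rest_labels S : labels rho (A :\: union_of lab S) (~: S) lab.
Proof. by rewrite (unionD m sA hl); apply: (union_labels m hl). Qed.

Let rest_typ S : perm_eq (typ (A :\: union_of lab S) rho)
  [seq part i | i : 'I_(size l) <- enum (~: S)].
Proof.
apply: perm_trans (typ_labels (rest_labels S)) _.
by rewrite (eq_map (g := fun i : 'I_(size l) => part i)).
Qed.

Let typA : perm_eq (typ A rho) l.
Proof.
apply: perm_trans (typ_labels hl) _.
rewrite (eq_map (g := fun i : 'I_(size l) => part i)) //.
by rewrite -[X in perm_eq _ X](map_nth_enum l); apply: perm_map; apply: uniq_perm; rewrite ?enum_uniq // => i;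
   rewrite !mem_enum inE.
Qed.

Let union1 i : union_of lab [set i] = lab i.
Proof. by rewrite /union_of big_set1. Qed.

Let compsD : comps (A :\: comp rho q) rho = lab @: (~: [set r]).
Proof. by rewrite -labr -union1; case: (rest_labels [set r]). Qed.

Let m' p : matching (rho ^ tperm p q)%g. Proof. exact: matching_conj. Qed.

Let s' p : p \in A -> stable A (rho ^ tperm p q)%g.
Proof. by move=> pA; apply: stable_conj; rewrite ?pA. Qed.

Lemma trans_sum_join k p j : j != r -> p \in lab j ->
  G k A (rho ^ tperm p q)%g = conn k (subcomp (~: [set j]) r (part r + part j)%N).
Proof.
move=> jr pj; have pA := subsetP (lab_sub sA hl j) _ pj.
have pC : p \notin comp rho q.
  by rewrite -labr; apply: contraNN jr => pr; apply/eqP; apply: (lab_eq m hl pj pr).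
have [_ tp] := join_typ m sA pA qA pC.
apply: (trans_sum_perm _ (m' p) (s' pA) A0 tp).
rewrite -labr -(lab_comp m hl pj) !half perm_sym.
apply: perm_trans (subcomp_perm _ _) _; first by rewrite !inE eq_sym.
rewrite perm_cons perm_sym.
have -> : lab r :|: lab j = union_of lab [set r; j] by rewrite /union_of bigcup_setU !big_set1.
apply: perm_trans (rest_typ _) _; apply: perm_map.
apply: uniq_perm; rewrite ?enum_uniq // => i; rewrite !mem_enum !inE.
by rewrite negb_or.
Qed.

Section Cut.
Variable i : nat.
Hypothesis hi : (0 < i < part r)%N.
Local Notation p := (iter i (step rho) q).
Local Notation rho' := (rho ^ tperm p q)%g.

Let hi' : (0 < i < #|porbit (step rho) q|)%N. Proof. by rewrite partr. Qed.

Let pC : p \in comp rho q.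
Proof. exact: stable_iter (comp_stable _ _) (comp_refl _ _). Qed.

Let pA : p \in A. Proof. exact: stable_iter. Qed.

Let cut := cut_comp m hi' erefl.

Let lab' j := if j == r then comp rho' q else lab j.

Let d : comp rho' q :&: comp rho' p = set0.
Proof.
have [_ c2 _] := cut; apply/setP => x; rewrite [in LHS]inE [in RHS]inE.
apply/negP => /andP[x1 x2]; move: c2.
by rewrite -(comp_eq (m' _) x1) (comp_eq (m' _) x2) comp_refl.
Qed.

Let sA2 : stable (A :\: comp rho' p) rho'.
Proof. by apply: stableD; rewrite ?s' //; apply: comp_stable. Qed.

Let qA2 : q \in A :\: comp rho' p.
Proof. by rewrite in_setD qA andbT mem_comp_sym //; case: cut. Qed.

Let hl' : labels rho' (A :\: comp rho' p) setT lab'.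
Proof. exact: labels_cut. Qed.

Let half' j : #|lab' j|./2 = if j == r then i else part j.
Proof.
rewrite /lab'; case: ifP => // _; have [-> _ _] := cut.
by rewrite mul2n doubleK.
Qed.

Let cardp : #|comp rho' p|./2 = (part r - i)%N.
Proof.
have [c1 c2 c3] := cut; have := card_comp q m; rewrite c3 cardsU d cards0 subn0 c1 partr.
move: (hi); move: #|comp rho' p| (nth 0%N l r) => u v; clear => hi h.
by have -> : u = (2 * (v - i))%N by [lia]; rewrite mul2n doubleK.
Qed.

Lemma trans_sum_cut k : G k A rho' = conn k (split_part l r (part r - i) i).
Proof.
apply: (trans_sum_perm _ (m' _) (s' pA) A0 (cut_typ m sA pA qA hi' erefl)).
rewrite perm_sym; apply: perm_trans (split_part_perm _ _ _) _.
rewrite partr -labr -union1.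
apply: perm_trans (_ : perm_eq [:: (part r - i)%N, i & typ (A :\: union_of lab [set r]) rho] _).
  by rewrite !perm_cons perm_sym rest_typ.
exact: perm_swap2.
Qed.

(** The orbit of q avoids the piece of p, hence is given by a set S of labels containing r. The
    complement consists of the other labels and the piece of p, which takes the name r again; this
    is why the two index sets share exactly r. *)
Lemma trans_sum_cut_split k :
  \sum_(O : {set V} | [&& O \subset A, q \in O, p \notin O & stable O rho'])
     \sum_(a < k.+1) G a O rho' * G (k - a) (A :\: O) rho' =
  \sum_(S : {set 'I_(size l)} | r \in S) \sum_(a < k.+1)
     conn a (subcomp S r i) * conn (k - a) (subcomp (r |: ~: S) r (part r - i)).
Proof.
have qr' : q \in lab' r by rewrite /lab' eqxx comp_refl.
rewrite (eq_bigl (fun O : {set V} => [&& O \subset A :\: comp rho' p, q \in O & stable O rho'])); last first.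
  move=> O; apply/and4P/and3P => -[h1 h2 h3]; last first.
    have h1' := subset_trans h1 (subsetDl _ _); split=> //.
    by apply/negP => /(subsetP h1); rewrite in_setD comp_refl.
  move=> h4; split=> //; apply/subsetP => x xO; rewrite in_setD (subsetP h1 _ xO) andbT.
  apply: contra h3 => xp; apply: (subsetP (comp_min h4 xO)).
  by rewrite (comp_eq (m' _) xp) comp_refl.
rewrite (@sum_stable _ _ _ (m' _) _ _ sA2 hl' _ _ _ _ qr').
apply: eq_bigr => S rS; apply: eq_bigr => a _; congr (_ * _).
  have hu := union_labels (m' _) hl' S.
  apply: trans_sum_perm (m' _) (union_stable (m' _) hl' S) _ (typ_labels hu) _.
    by apply/set0Pn; exists q; rewrite (mem_union (m' _) hl' S qr').
  by rewrite (eq_map (g := fun j => if j == r then i else part j)).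
have pD : p \in A :\: union_of lab' S.
  rewrite in_setD pA andbT; apply/negP => /(subsetP (union_sub sA2 hl' S)).
  by rewrite in_setD comp_refl.
have sD : stable (A :\: union_of lab' S) rho'.
  by apply: stableD; rewrite ?s' //; exact: (union_stable (m' _) hl' S).
have eD : (A :\: union_of lab' S) :\: comp rho' p = union_of lab' (~: S).
  by rewrite setDDl setUC -setDDl (unionD (m' _) sA2 hl').
apply: trans_sum_perm (m' _) sD _ (typ_block (m' _) sD pD) _.
  by apply/set0Pn; exists p.
rewrite eD cardp perm_sym; apply: perm_trans (subcomp_perm _ _) _; first by rewrite !inE eqxx.
rewrite perm_cons perm_sym; apply: perm_trans (typ_labels (union_labels (m' _) hl' _)) _.
have -> : (r |: ~: S) :\ r = ~: S.
  by apply/setP => j; rewrite !inE; case: eqVneq => // ->; rewrite rS.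
set u := map _ _; set v := map _ _; suff -> : u = v by []; apply/eq_in_map => j.
by rewrite mem_enum in_setC half' => jS; rewrite ifN //; apply: contraNneq jS => ->.
Qed.

End Cut.

Lemma trans_sum_twist k i : (0 < i < part r)%N ->
  G k A (rho ^ tperm (tau (iter i (step rho) q)) q)%g = conn k l /\
  tau (iter i (step rho) q) \in comp (rho ^ tperm (tau (iter i (step rho) q)) q)%g q.
Proof.
rewrite -partr => hi.
have pC : tau (iter i (step rho) q) \in comp rho q.
  by apply: stable_tau (comp_stable _ _) _; apply: stable_iter (comp_stable _ _) (comp_refl _ _).
have pA : tau (iter i (step rho) q) \in A by apply: (stable_tau sA); apply: stable_iter.
split; last by rewrite (twist_comp m hi).
exact: trans_sum_perm (m' _) (s' pA) A0 (twist_typ m sA pA qA hi erefl) typA.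
Qed.

Lemma conn_sum_rec_labelled k : conn k.+1 l =
  \sum_(j | j != r) (2 * part j)%:R * C * conn k (subcomp (~: [set j]) r (part r + part j)%N)
  + (part r).-1%:R * T * conn k l
  + \sum_(i < (part r).-1) J * (conn k (split_part l r (part r - i.+1) i.+1) +
      \sum_(S : {set 'I_(size l)} | r \in S) \sum_(a < k.+1)
        conn a (subcomp S r i.+1) * conn (k - a) (subcomp (r |: ~: S) r (part r - i.+1))).
Proof.
rewrite -(trans_sum_perm k.+1 m sA A0 typA (perm_refl _)) (trans_sum_top _ _ _ m sA qA top).
rewrite (sum_steps m sA qA top) partr big_split /=.
rewrite [X in _ + X = _]addrC addrA; congr (_ + _ + _).
- rewrite compsD big_imset /=; last by move=> a b _ _; apply: (lab_inj hl).
  apply: eq_big => [j|j]; first by rewrite !inE.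
  rewrite !inE => jr.
  rewrite (eq_bigr (fun=> C * conn k (subcomp (~: [set j]) r (part r + part j)%N))).
    by rewrite sumr_const -[LHS]mulr_natl mulrA sz.
  move=> p pj; have pC : p \notin comp rho q.
    by rewrite -labr; apply: contraNN jr => pr; apply/eqP; apply: (lab_eq m hl pj pr).
  rewrite (step_weight_join _ _ _ pC) (trans_sum_join _ jr pj) joined_split0 ?addr0 //.
  by rewrite join_comp // in_setU comp_refl.
- rewrite (eq_bigr (fun=> T * conn k l)).
    by rewrite sumr_const card_ord -[LHS]mulr_natl mulrA.
  move=> i _; rewrite -iterS (@step_weight_twist _ _ C J T rho q m i.+1).
  have hi : (0 < i.+1 < part r)%N by have := ltn_ord i; lia.
  have [e1 e2] := trans_sum_twist k hi.
  by rewrite e1 joined_split0 ?addr0.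
apply: eq_bigr => i _; rewrite -iterS (@step_weight_cut _ _ C J T rho q i.+1).
have hi : (0 < i.+1 < part r)%N by have := ltn_ord i; lia.
by rewrite trans_sum_cut // trans_sum_cut_split.
Qed.

End Labelled.

Lemma comps_sub A O rho : (#|comps A rho| <= #|comps O rho| + #|comps (A :\: O) rho|)%N.
Proof.
apply: leq_trans (leq_card_setU _ _); apply: subset_leq_card; apply/subsetP => _ /imsetP[x xA ->].
by rewrite in_setU; case xO: (x \in O); [rewrite imset_f | rewrite [X in _ || X]imset_f ?orbT // inE xO].
Qed.

Let genus_arith (xA xO xD yA yO yD k a : nat) :
  (2 * k.+1 + 4 < xA + 2 * yA)%N -> (xO + xD)%N = xA -> (yA.+1 <= yO + yD)%N ->
  (xO + 2 * yO <= 2 * a + 4)%N -> (a < k.+1)%N -> (2 * (k - a) + 4 < xD + 2 * yD)%N.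
Proof. lia. Qed.

(** Nonnegativity of the genus: a transitive walk to a matching with n pairs and c components has k
    >= n + c - 2 steps (stated doubled). It makes the sum over step numbers start and stop where the
    sum over genera does. *)
Lemma trans_sum_genus k A rho : matching rho -> stable A rho -> A != set0 ->
  (2 * k + 4 < #|A| + 2 * #|comps A rho|)%N -> G k A rho = 0.
Proof.
elim/ltn_ind: k A rho => -[|k] IH A rho m sA A0 hk.
  rewrite /trans_sum sum_words0; case: ifP => // /andP[_ /forall_inP tr].
  have /set0Pn[x xA] := A0.
  have sub : A \subset [set x; tau x].
    apply: subset_trans (tr x xA) _; apply: walk_orbit_min; last by rewrite !inE eqxx.
    apply/andP; split=> //; apply/forall_inP => y; rewrite !inE => /orP[] /eqP ->.
      by rewrite eqxx orbT.
    by rewrite tauK eqxx.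
  have h1 := subset_leq_card sub; rewrite cards2 in h1.
  have h2 : comps A rho \subset [set comp rho x].
    apply/subsetP => _ /imsetP[y yA ->]; have := subsetP sub y yA; rewrite !inE => /orP[] /eqP -> //.
    by rewrite (comp_eq m (stable_tau (comp_stable _ _) (comp_refl _ _))).
  have := subset_leq_card h2; rewrite cards1 => h3.
  by move: h1; case: (x != tau x) => h1; lia.
have [i0 qA top] := max_vertexP sA A0.
rewrite (trans_sum_top _ _ _ m sA qA top) big1 // => p /andP[pA pi]; set q := (i0, false) in qA *.
have m' : matching (rho ^ tperm p q)%g by apply: matching_conj.
have s' : stable A (rho ^ tperm p q)%g by apply: stable_conj; rewrite ?pA.
have pq : p != q by apply: contraTneq pi => ->; rewrite ltnn.
have ptq : p != tau q by apply: contraTneq pi => ->; rewrite tauE ltnn.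
(* Undoing a step loses at most one component, and if it separates p from q it gains one. *)
have szs : ((#|comps A rho| <= (#|comps A (rho ^ tperm p q)|).+1) &&
   ((p \in comp (rho ^ tperm p q) q) || (#|comps A (rho ^ tperm p q)| == (#|comps A rho|).+1)))%N.
  rewrite -!size_typ.
  have [pC|pC] := boolP (p \in comp rho q); last first.
    have [t1 t2] := join_typ m sA pA qA pC.
    by rewrite (perm_size t1) (perm_size t2) /= join_comp // in_setU comp_refl !ltnS leqnn.
  have szb := perm_size (typ_block m sA qA).
  move: pC; rewrite compE // in_setU in_set => /orP[] /mem_porbit_iter[i hi ei].
    have {}hi : (0 < i < #|porbit (step rho) q|)%N.
      by rewrite hi andbT; case: i ei {hi} => // ei; rewrite ei eqxx in pq.
    by rewrite (perm_size (cut_typ m sA pA qA hi ei)) szb /= eqxx orbT andbT; lia.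
  have {}ei : p = tau (iter i (step rho) q) by rewrite -ei tauK.
  have {}hi : (0 < i < #|porbit (step rho) q|)%N.
    by rewrite hi andbT; case: i ei {hi} => // ei; rewrite ei eqxx in ptq.
  rewrite (perm_size (twist_typ m sA pA qA hi ei)) leqnSn /=.
  rewrite (twist_comp m hi ei) {1}ei.
  by rewrite (stable_tau (comp_stable _ _)) // stable_iter ?comp_stable ?comp_refl.
case/andP: szs => sz1 sz2.
rewrite IH // ?add0r; last by lia.
rewrite [X in _ * X]big1 ?mulr0 // => O /and4P[OA qO pO sO].
have {}sz2 : #|comps A (rho ^ tperm p q)%g| = (#|comps A rho|).+1.
  case/orP: sz2 => [/(subsetP (comp_min sO qO))|/eqP //].
  by rewrite (negPf pO).
apply: big1 => a _; have sD := stableD m' s' sO.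
have O0 : O != set0 by apply/set0Pn; exists q.
have D0 : A :\: O != set0 by apply/set0Pn; exists p; rewrite inE pO.
have := comps_sub A O (rho ^ tperm p q)%g; have := cardsID O A.
rewrite (setIidPr OA) sz2 => c1 c2; have ha := ltn_ord a.
(* If O obeys its bound, its complement violates its own: vertices add up, and the cut has raised
   the number of components by one. *)
have [h|h] := leqP (#|O| + 2 * #|comps O (rho ^ tperm p q)%g|) (2 * a + 4); last first.
  by rewrite IH ?mul0r //.
rewrite [G (k - a) _ _]IH ?mulr0 //; first by rewrite ltnS leq_subr.
exact: genus_arith hk c1 c2 h ha.
Qed.

End Recursion.

(** * Total weights *)

Section TotalWeight.
Variable n : nat.
Local Notation V := (barset n).
Local Notation tau := (tau n).
Implicit Types (rho : {perm V}) (u : seq (marked n)) (t : marked n).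
Local Notation W := (walk_weight varC varJ varT).

Lemma step_cases rho p q : matching rho -> p \in comp rho q -> p != q -> p != tau q ->
  exists2 i, (0 < i < #|porbit (step rho) q|)%N &
    p = iter i (step rho) q \/ p = tau (iter i (step rho) q).
Proof.
move=> m pC pq ptq.
move: pC; rewrite compE // in_setU in_set => /orP[] /mem_porbit_iter[i hi ei].
  exists i; last by left.
  by rewrite hi andbT; case: i ei {hi} => // ei; rewrite ei eqxx in pq.
have {}ei : p = tau (iter i (step rho) q) by rewrite -ei tauK.
exists i; last by right.
by rewrite hi andbT; case: i ei {hi} => // ei; rewrite ei eqxx in ptq.
Qed.

(** [weight] is evaluated at the matching before the step and [step_weight] at the one after it, so
    a join seen from [rho] is a gained part in the definition. *)
Lemma weight_step rho t : matching rho -> (t.1.1 < t.2)%N ->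
  weight (rho ^ marked_transp t)%g (marked_transp t) = step_weight varC varJ varT rho t.1 (high t).
Proof.
case: t => p k m pk; set q := high (p, k); rewrite /= in pk *.
rewrite /weight /act_inv marked_transpE conj_tpermK !inv_typeE -!size_typ -/q /=.
have pq : p != q by apply: contraTneq pk => ->; rewrite ltnn.
have ptq : p != tau q by apply: contraTneq pk => ->; rewrite tauE ltnn.
have [pC|pC] := boolP (p \in comp rho q); last first.
  have [t1 t2] := join_typ m (stableT _) (in_setT p) (in_setT q) pC.
  by rewrite (perm_size t1) (perm_size t2) /= eqxx step_weight_join.
have szb := perm_size (typ_block m (stableT _) (in_setT q)).
have [i hi [e|e]] := step_cases m pC pq ptq.
  have -> : step_weight varC varJ varT rho p q = varJ by rewrite e step_weight_cut.
  rewrite (perm_size (cut_typ m (stableT _) (in_setT p) (in_setT q) hi e)) szb /=.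
  by rewrite eqxx eqSS ltn_eqF.
rewrite (perm_size (twist_typ m (stableT _) (in_setT p) (in_setT q) hi e)).
have -> : step_weight varC varJ varT rho p q = varT by rewrite e step_weight_twist.
by rewrite ltn_eqF // eq_sym ltn_eqF.
Qed.

Fixpoint applied u : {perm V} :=
  if u is t :: u' then (applied u' ^ marked_transp t)%g else tau.

Fixpoint walk_prod u : QCJT :=
  if u is t :: u' then weight (applied u') (marked_transp t) * walk_prod u' else 1.

Lemma applied_matching u : matching (applied u).
Proof. by elim: u => [|t u IH] /=; [apply: matching_tau | apply: matching_conj]. Qed.

(** Read backwards from [rho], the word arrives at [tau] for exactly one [rho], the matching it
    produces. *)
Lemma walk_weight_applied u rho : all (fun t => t.1.1 < t.2)%N u -> matching rho ->
  W setT rho u = (rho == applied u)%:R * walk_prod u.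
Proof.
elim: u rho => [|t u IH] rho /=.
  move=> _ _; rewrite mulr1; congr (nat_of_bool _)%:R.
  apply/forall_inP/eqP => [h|-> //]; apply/permP => x.
  by apply/eqP/h; rewrite inE.
case/andP=> ht hu m; rewrite IH ?matching_conj //.
have -> : (rho ^ marked_transp t == applied u)%g = (rho == applied u ^ marked_transp t)%g.
  by apply/eqP/eqP => [<-|->]; rewrite conj_tpermK.
case: eqP => [e|_]; last by rewrite !mul0r mulr0.
have e2 : (rho ^ marked_transp t)%g = applied u by rewrite e conj_tpermK.
by rewrite -(weight_step m ht) e2 mulrCA.
Qed.

Lemma applied_rev (w : seq (marked n)) :
  applied (rev w) = act_inv (\prod_(t <- w) marked_transp t)%g tau.
Proof.
elim/last_ind: w => [|w t IH]; first by rewrite /= big_nil /act_inv conjg1.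
by rewrite rev_rcons /= IH -cats1 big_cat big_seq1 /act_inv conjgM.
Qed.

Lemma walk_prod_rev t0 (w : seq (marked n)) :
  walk_prod (rev w) = \prod_(i < size w) weight (applied (rev (take i w))) (marked_transp (nth t0 w i)).
Proof.
elim/last_ind: w => [|w t IH]; first by rewrite /= big_ord0.
rewrite rev_rcons /= size_rcons big_ord_recr /= IH mulrC; congr (_ * _).
  apply: eq_bigr => i _; rewrite nth_rcons ltn_ord -cats1 takel_cat //.
  exact: ltnW.
by rewrite nth_rcons ltnn eqxx -cats1 take_size_cat.
Qed.

Section Word.
Variable k : nat.
Implicit Type s : {ffun 'I_k -> marked n}.

Definition steps s := [seq s i | i <- enum 'I_k].

Lemma size_steps s : size (steps s) = k.
Proof. by rewrite size_map size_enum_ord. Qed.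

Lemma nth_steps t0 s (i : 'I_k) : nth t0 (steps s) i = s i.
Proof. by rewrite (nth_map i) ?size_enum_ord // nth_ord_enum. Qed.

Lemma mem_steps t s : reflect (exists i, t = s i) (t \in steps s).
Proof.
by apply: (iffP mapP) => [[i _ ->]|[i ->]]; exists i; rewrite ?mem_enum.
Qed.

Lemma partial_invE s (i : nat) : (i <= k)%N -> partial_inv s i = applied (rev (take i (steps s))).
Proof.
move=> ik; rewrite applied_rev /partial_inv; congr act_inv.
rewrite -map_take big_map -[LHS]big_filter [index_enum _]unlock -enumT; congr bigop.
apply: (inj_map val_inj).
transitivity (filter (fun j => (j < i)%N) (iota 0 k)).
  by rewrite -val_enum_ord filter_map.
rewrite map_take val_enum_ord.
rewrite take_iota (minn_idPl ik); apply: (irr_sorted_eq ltn_trans ltnn).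
- by apply: sorted_filter; [exact: ltn_trans | exact: iota_ltn_sorted].
- exact: iota_ltn_sorted.
move=> j; rewrite mem_filter !mem_iota /= !add0n.
by case h: (j < i)%N => //=; apply: leq_trans h ik.
Qed.

Lemma prod_weight s :
  \prod_(i < k) weight (partial_inv s i) (marked_transp (s i)) = walk_prod (rev (steps s)).
Proof.
case: (pickP (mem 'I_k)) => [i0 _|h].
  rewrite (walk_prod_rev (s i0)) size_steps; apply: eq_bigr => i _.
  by rewrite nth_steps partial_invE // ltnW.
rewrite big1 => [|i _]; last by have := h i.
rewrite (_ : steps s = [::]) //; apply/eqP; rewrite -size_eq0 size_steps.
by case: (k) h => // k' /(_ ord0).
Qed.

Lemma orbit_walk_orbit s x :
  orbit 'P <<tau |: [set marked_transp (s i) | i : 'I_k]>>%g x = walk_orbit (rev (steps s)) x.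
Proof.
set H := _ |: _; set w := rev _; apply/eqP; rewrite eqEsubset; apply/andP; split.
  have acts : [acts <<H>>%g, on walk_orbit w x | 'P].
    rewrite gen_subG; apply/subsetP => g gH; rewrite !inE /=.
    apply/subsetP => y yo; rewrite inE /= /aperm.
    have /andP[/forall_inP c1 /allP c2] := walk_orbit_closed w x.
    case/setU1P: gH => [->|/imsetP[i _ ->]]; first exact: c1.
    have : s i \in w by rewrite mem_rev; apply/mem_steps; exists i.
    move/c2/eqP; rewrite marked_transpE => e2.
    by case: tpermP => [ey|ey|//]; [rewrite -e2 -ey | rewrite e2 -ey].
  by rewrite acts_sub_orbit // walk_orbit_refl.
apply: walk_orbit_min; last exact: orbit_refl.
have step_in g y : g \in H -> y \in orbit 'P <<H>>%g x -> g y \in orbit 'P <<H>>%g x.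
  move=> gH yo; apply: orbit_trans yo; apply/orbitP; exists g; rewrite ?mem_gen //.
apply/andP; split.
  by apply/forall_inP => y; apply: step_in; rewrite !inE eqxx.
apply/allP => t; rewrite mem_rev => /mem_steps[i ->].
have gi : marked_transp (s i) \in H by apply/setU1P; right; apply/imsetP; exists i.
apply/eqP; apply/idP/idP => /(step_in _ _ gi).
  by rewrite marked_transpE tpermL.
by rewrite marked_transpE tpermR.
Qed.

(** The vertex [x0] is required because transitivity on a set asks it to be the orbit of one of its
    points, which fails for the empty set. *)
Lemma monotone_transitiveE (x0 : V) s :
  monotone_transitive s =
  valid setT (rev (steps s)) && transitive_on setT (rev (steps s)).
Proof.
rewrite /monotone_transitive /valid -andbA; congr [&& _, _ & _].
- apply/forallP/allP => [h t|h i].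
    rewrite mem_rev => /mem_steps[i ->]; rewrite /admissible !in_setT.
    by have := h i; rewrite /bar_lt /= !andbF orbF.
  have /h /and3P[_ _] : s i \in rev (steps s) by rewrite mem_rev; apply/mem_steps; exists i.
  by rewrite /bar_lt => ->.
- rewrite /desc rev_sorted; apply/forallP/idP => [h|h i].
    case: (pickP (mem 'I_k)) => [i0 _|e]; last first.
      rewrite (_ : steps s = [::]) //; apply/eqP; rewrite -size_eq0 size_steps.
      by case: (k) e => // k' /(_ ord0).
    apply/(sortedP (s i0)) => j; rewrite size_steps => jk.
    have jk' := ltnW jk.
    rewrite (nth_steps (s i0) s (Ordinal jk)) (nth_steps (s i0) s (Ordinal jk')).
    by have /forallP/(_ (Ordinal jk)) := h (Ordinal jk'); rewrite /= leqnSn.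
  apply/forallP => j; apply/implyP => ij.
  have tr : transitive (fun a b : marked n => (a.2 <= b.2)%N) by move=> a b c; apply: leq_trans.
  have := sorted_leq_nth tr (fun a => leqnn _) (s i) h i j.
  by rewrite !inE size_steps !ltn_ord !nth_steps; apply.
apply/idP/forall_inP => [/atransP h x _|h]; first by rewrite -orbit_walk_orbit h ?inE.
apply/imsetP; exists x0; first exact: in_setT.
by apply/esym/eqP; rewrite eqEsubset subsetT /= orbit_walk_orbit h ?inE.
Qed.

Lemma sum_ffun_words (F : seq (marked n) -> QCJT) :
  \sum_(s : {ffun 'I_k -> marked n}) F (rev (steps s)) = \sum_(u <- words (marked n) k) F u.
Proof.
rewrite -(big_map (fun s => rev (steps s)) xpredT F); apply: perm_big; apply: uniq_perm.
- rewrite map_inj_uniq ?index_enum_uniq // => s s' /(congr1 rev); rewrite !revK => e.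
  by apply/ffunP => i; rewrite -(nth_steps (s i) s) e nth_steps.
- exact: words_uniq.
move=> u; rewrite mem_words; apply/mapP/idP => [[s _ ->]|e].
  by rewrite size_rev size_steps.
exists (finfun (tnth (rev_tuple (Tuple e)))); first exact: mem_index_enum.
apply: (can_inj revK); rewrite revK.
rewrite /steps (eq_map (g := tnth (rev_tuple (Tuple e)))); last by move=> i; rewrite ffunE.
exact/esym/map_tnth_enum.
Qed.

End Word.
End TotalWeight.

Definition labelled_matchings (n : nat) (I : finType) (sz : I -> nat) :=
  [set x : {perm barset n} * {ffun I -> {set barset n}} |
    [&& matching x.1, injectiveb x.2, x.2 @: setT == comps setT x.1 &
        [forall i, #|x.2 i| == (2 * sz i)%N]]].

Lemma labelled_perm l n x : x \in labelled_matchings n (fun i : 'I_(size l) => nth 0%N l i) ->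
  perm_eq (typ setT x.1) l.
Proof.
rewrite inE => /and4P[m /injectiveP inj /eqP im /forallP sz].
have h : labels x.1 setT setT x.2 by split=> // i j _ _; apply: inj.
apply: perm_trans (typ_labels h) _.
rewrite (eq_map (g := fun i : 'I_(size l) => nth 0%N l i)); last first.
  by move=> i; rewrite (eqP (sz i)) mul2n doubleK.
rewrite -[X in perm_eq _ X](map_nth_enum l); apply: perm_map; apply: uniq_perm;
  rewrite ?enum_uniq // => i; by rewrite !mem_enum inE.
Qed.

(** Grouping the pairs by end matching and labelling gives one transitive sum per labelled matching,
    and all these sums agree because the types do. *)
Lemma total_weightE l k : (0 < sumn l)%N ->
  total_weight l k =
  #|labelled_matchings (sumn l) (fun i : 'I_(size l) => nth 0%N l i)|%:R * conn_sum varC varJ varT k l.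
Proof.
move=> l0; set n := sumn l; set L := labelled_matchings _ _.
have T0 : [set: barset n] != set0.
  by apply/set0Pn; exists (Ordinal l0, false); rewrite inE.
rewrite mulr_natl -sumr_const.
transitivity (\sum_(x in L) trans_sum varC varJ varT k setT x.1); last first.
  apply: eq_bigr => x xL; apply: trans_sum_conn; rewrite ?stableT //.
    by move: xL; rewrite inE => /and4P[].
  by rewrite perm_sym labelled_perm.
rewrite /trans_sum exchange_big /= [RHS]big_mkcond /= -sum_ffun_words /total_weight.
rewrite -(pair_big_dep (fun s : {ffun 'I_k -> marked n} => monotone_transitive s)
   (fun s lab => is_labelling (partial_inv s k) lab) (fun s lab =>
     \prod_(i < k) weight (partial_inv s i) (marked_transp (s i)))) /=.
rewrite big_mkcond; apply: eq_bigr => s _.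
rewrite (monotone_transitiveE (Ordinal l0, false)); set u := rev (steps s).
have hs : partial_inv s k = applied u by rewrite partial_invE // -{1}(size_steps s) take_size.
have [/andP[v tr]|//] := boolP (valid setT u && transitive_on setT u).
rewrite prod_weight -/u hs.
have hu : all (fun t : marked n => t.1.1 < t.2)%N u.
  by case/andP: v => h _; apply: sub_all h => t /and3P[].
rewrite (eq_bigr (fun x => (x.1 == applied u)%:R * walk_prod u)); last first.
  by move=> x; rewrite inE => /and4P[m _ _ _]; rewrite walk_weight_applied.
rewrite [RHS](bigID (fun x => x.1 == applied u)) /= [X in _ + X]big1 ?addr0; last first.
  by move=> x /andP[_ /negPf ->]; rewrite mul0r.
rewrite (reindex_onto (fun lab => (applied u, lab)) snd) /=; last by case=> a b /= /andP[_ /eqP ->].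
apply: eq_big => [lab|lab _]; last by rewrite eqxx mul1r.
rewrite !eqxx !andbT inE /= applied_matching /=.
congr [&& _, _ & _].
by congr (_ == _); [apply/setP => B; apply/imsetP/imsetP => -[i _ ->]; exists i |
  apply/setP => B; apply/imsetP/imsetP => -[i _ ->]; exists i].
Qed.

(** * Counting labelled matchings *)

Lemma big_option_split (R : Type) (idx : R) (op : Monoid.com_law idx) (I : finType) (F : option I -> R) :
  \big[op/idx]_o F o = op (F None) (\big[op/idx]_i F (Some i)).
Proof.
rewrite (bigD1 None) //=; congr (op _ _).
rewrite (reindex_omap Some id) /=; last by case.
by apply: eq_bigl => i; rewrite eqxx.
Qed.

Lemma card_dep_pairs (S T : finType) (P : {set S}) (Q : S -> {set T}) k :
  (forall x, x \in P -> #|Q x| = k) ->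
  #|[set z : S * T | (z.1 \in P) && (z.2 \in Q z.1)]| = (#|P| * k)%N.
Proof.
move=> h; rewrite -sum1_card (eq_bigl (fun z : S * T => (z.1 \in P) && (z.2 \in Q z.1))); last first.
  by move=> z; rewrite inE.
rewrite -(pair_big_dep (fun x => x \in P) (fun x y => y \in Q x) (fun _ _ => 1%N)) /=.
rewrite (eq_bigr (fun=> k)) => [|x xP]; last by rewrite sum1_card h.
by rewrite sum_nat_const.
Qed.

Section Labelled.
Variable n : nat.
Local Notation V := (barset n).
Local Notation tau := (tau n).
Implicit Types (rho : {perm V}).

Lemma labelledP (I : finType) (sz : I -> nat) (x : {perm V} * {ffun I -> {set V}}) :
  reflect [/\ matching x.1, labels x.1 setT setT x.2 & forall i, #|x.2 i| = (2 * sz i)%N]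
          (x \in labelled_matchings n sz).
Proof.
rewrite inE; apply: (iffP and4P) => [[m /injectiveP inj /eqP im /forallP h]|[m [inj im] h]].
  split=> //; first by split=> // i j _ _; apply: inj.
  by move=> i; apply/eqP.
split=> //; [|by apply/eqP | by apply/forallP => i; rewrite h].
by apply/injectiveP => i j; apply: inj; rewrite inE.
Qed.

Lemma comp_tau x : comp tau x = [set x; tau x].
Proof. exact: comp_porbit1 (matching_tau n) erefl. Qed.

Lemma card_comps_tau : #|comps setT tau| = n.
Proof.
have -> : comps setT tau = [set [set ((i, false) : V); tau (i, false)] | i : 'I_n].
  apply/setP => B; apply/imsetP/imsetP => [[[i b] _ ->]|[i _ ->]]; last first.
    by exists (i, false); rewrite ?inE ?comp_tau.
  exists i => //; rewrite comp_tau !tauE; case: b => //=.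
  by rewrite setUC.
rewrite card_imset ?card_ord // => i j /setP/(_ (i, false)).
by rewrite !inE eqxx /= tauE !xpair_eqE andbT andbF orbF => /esym/eqP.
Qed.

(** Two-vertex components force the matching to be [tau], and a labelling is then any bijection onto
    its n components. *)
Lemma card_labelled1 (I : finType) (sz : I -> nat) :
  (forall i, sz i = 1%N) -> #|I| = n -> #|labelled_matchings n sz| = n`!.
Proof.
move=> sz1 cI; transitivity (#|comps setT tau| ^_ #|I|)%N; last by rewrite card_comps_tau cI ffactnn.
rewrite -card_inj_ffuns_on.
rewrite -[RHS](@card_imset _ _ (fun lab => (tau, lab))); last by move=> f g [].
apply: eq_card => -[rho lab]; apply/labelledP/imsetP => /= [[m hl hs]|[f]].
  have e : rho = tau.
    apply/permP => x; apply/eqP; rewrite -porbit_step1 // -card_comp_half //.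
    have [i xi] := lab_ex hl (in_setT x).
    by rewrite -(lab_comp m hl xi) hs sz1.
  exists lab; last by rewrite e.
  rewrite inE; apply/andP; split; last by apply/injectiveP; apply: lab_inj hl.
  by apply/ffun_onP => i; rewrite -e; case: hl => _ <-; apply: imset_f.
rewrite inE => /andP[/ffun_onP fon /injectiveP finj] [-> ->].
split; first exact: matching_tau.
  split; first by move=> i j _ _; apply: finj.
  apply/eqP; rewrite eqEcard; apply/andP; split.
    by apply/subsetP => _ /imsetP[i _ ->].
  by rewrite card_imset // cardsT cI card_comps_tau.
move=> i; rewrite sz1; have /imsetP[x _ ->] := fon i.
by rewrite comp_tau cards2 eq_sym tau_neq.
Qed.

Section Split.
Variables (I : finType) (sz : I -> nat) (i : I).
Hypothesis szi : (1 < sz i)%N.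

(** [Some i] names the two-vertex component that is cut off and [None] the remainder of the old
    component i. *)
Definition split_size (o : option I) : nat :=
  if o is Some j then if j == i then 1%N else sz j else (sz i).-1.

Local Notation L := (labelled_matchings n sz).
Local Notation L' := (labelled_matchings n split_size).
Local Notation frame J := ({perm V} * {ffun J -> {set V}})%type.

(* Conjugating by (p q) with p = rho (tau q) turns {q, tau q} into a component. *)
Definition cut_off (z : frame I * V) : frame (option I) * (V * V) :=
  let p := step z.1.1 z.2 in
  let rho := (z.1.1 ^ tperm p z.2)%g in
  ((rho, [ffun o => if o is Some j then
             if j == i then comp rho z.2 else z.1.2 j else comp rho p]), (z.2, p)).

Definition glue (z : frame (option I) * (V * V)) : frame I * V :=
  (((z.1.1 ^ tperm z.2.2 z.2.1)%g,
    [ffun j => if j == i then z.1.2 None :|: z.1.2 (Some i) else z.1.2 (Some j)]), z.2.1).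

Definition pointed : {set frame I * V} :=
  [set z | (z.1 \in L) && (z.2 \in z.1.2 i)].

Definition bipointed : {set frame (option I) * (V * V)} :=
  [set z | (z.1 \in L') && (z.2 \in setX (z.1.2 (Some i)) (z.1.2 None))].

Lemma cut_offP z : z \in pointed -> cut_off z \in bipointed /\ glue (cut_off z) = z.
Proof.
case: z => -[rho lab] q; rewrite inE /= => /andP[/labelledP[m hl hs] qi]; rewrite /= in m hl hs qi *.
set p := step rho q; set rho' := (rho ^ tperm p q)%g.
have ei := lab_comp m hl qi.
have cM : #|porbit (step rho) q| = sz i.
  by rewrite -card_comp_half // -ei hs mul2n doubleK.
(* The point p is at position 1 from q, so the piece that contains q has two vertices. *)
have hi : (0 < 1 < #|porbit (step rho) q|)%N by rewrite cM.
have m' : matching rho' by apply: matching_conj.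
have [c1 c2 c3] := cut_comp m hi (erefl p); rewrite -/rho' in c1 c2 c3.
have [inj im] := labels_cut (i := 1) m (stableT _) hl qi hi.
rewrite -/p -/rho' in inj im.
have [b1 b2] := comps_block m' (stableT _) (in_setT p).
rewrite -im in b1 b2.
have d : comp rho' q :&: comp rho' p = set0.
  apply/setP => x; rewrite [in LHS]inE [in RHS]inE.
  apply/negP => /andP[x1 x2]; move: c2.
  by rewrite -(comp_eq m' x1) (comp_eq m' x2) comp_refl.
have cp : #|comp rho' p| = (2 * (sz i).-1)%N.
  have := hs i; rewrite ei c3 cardsU d cards0 subn0 c1.
  by move: #|_| (sz i) szi => u v; clear; lia.
split; last first.
  rewrite /glue /= conj_tpermK; congr (_, _, _); apply/ffunP => j.
  by rewrite !ffunE eqxx; case: eqVneq => [->|//]; rewrite ei c3 setUC.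
rewrite in_set; apply/andP; split; last by rewrite /= in_setX !ffunE eqxx !comp_refl.
apply/labelledP; split=> //=.
  split.
    have nS j : comp rho' p != (if j == i then comp rho' q else lab j).
      by apply: contraNneq b2 => ->; apply/imsetP; exists j.
    move=> [a|] [b|] _ _ //; rewrite !ffunE.
    - by move/inj => -> //; rewrite inE.
    - by move=> e; have := nS a; rewrite -e eqxx.
    - by move=> e; have := nS b; rewrite -e eqxx.
  rewrite b1; apply/setP => B; apply/imsetP/setU1P => [[[j|] _ ->]|[->|/imsetP[j _ ->]]].
  - by right; rewrite ffunE; apply/imsetP; exists j.
  - by left; rewrite ffunE.
  - by exists None; rewrite ?ffunE.
  - by exists (Some j); rewrite ?ffunE.
move=> [j|]; rewrite ffunE //=; case: eqP => // _.
Qed.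

Lemma glueP z : z \in bipointed -> glue z \in pointed /\ cut_off (glue z) = z.
Proof.
case: z => -[rho lab] [q p]; rewrite inE /= in_setX /= => /andP[/labelledP[m hl hs] /andP[qi pi]].
rewrite /= in m hl hs qi pi *.
set rho' := (rho ^ tperm p q)%g.
have eq_ := lab_comp m hl qi; have ep := lab_comp m hl pi.
have m' : matching rho' by apply: matching_conj.
have pq : p \notin comp rho q.
  by rewrite -eq_; apply/negP => h; have := lab_eq m hl pi h.
have j1 := join_comp m pq; rewrite -/rho' in j1.
have hq : rho q = tau q.
  apply/eqP; rewrite -porbit_step1 // -card_comp_half // -eq_ hs /= eqxx //.
(* The glued matching remembers p as the point one double step after q, which makes [glue] and
   [cut_off] inverse to each other. *)
have e1 : step rho' q = p.
  have h : tau q \in comp rho q by apply: stable_tau (comp_stable _ _) (comp_refl _ _).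
  rewrite stepE conj_tpermE (@tpermD _ _ _ (tau q)).
  - by rewrite -hq matchingK // tpermR.
  - by apply: contraNneq pq => ->.
  - by rewrite eq_sym tau_neq.
split; last first.
  rewrite /cut_off /glue /= -/rho' e1 conj_tpermK; congr (_, _, _); apply/ffunP => -[j|].
    by rewrite !ffunE; case: eqVneq => // ->.
  by rewrite ffunE.
have sU : stable (comp rho p :|: comp rho q) rho by apply: stableU; apply: comp_stable.
have sD : stable (setT :\: (comp rho p :|: comp rho q)) rho by apply: stableD => //; apply: stableT.
have aD : {in setT :\: (comp rho p :|: comp rho q), rho =1 rho'}.
  by apply: conj_agree => //; rewrite in_setD in_setU comp_refl ?orbT.
have [b1 b2] := comps_block m' (stableT _) (in_setT q).
rewrite j1 -(agree_comps sD aD) in b1 b2.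
have cD : comps (setT :\: (comp rho p :|: comp rho q)) rho = lab @: (~: [set None; Some i]).
  have -> : comp rho p :|: comp rho q = union_of lab [set None; Some i].
    by rewrite /union_of bigcup_setU !big_set1 ep eq_.
  rewrite (unionD m (stableT _) hl).
  by case: (union_labels m hl (~: [set None; Some i])).
rewrite cD -ep -eq_ in b1 b2.
rewrite in_set; apply/andP; split; last by rewrite /= ffunE eqxx in_setU qi orbT.
apply/labelledP; split=> //=.
  have nS j : j != i -> lab (Some j) != lab None :|: lab (Some i).
    move=> ji; apply: contraNneq b2 => <-; apply: imset_f; rewrite !inE /=.
    by apply: contra ji => /eqP [->].
  split.
    move=> a b _ _; rewrite !ffunE; case: (eqVneq a i) => [->|ai]; case: (eqVneq b i) => [->|bi] //.
    - by move=> e; have := nS b bi; rewrite -e eqxx.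
    - by move=> e; have := nS a ai; rewrite -e eqxx.
    by move/(lab_inj hl) => [].
  rewrite b1; apply/setP => B; apply/imsetP/setU1P => [[j _ ->]|[->|/imsetP[[j|]]]].
  - rewrite ffunE; case: eqVneq => [_|ji]; [by left | right].
    by apply: imset_f; rewrite !inE /=; apply: contra ji => /eqP [->].
  - by exists i; rewrite ?ffunE ?eqxx.
  - rewrite !inE /= => ji ->; exists j => //; rewrite ffunE ifN //.
  - by rewrite !inE.
move=> j; rewrite ffunE; case: eqVneq => [->|ji]; last by rewrite hs /= (negPf ji).
have d : lab None :&: lab (Some i) = set0.
  by apply/setP => x; rewrite !inE; apply/negP => /andP[h1 h2]; have := lab_eq m hl h1 h2.
rewrite cardsU d cards0 subn0 !hs /= eqxx.
by move: (sz i) szi => v; clear; lia.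
Qed.

(** On the left, q is any vertex of the i-th component. On the right, q is one of the 2 vertices of
    the small component and p one of the 2(m_i - 1) vertices of the remainder. *)
Lemma card_split : (#|L| * (2 * sz i) = #|L'| * (2 * (2 * (sz i).-1)))%N.
Proof.
have <- : #|pointed| = (#|L| * (2 * sz i))%N.
  by rewrite /pointed (card_dep_pairs (Q := fun x : frame I => x.2 i) (k := (2 * sz i)%N)) // => x /labelledP[].
have <- : #|bipointed| = (#|L'| * (2 * (2 * (sz i).-1)))%N.
  rewrite /bipointed (card_dep_pairs (Q := fun x : frame (option I) => setX (x.2 (Some i)) (x.2 None))
    (k := (2 * (2 * (sz i).-1))%N)) // => x /labelledP[_ _ hs].
  by rewrite cardsX !hs /= eqxx muln1.
rewrite -(card_in_imset (f := cut_off) (D := pointed)); last first.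
  by move=> z w /cut_offP[_ e1] /cut_offP[_ e2] e; rewrite -e1 -e2 e.
congr #|pred_of_set _|; apply/setP => z; apply/imsetP/idP => [[w /cut_offP[h _] -> //]|h].
by have [h1 h2] := glueP h; exists (glue z).
Qed.

End Split.

(** By [card_split] the number of labelled matchings times the product of the component sizes does
    not change when a two-vertex component is cut off. The sum of the m_i - 1 drops by one each
    time, until all parts are 1. *)
Lemma card_labelled (I : finType) (sz : I -> nat) : (forall i, 0 < sz i)%N ->
  (\sum_i sz i = n)%N ->
  (#|labelled_matchings n sz| * \prod_i (2 * sz i) = n`! * 2 ^ n)%N.
Proof.
have [N leN] := ubnP (\sum_i (sz i).-1)%N; elim: N I sz leN => // N IH I sz leN sz0 szn.
case: (pickP (fun i => 1 < sz i)%N) => [i hi|h]; last first.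
  have sz1 i : sz i = 1%N by apply/eqP; rewrite eqn_leq sz0 leqNgt h.
  have cI : #|I| = n by rewrite -szn (eq_bigr (fun=> 1%N)) ?sum1_card.
  rewrite card_labelled1 // (eq_bigr (fun=> 2%N)) => [|i _]; last by rewrite sz1.
  by rewrite prod_nat_const cI.
rewrite (bigD1 i) //= mulnA card_split //.
have eD (f : nat -> nat) : (\sum_j f (if j == i then 1%N else sz j) =
    f 1%N + \sum_(j | j != i) f (sz j))%N.
  rewrite (bigD1 i) //= eqxx; congr (_ + _)%N; apply: eq_bigr => j ji.
  by rewrite ifN.
have <- : (#|labelled_matchings n (split_size sz i)| * \prod_o (2 * split_size sz i o))%N =
    (n`! * 2 ^ n)%N.
  have := leN; have := szn; rewrite (bigD1 i) //= [in X in _ -> X -> _](bigD1 i) //= => h1 h2.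
  apply: IH.
  - rewrite big_option_split /= (eD predn); move: h2 hi.
    by move: (sz i) (\sum_(_ | _) _)%N => u v; clear; lia.
  - by move=> [j|] /=; [case: eqP | move: hi; case: (sz i) => [|[]]].
  rewrite big_option_split /= (eD id) -h1; move: hi.
  by move: (sz i) (\sum_(_ | _) _)%N => u v; clear; lia.
rewrite big_option_split /= [X in _ = (_ * (_ * X))%N](bigD1 i) //= eqxx muln1.
rewrite [X in _ = (_ * (_ * (_ * X)))%N](eq_bigr (fun j => 2 * sz j)%N); last first.
  by move=> j ji; rewrite ifN.
by rewrite -!mulnA; congr (_ * (_ * _))%N; rewrite mulnCA.
Qed.

End Labelled.

(** * The recursion for N *)

Lemma varX_neq0 (i : 'I_3) : FracField.tofrac ('X_i : {mpoly rat[3]}) != 0 :> QCJT.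
Proof. by rewrite tofrac_eq0 -msupp_eq0 msuppX. Qed.

Lemma varC_neq0 : varC != 0.
Proof. exact: varX_neq0. Qed.

Lemma varJ_neq0 : varJ != 0.
Proof. exact: varX_neq0. Qed.

Lemma natQ_neq0 k : (0 < k)%N -> k%:R != 0 :> QCJT.
Proof.
case: k => // k _; rewrite -(rmorph_nat (@FracField.tofrac {mpoly rat[3]})) tofrac_eq0 -mpolyC_nat mpolyC_eq0.
by rewrite pnatr_eq0.
Qed.

Lemma mulf_div_cancel (F : fieldType) (x y z : F) : x != 0 -> x * y / (x * z) = y / z.
Proof. by move=> x0; rewrite -mulf_div divff // mul1r. Qed.

Section Reindexing.
Variable (V : nmodType).

(** Turns a sum over step numbers into one over doubled genera, once the terms of negative genus at
    both ends are known to vanish. *)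
Lemma sum_shift (F : nat -> V) u h v :
  (forall a, (a < u)%N -> F a = 0) -> (forall a, (u + h < a <= u + h + v)%N -> F a = 0) ->
  \sum_(a < (u + h + v).+1) F a = \sum_(g < h.+1) F (u + g)%N.
Proof.
move=> F1 F2; rewrite -(big_mkord xpredT F) (_ : (u + h + v).+1 = (u + (h.+1 + v))%N); last by lia.
rewrite big_mkord big_split_ord /= big1 ?add0r; last by move=> i _; apply: F1.
rewrite big_split_ord /= [X in _ + X]big1 ?addr0 // => i _.
by apply: F2; have := ltn_ord i; lia.
Qed.

Lemma sum_compositions2 (M : nat) (X : nat -> nat -> V) :
  \sum_(ab : 'I_M.+1 * 'I_M.+1 | [&& (0 < ab.1)%N, (0 < ab.2)%N & (ab.1 + ab.2 == M)%N])
     X ab.1 ab.2 = \sum_(i < M.-1) X (M - i.+1)%N i.+1.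
Proof.
rewrite -(pair_big_dep xpredT (fun a b : 'I_M.+1 => [&& (0 < a)%N, (0 < b)%N & (a + b == M)%N])
   (fun a b : 'I_M.+1 => X a b)) /= (exchange_big_dep xpredT) //=.
rewrite (eq_bigr (fun b : 'I_M.+1 => if (0 < b < M)%N then X (M - b)%N b else 0)); last first.
  move=> b _; have hb := ltn_ord b; case: ifP => h; last first.
    by rewrite big_pred0 // => a; apply/negP => /and3P[h1 h2 /eqP h3]; lia.
  rewrite (big_pred1 (inord (M - b))) => [|a] /=; first by rewrite inordK //; lia.
  rewrite -val_eqE /= inordK; last by lia.
  by apply/and3P/eqP => [[_ _ /eqP]|]; [lia | move=> ->; split; lia].
case: M X => [|M] X; first by rewrite big_ord_recl /= !big_ord0 addr0.
rewrite -(big_mkord xpredT (fun b => if (0 < b < M.+1)%N then X (M.+1 - b)%N b else 0)).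
rewrite big_nat_recl // big_nat_recr //= ltnn add0r addr0 big_mkord.
by apply: eq_bigr => i _; rewrite ltnS ltn_ord.
Qed.

Lemma sum_pairs_eq (h : nat) (X : nat -> nat -> V) :
  \sum_(g : 'I_h.+1 * 'I_h.+1 | (g.1 + g.2 == h)%N) X g.1 g.2 =
  \sum_(g < h.+1) X g (h - g)%N.
Proof.
rewrite -(pair_big_dep xpredT (fun a b : 'I_h.+1 => (a + b == h)%N) (fun a b : 'I_h.+1 => X a b)) /=.
apply: eq_bigr => a _; have ha := ltn_ord a.
rewrite (big_pred1 (inord (h - a))) => [|b] /=; first by rewrite inordK //; lia.
rewrite -val_eqE /= inordK; last by lia.
by apply/eqP/eqP; lia.
Qed.

(** The second set is forced to be r together with the complement of the first. *)
Lemma sum_coverings (I : finType) (r : I) (X : {set I} -> {set I} -> V) :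
  \sum_(S : {set I} * {set I} | (S.1 :|: S.2 == setT) && (S.1 :&: S.2 == [set r])) X S.1 S.2 =
  \sum_(S : {set I} | r \in S) X S (r |: ~: S).
Proof.
rewrite (reindex_onto (fun S => (S, r |: ~: S)) fst) /=.
  apply: eq_bigl => S; rewrite eqxx andbT; apply/andP/idP => [[_ /eqP/setP/(_ r)]|rS].
    by rewrite !inE eqxx /= andbT.
  split; apply/eqP/setP => i; rewrite !inE; case: (eqVneq i r) => [->|]; rewrite ?rS ?orbT //=.
    by rewrite orbN.
  by rewrite andbN.
move=> [S S'] /= /andP[/eqP/setP h1 /eqP/setP h2]; congr (_, _); apply/setP => i.
have := h1 i; have := h2 i; rewrite !inE.
by case: (i \in S); case: (i \in S'); case: (i == r).
Qed.

End Reindexing.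

Section Parts.
Variables (R : Type) (idx : R) (op : Monoid.com_law idx) (f : nat -> R).
Variables (l : seq nat) (r : 'I_(size l)).

(** These identities hold in any commutative monoid because each is applied several ways: to sums of
    parts, to numbers of parts (the constant 1) and to products of [part_factor]. *)
Lemma big_parts : \big[op/idx]_(a <- l) f a =
  op (f (nth 0%N l r)) (\big[op/idx]_(i in ~: [set r]) f (nth 0%N l i)).
Proof. by rewrite (perm_big _ (perm_nth_setC1 r)) big_cons big_map big_enum. Qed.

Lemma big_subcomp (S : {set 'I_(size l)}) b : r \in S ->
  \big[op/idx]_(a <- subcomp S r b) f a =
  op (f b) (\big[op/idx]_(i in S :\ r) f (nth 0%N l i)).
Proof. by move=> rS; rewrite (perm_big _ (subcomp_perm b rS)) big_cons big_map big_enum. Qed.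

Lemma big_split_part b c :
  \big[op/idx]_(a <- split_part l r b c) f a =
  op (f b) (op (f c) (\big[op/idx]_(i in ~: [set r]) f (nth 0%N l i))).
Proof. by rewrite (perm_big _ (split_part_perm r b c)) !big_cons big_map big_enum. Qed.

Lemma big_subcomp2 (S : {set 'I_(size l)}) b c : r \in S ->
  op (\big[op/idx]_(a <- subcomp S r b) f a) (\big[op/idx]_(a <- subcomp (r |: ~: S) r c) f a) =
  op (f b) (op (f c) (\big[op/idx]_(i in ~: [set r]) f (nth 0%N l i))).
Proof.
move=> rS; rewrite !big_subcomp //; last by rewrite !inE eqxx.
have -> : (r |: ~: S) :\ r = ~: S.
  by apply/setP => j; rewrite !inE; case: eqVneq => // ->; rewrite rS.
rewrite Monoid.mulmACA -Monoid.mulmA; congr (op _ (op _ _)).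
rewrite [RHS](bigID (fun i => i \in S)) /=; congr (op _ _); apply: eq_bigl => i; rewrite !inE //.
by case: eqVneq => // ->; rewrite rS.
Qed.

Lemma big_subcomp_join (j : 'I_(size l)) b : j != r ->
  op (f (nth 0%N l j)) (\big[op/idx]_(a <- subcomp (~: [set j]) r b) f a) =
  op (f b) (\big[op/idx]_(i in ~: [set r]) f (nth 0%N l i)).
Proof.
move=> jr; rewrite big_subcomp; last by rewrite !inE eq_sym.
rewrite Monoid.mulmCA; congr (op _ _).
rewrite [RHS](bigD1 j) /=; last by rewrite !inE.
by congr (op _ _); apply: eq_bigl => i; rewrite !inE.
Qed.

End Parts.

Lemma size_sum (l : seq nat) : size l = (\sum_(a <- l) 1)%N.
Proof. by rewrite sum1_size. Qed.

(** The normalisation n! C^q J^n 2^n divided by the number n! 2^n / prod_j (2 m_j) of labelled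
    matchings is the product of these factors. *)
Definition part_factor (a : nat) : QCJT := (2 * a)%:R * varC * varJ ^+ a.

Definition parts_factor (l : seq nat) : QCJT := \prod_(a <- l) part_factor a.

Lemma part_factor_neq0 a : (0 < a)%N -> part_factor a != 0.
Proof.
move=> a0; apply: mulf_neq0; last by rewrite expf_neq0 ?varJ_neq0.
by apply: mulf_neq0; [apply: natQ_neq0; rewrite muln_gt0 | apply: varC_neq0].
Qed.

Lemma parts_factor_neq0 l : composition l -> parts_factor l != 0.
Proof.
rewrite /parts_factor; elim: l => [|a l IH] /=; first by rewrite big_nil oner_neq0.
by case/andP=> a0 hl; rewrite big_cons mulf_neq0 ?part_factor_neq0 ?IH.
Qed.

Lemma parts_factorE l : parts_factor l =
  (\prod_(i < size l) (2 * nth 0%N l i))%N%:R * varC ^+ size l * varJ ^+ sumn l.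
Proof.
rewrite -(big_mkord xpredT (fun i => 2 * nth 0%N l i)%N).
rewrite -(big_nth 0%N xpredT (fun a => 2 * a)%N) /parts_factor.
elim: l => [|a l IH]; first by rewrite !big_nil !expr0 !mulr1.
by rewrite !big_cons IH /part_factor /= natrM exprS exprD; ring.
Qed.

Lemma composition_nth l (i : 'I_(size l)) : composition l -> (0 < nth 0%N l i)%N.
Proof. by move=> /(all_nthP 0%N) h; apply: h. Qed.

Lemma composition_sumn l : composition l -> (0 < size l)%N -> (0 < sumn l)%N.
Proof. by case: l => //= a l /andP[a0 _] _; rewrite addn_gt0 a0. Qed.

Lemma sum_nth (l : seq nat) : (\sum_(i < size l) nth 0 l i)%N = sumn l.
Proof. by rewrite sumnE (big_nth 0%N) big_mkord. Qed.

Local Notation conn := (conn_sum varC varJ varT).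

Lemma card_parts l : composition l ->
  (#|labelled_matchings (sumn l) (fun i : 'I_(size l) => nth 0%N l i)| *
     \prod_(i < size l) (2 * nth 0 l i) = (sumn l)`! * 2 ^ sumn l)%N.
Proof. by move=> hl; apply: card_labelled; [move=> i; apply: composition_nth | apply: sum_nth]. Qed.

Lemma labelled_ex l : composition l ->
  exists x, x \in labelled_matchings (sumn l) (fun i : 'I_(size l) => nth 0%N l i).
Proof.
move=> hl; apply/card_gt0P; rewrite lt0n; apply/eqP => h.
have := card_parts hl; rewrite h mul0n => /esym/eqP.
by rewrite muln_eq0 expn_eq0 /= orbF -[_ == _]negbK -lt0n fact_gt0.
Qed.

Lemma N_conn (h k : nat) l : composition l -> (0 < size l)%N ->
  (h + sumn l + size l = k + 2)%N -> N h%:Z l = conn k l / parts_factor l.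
Proof.
move=> hl l0 hk; have n0 := composition_sumn hl l0.
have e : num_transp h%:Z l = k%:Z by rewrite /num_transp; lia.
rewrite /N e /= total_weightE // parts_factorE.
have := congr1 (fun x => x%:R : QCJT) (card_parts hl); rewrite !natrM natrX.
set K := (#|_|%:R); set P := ((\prod_(_ < _) _)%N%:R); move=> eK.
have P0 : P != 0.
  rewrite natQ_neq0 //; apply: prodn_gt0 => i; rewrite muln_gt0; exact: composition_nth.
have K0 : K != 0.
  apply: contraTneq isT => h0; move: eK; rewrite h0 mul0r => /esym/eqP.
  by rewrite mulf_eq0 (negPf (natQ_neq0 (fact_gt0 _))) expf_eq0 (negPf (natQ_neq0 (isT : (0 < 2)%N))) andbF.
have C0 := varC_neq0; have J0 := varJ_neq0.
rewrite [X in _ / X](_ : _ = K * (P * varC ^+ size l * varJ ^+ sumn l)); last first.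
  by rewrite mulrA mulrA eK; ring.
exact (@mulf_div_cancel QCJT K _ _ K0).
Qed.

Lemma N_neg (h : int) l : (h < 0) -> N h l = 0.
Proof. by move=> h0; rewrite /N leNgt h0. Qed.

(** [conn_sum] is a formula in l, so the vanishing is obtained at an actual matching of type l,
    which exists because the count is nonzero. *)
Lemma conn_sum_genus k l : composition l -> (0 < size l)%N -> (k + 2 < sumn l + size l)%N ->
  conn k l = 0.
Proof.
move=> hl l0 hk; have n0 := composition_sumn hl l0.
have [x xL] := labelled_ex hl; have /labelledP[m hx _] := xL.
have T0 : [set: barset (sumn l)] != set0.
  by apply/set0Pn; exists (Ordinal n0, false); rewrite inE.
have px := labelled_perm xL.
rewrite -(trans_sum_conn _ _ _ k m (stableT _) T0 (_ : perm_eq l _)); last by rewrite perm_sym.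
apply: trans_sum_genus; rewrite ?stableT // -size_typ (perm_size px) cardsT card_prod card_ord card_bool.
move: hk; move: (sumn l) (size l) => u v; clear; lia.
Qed.

(* Commutes with tau, so conjugation by it moves components and keeps their sizes. *)
Definition swap_index n (a b : 'I_n) (x : barset n) : barset n := (tperm a b x.1, x.2).

Lemma swap_index_inj n (a b : 'I_n) : injective (swap_index a b).
Proof. by move=> [i c] [j d] [/perm_inj -> ->]. Qed.

Lemma comp_conj n (rho s : {perm barset n}) x : commute s (tau n) ->
  comp (rho ^ s)%g (s x) = s @: comp rho x.
Proof.
have half (r u : {perm barset n}) y : commute u (tau n) -> u @: comp r y \subset comp (r ^ u)%g (u y).
  move=> cu; rewrite sub_imset_pre.
  have hu w : (w \in u @^-1: comp (r ^ u)%g (u y)) = (u w \in comp (r ^ u)%g (u y)).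
    by rewrite in_set.
  apply: comp_min; last by rewrite hu comp_refl.
  apply/forall_inP => z; rewrite !hu => h.
  rewrite -[u (tau n z)]permM -cu permM (stable_tau (comp_stable _ _)) //=.
  rewrite (_ : u (r z) = (r ^ u)%g (u z)); last by rewrite conjpE permK.
  exact: stable_rho (comp_stable _ _) h.
move=> cs; apply/eqP; rewrite eqEsubset half // andbT.
have cs' : commute s^-1 (tau n) by apply: commute_sym; apply: commuteV; apply: commute_sym.
have := half (rho ^ s)%g s^-1%g (s x) cs'; rewrite conjgK permK => h.
apply/subsetP => y yc; have : s^-1%g y \in comp rho x by apply: (subsetP h); apply: imset_f.
by move=> h'; apply/imsetP; exists (s^-1%g y); rewrite // permKV.
Qed.

Lemma labelled_top l (r : 'I_(size l)) (i0 : 'I_(sumn l)) : composition l ->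
  exists2 x, x \in labelled_matchings (sumn l) (fun i : 'I_(size l) => nth 0%N l i) &
    (i0, false) \in x.2 r.
Proof.
move=> hl; have [x /labelledP[m hx sz]] := labelled_ex hl.
have [[a b] ar] := lab_neq0 hx r.
have {b ar} ar : (a, false) \in x.2 r.
  case: b ar => // ar; rewrite (lab_comp m hx ar).
  by rewrite -(stable_tauE _ (comp_stable _ _)) tauE comp_refl.
pose s := perm (@swap_index_inj _ a i0).
have cs : commute s (tau _).
  by apply/permP => -[i c]; rewrite !permM !permE.
exists ((x.1 ^ s)%g, [ffun i => s @: x.2 i]); last first.
  by rewrite ffunE; apply/imsetP; exists (a, false); rewrite // permE /swap_index /= tpermL.
apply/labelledP; split=> /=; first exact: matching_conj.
  split.
    by move=> i j _ _; rewrite !ffunE => /(imset_inj perm_inj); apply: (lab_inj hx).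
  apply/setP => B; apply/imsetP/imsetP => [[i _ ->]|[y _ ->]].
    have [y yi] := lab_neq0 hx i; exists (s y) => //.
    by rewrite ffunE (lab_comp m hx yi) comp_conj.
  have [i yi] := lab_ex hx (in_setT (s^-1%g y)); exists i => //.
  by rewrite ffunE (lab_comp m hx yi) -comp_conj // permKV.
by move=> i; rewrite ffunE card_imset ?sz //; apply: perm_inj.
Qed.

(** Both sides depend on the parts alone, so the matching may be chosen, by [labelled_top], with the
    largest vertex in the component of the given r. *)
Lemma conn_sum_rec k l (r : 'I_(size l)) : composition l ->
  let part (i : 'I_(size l)) := nth 0%N l i in
  conn k.+1 l =
  \sum_(j | j != r) (2 * part j)%:R * varC * conn k (subcomp (~: [set j]) r (part r + part j)%N)
  + (part r).-1%:R * varT * conn k l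
  + \sum_(i < (part r).-1) varJ * (conn k (split_part l r (part r - i.+1) i.+1) +
      \sum_(S : {set 'I_(size l)} | r \in S) \sum_(a < k.+1)
        conn a (subcomp S r i.+1) * conn (k - a) (subcomp (r |: ~: S) r (part r - i.+1))).
Proof.
move=> hl part; have l0 : (0 < size l)%N by apply: leq_ltn_trans (ltn_ord r).
have n0 := composition_sumn hl l0.
have n1 : ((sumn l).-1 < sumn l)%N by rewrite prednK.
have [x /labelledP[m hx sz] qr] := labelled_top r (Ordinal n1) hl.
apply: (conn_sum_rec_labelled varC varJ varT m (stableT _) hx sz qr) => y _ /=.
by rewrite -ltnS prednK.
Qed.

Section Ratios.
Variables (F : fieldType) (C J : F).
Hypothesis J0 : J != 0.
Local Notation d a := ((2 * a)%:R * C * J ^+ a).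

Lemma cross_ratio (x y D D' c : F) : D != 0 -> D' != 0 -> x * D' = y * D ->
  x * c / D = y * (c / D').
Proof.
move=> D0 D0' e; apply: (mulIf D0); rewrite mulfVK //.
by rewrite mulrA mulrAC [y * c]mulrC -[c * y * D]mulrA -e mulrA mulfK // mulrC.
Qed.

(** Here Q contains the factor d(b). The weight 2 b C of a join becomes p + b because d(p) d(b) /
    d(p + b) = 2 C p b / (p + b). *)
Lemma join_ratio (p b : nat) (Q D D' c : F) : D != 0 -> D' != 0 ->
  d b * D' = d (p + b)%N * Q -> D = d p * Q ->
  p%:R * ((2 * b)%:R * C * c / D) = (p + b)%:R * (c / D').
Proof.
move=> D0 D0' e1 e2.
rewrite (_ : p%:R * _ = p%:R * ((2 * b)%:R * C) * c / D); last by rewrite !mulrA.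
apply: cross_ratio => //.
apply: (mulfI (expf_neq0 b J0)).
transitivity (p%:R * (d b * D')); first by ring.
by rewrite e1 e2 exprD !natrM; ring.
Qed.

(** The same relation read the other way, d(a) d(b) / d(p) = 2 C a b / p, is the origin of the
    coefficient 2 C J alpha beta. *)
Lemma cut_ratio (a b p : nat) (Q D c : F) : D != 0 -> d a * (d b * Q) != 0 ->
  (a + b)%N = p -> D = d p * Q ->
  p%:R * (J * c / D) = 2%:R * C * J * a%:R * b%:R * (c / (d a * (d b * Q))).
Proof.
move=> D0 E0 ep eD; rewrite (_ : p%:R * (J * c / D) = p%:R * J * c / D); last by rewrite !mulrA.
by apply: cross_ratio => //; rewrite eD -ep exprD !natrM !natrD; ring.
Qed.

End Ratios.

Lemma composition_subcomp l (S : {set 'I_(size l)}) r a : composition l -> (0 < a)%N ->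
  composition (subcomp S r a).
Proof.
move=> hl a0; apply/allP => x /mapP[i _ ->]; case: ifP => // _.
exact: composition_nth.
Qed.

Lemma composition_split_part l r a b : composition l -> (0 < a)%N -> (0 < b)%N ->
  composition (split_part l r a b).
Proof.
move=> /allP hl a0 b0; rewrite /composition /split_part !all_cat /= a0 b0 /=.
by apply/andP; split; apply/allP => x; [move/mem_take | move/mem_drop]; apply: hl.
Qed.

Lemma size_subcomp_gt0 l (S : {set 'I_(size l)}) r a : r \in S -> (0 < size (subcomp S r a))%N.
Proof. by move=> rS; rewrite size_map -cardE; apply/card_gt0P; exists r. Qed.

Lemma composition_size l : composition l -> (size l <= sumn l)%N.
Proof.
elim: l => //= a l IH /andP[a0 /IH h]; rewrite -[X in (X <= _)%N]add1n.
exact: leq_add.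
Qed.

(** On each orbit the number of steps is its doubled genus plus a constant, sum plus number of parts
    minus 2; the constants shift the range. *)
Lemma sum_N_split (h k : nat) s1 s2 : composition s1 -> composition s2 ->
  (0 < size s1)%N -> (0 < size s2)%N ->
  (h + (sumn s1 + size s1) + (sumn s2 + size s2) = k + 4)%N ->
  (\sum_(a < k.+1) conn a s1 * conn (k - a) s2) / (parts_factor s1 * parts_factor s2) =
  \sum_(g < h.+1) N (g : nat)%:Z s1 * N (h - g)%N%:Z s2.
Proof.
move=> c1 c2 z1 z2 hk.
(* Each list has at least one part and a sum no smaller than its length, so the subtractions of 2
   are not truncated. *)
have l1 := composition_size c1; have l2 := composition_size c2.
set u := (sumn s1 + size s1 - 2)%N; set v := (sumn s2 + size s2 - 2)%N.
have ek : k = (u + h + v)%N by rewrite /u /v; lia.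
rewrite ek (sum_shift (F := fun a => conn a s1 * conn (u + h + v - a)%N s2)); last 2 first.
- by move=> a ha; rewrite conn_sum_genus ?mul0r //; rewrite /u in ha; lia.
- move=> a ha; rewrite [X in _ * X]conn_sum_genus ?mulr0 //; rewrite /v in ha *; lia.
rewrite mulr_suml; apply: eq_bigr => g _; have hg := ltn_ord g.
rewrite (N_conn (k := (u + g)%N)) //; last by rewrite /u; lia.
rewrite (N_conn (k := (u + h + v - (u + g))%N)) //; last by rewrite /u /v; lia.
by rewrite mulf_div.
Qed.

Section Step.
Variables (h k : nat) (m : seq nat) (r : 'I_(size m)).
Hypotheses (hm : composition m) (hk : (h + sumn m + size m = k + 3)%N).
Local Notation part i := (nth 0%N m i).

Let m0 : (0 < size m)%N. Proof. exact: leq_ltn_trans (ltn_ord r). Qed.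

Let D0 : parts_factor m != 0. Proof. exact: parts_factor_neq0. Qed.

Lemma join_term (j : 'I_(size m)) : j != r ->
  (part r)%:R * ((2 * part j)%:R * varC * conn k (subcomp (~: [set j]) r (part r + part j)%N)
     / parts_factor m) =
  (part r + part j)%:R * N h%:Z (subcomp (~: [set j]) r (part r + part j)%N).
Proof.
move=> jr; set s := subcomp _ _ _.
have rS : r \in ~: [set j] by rewrite !inE eq_sym.
have p0 : (0 < part r + part j)%N by rewrite addn_gt0 composition_nth.
have cs : composition s by apply: composition_subcomp.
have e1 := @big_subcomp_join _ 0%N addn id m r j (part r + part j)%N jr.
have e2 := @big_parts _ 0%N addn id m r.
have f1 := @big_subcomp_join _ 0%N addn (fun=> 1%N) m r j (part r + part j)%N jr.
have f2 := @big_parts _ 0%N addn (fun=> 1%N) m r.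
rewrite -/s -!sumnE -!size_sum /= in e1 e2 f1 f2.
rewrite (N_conn (k := k)) //; last 2 first.
- exact: size_subcomp_gt0.
- move: hk e1 e2 f1 f2; set x := (\sum_(_ in _) _)%N; set y := (\sum_(_ in _) _)%N; clear; lia.
apply: (@join_ratio QCJT varC varJ varJ_neq0 (part r) (part j)
  (\prod_(i in ~: [set r]) part_factor (part i)) _ _ _ D0 (parts_factor_neq0 cs)).
- exact: (@big_subcomp_join _ 1 *%R part_factor m r j (part r + part j)%N jr).
- exact: big_parts.
Qed.

Lemma twist_term :
  (part r)%:R * ((part r).-1%:R * varT * conn k m / parts_factor m) =
  (part r)%:R * ((part r)%:R - 1) * varT * N (h%:Z - 1) m.
Proof.
have p0 := composition_nth r hm.
rewrite -[X in _ * (X%:R - 1)](prednK p0) -[(_.-1).+1%:R]natr1 addrK -!mulrA.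
(* For h = 0 the right side has negative genus and is zero by definition; on the left there are too
   few steps. *)
congr (_ * (_ * (_ * _))); case: h hk => [|h'] hk'.
  by rewrite N_neg // conn_sum_genus ?mul0r //; lia.
by rewrite (_ : h'.+1%:Z - 1 = h'%:Z) ?(N_conn (k := k)) //; lia.
Qed.

Let split_arith (h' k' n q a b x y s1 s2 z1 z2 : nat) :
  (h' + n + q = k' + 3)%N -> (s1 + s2 = b + (a + x))%N -> (n = a + b + x)%N ->
  (z1 + z2 = 1 + (1 + y))%N -> (q = 1 + y)%N -> (h' + (s1 + z1) + (s2 + z2) = k' + 4)%N.
Proof. lia. Qed.

Lemma cut_term (a b : nat) : (0 < a)%N -> (0 < b)%N -> (a + b)%N = part r ->
  (part r)%:R * (varJ * (conn k (split_part m r a b) +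
      \sum_(S : {set 'I_(size m)} | r \in S) \sum_(i < k.+1)
        conn i (subcomp S r b) * conn (k - i) (subcomp (r |: ~: S) r a)) / parts_factor m) =
  2%:R * varC * varJ * a%:R * b%:R *
   (N (h%:Z - 2) (split_part m r a b) +
    \sum_(g : 'I_h.+1 * 'I_h.+1 | (g.1 + g.2 == h)%N)
      \sum_(I : {set 'I_(size m)} * {set 'I_(size m)}
         | (I.1 :|: I.2 == setT) && (I.1 :&: I.2 == [set r]))
       N (g.1 : nat)%:Z (subcomp I.1 r b) * N (g.2 : nat)%:Z (subcomp I.2 r a)).
Proof.
move=> a0 b0 ab; pose Q := \prod_(i in ~: [set r]) part_factor (part i).
have cs : composition (split_part m r a b) by apply: composition_split_part.
have eE : parts_factor (split_part m r a b) = part_factor a * (part_factor b * Q).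
  exact: big_split_part.
have E0 := parts_factor_neq0 cs; rewrite eE in E0.
have eD : parts_factor m = part_factor (part r) * Q by apply: big_parts.
rewrite (@cut_ratio _ varC varJ a b _ Q) //; congr (_ * _); rewrite mulrDl; congr (_ + _).
  have e1 := @big_split_part _ 0%N addn id m r a b.
  have e2 := @big_parts _ 0%N addn id m r.
  have f1 := @big_split_part _ 0%N addn (fun=> 1%N) m r a b.
  have f2 := @big_parts _ 0%N addn (fun=> 1%N) m r.
  rewrite -!sumnE -!size_sum /= in e1 e2 f1 f2.
  have sz : (sumn (split_part m r a b) = sumn m)%N by rewrite e1 e2 -ab addnA.
  have sz' : (size (split_part m r a b) = (size m).+1)%N by rewrite f1 [in RHS]f2.
  have z0 : (0 < size (split_part m r a b))%N by rewrite sz'.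
  transitivity (conn k (split_part m r a b) / parts_factor (split_part m r a b)).
    by rewrite eE.
  (* The genus drops by one, that is h by 2, so h = 0 and h = 1 are the vanishing cases. *)
  case: h hk => [|[|h']] hk'.
  - by rewrite N_neg // conn_sum_genus ?mul0r // sz sz'; lia.
  - by rewrite N_neg // conn_sum_genus ?mul0r // sz sz'; lia.
  by rewrite (_ : h'.+2%:Z - 2 = h'%:Z) ?(N_conn (k := k)) // ?sz ?sz'; lia.
rewrite (sum_pairs_eq h (fun g g' => \sum_(I : {set 'I_(size m)} * {set 'I_(size m)}
         | (I.1 :|: I.2 == setT) && (I.1 :&: I.2 == [set r]))
       N g%:Z (subcomp I.1 r b) * N g'%:Z (subcomp I.2 r a))).
under [RHS]eq_bigr => g _ do rewrite (sum_coverings r (fun S S' =>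
  N (g : nat)%:Z (subcomp S r b) * N (h - g)%N%:Z (subcomp S' r a))).
rewrite [RHS]exchange_big /= mulr_suml; apply: eq_bigr => S rS.
have rS' : r \in r |: ~: S by rewrite !inE eqxx.
rewrite -(@sum_N_split h k); try exact: composition_subcomp; try exact: size_subcomp_gt0.
  congr (_ / _); rewrite mulrCA; apply/esym.
  exact: (@big_subcomp2 _ 1 *%R part_factor m r S b a rS).
have e1 := @big_subcomp2 _ 0%N addn id m r S b a rS.
have e2 := @big_parts _ 0%N addn id m r.
have f1 := @big_subcomp2 _ 0%N addn (fun=> 1%N) m r S b a rS.
have f2 := @big_parts _ 0%N addn (fun=> 1%N) m r.
rewrite -!sumnE -!size_sum /= in e1 e2 f1 f2.
by rewrite -ab in e2; apply: split_arith hk e1 e2 f1 f2.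
Qed.

End Step.

Lemma N_initial : N 0 [:: 1%N] = (2%:R * varC * varJ)^-1.
Proof.
rewrite (@N_conn 0 0 [:: 1%N]) // /parts_factor big_seq1 /part_factor.
rewrite (_ : conn 0 [:: 1%N] = 1) ?div1r //.
(* With a single part no proper index set contains it, so nothing is subtracted and only the empty
   walk remains. *)
rewrite /conn_sum /= big_pred0 ?subr0 ?mul1r ?addr0 // => S.
apply/negP => /andP[/exists_inP[i iS _]]; apply/negP; rewrite negbK.
by apply/eqP/setP => j; rewrite inE (ord1 j) -(ord1 i).
Qed.

Theorem theorem5p18 :
  (forall m : nat, num_transp 0 [:: m] < 1 ->
     N 0 [:: m] = (m == 1%N)%:R / (2%:R * varC * varJ))
  /\
  (forall (h : nat) (m : seq nat) (r : 'I_(size m)),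
     composition m -> 1 <= num_transp h%:Z m ->
     let part (i : 'I_(size m)) : nat := nth 0%N m i in
     (part r)%:R * N h%:Z m =
       \sum_(j : 'I_(size m) | j != r)
          (part r + part j)%:R
            * N h%:Z (subcomp (~: [set j]) r (part r + part j)%N)
       + (part r)%:R * ((part r)%:R - 1) * varT * N (h%:Z - 1) m
       + \sum_(ab : 'I_(part r).+1 * 'I_(part r).+1
                | [&& (0 < ab.1)%N, (0 < ab.2)%N & (ab.1 + ab.2 == part r)%N])
            2%:R * varC * varJ * (ab.1 : nat)%:R * (ab.2 : nat)%:R *
            (N (h%:Z - 2) (split_part m r ab.1 ab.2)
             + \sum_(g : 'I_h.+1 * 'I_h.+1 | (g.1 + g.2 == h)%N)
                 \sum_(I : {set 'I_(size m)} * {set 'I_(size m)}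
                        | (I.1 :|: I.2 == setT) && (I.1 :&: I.2 == [set r]))
                    N (g.1 : nat)%:Z (subcomp I.1 r ab.2)
                    * N (g.2 : nat)%:Z (subcomp I.2 r ab.1))).
Proof.
split=> [m hm|h m r hm hk part].
  (* For h = 0 and one part, k = m - 1: it is negative at m = 0, zero at m = 1, and excluded by the
     hypothesis beyond. *)
  case: m hm => [|[|m]] hm; last by rewrite /num_transp /= in hm; lia.
    by rewrite /N /num_transp /= mul0r.
  by rewrite N_initial div1r.
have m0 : (0 < size m)%N by apply: leq_ltn_trans (ltn_ord r).
have [k ek] : exists k, (h + sumn m + size m = k + 3)%N.
  (* The offset 3 makes k + 1 the number of transpositions, so a last step can be removed. *)
  by exists (h + sumn m + size m - 3)%N; rewrite /num_transp in hk; lia.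
rewrite (N_conn (k := k.+1)) //; last by lia.
rewrite (conn_sum_rec k r hm) -/part 2!mulrDl 2!mulrDr; congr (_ + _ + _).
- by rewrite mulr_suml mulr_sumr; apply: eq_bigr => j jr; apply: join_term.
- exact: twist_term.
rewrite (sum_compositions2 (part r) (fun a b => 2%:R * varC * varJ * a%:R * b%:R *
   (N (h%:Z - 2) (split_part m r a b) +
    \sum_(g : 'I_h.+1 * 'I_h.+1 | (g.1 + g.2 == h)%N)
      \sum_(I : {set 'I_(size m)} * {set 'I_(size m)}
         | (I.1 :|: I.2 == setT) && (I.1 :&: I.2 == [set r]))
       N (g.1 : nat)%:Z (subcomp I.1 r b) * N (g.2 : nat)%:Z (subcomp I.2 r a)))).
rewrite mulr_suml mulr_sumr; apply: eq_bigr => i _; have hi := ltn_ord i.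
by apply: cut_term => //; lia.
Qed.
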